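(* Let $L$ satisfy the standing assumptions (L1), (L2'), (L3) stated in the context. Let $x_0,x\in\mathbb{R}^n$, $t>0$, $u_0\in\mathbb{R}$, and let $\xi\in\Gamma^t_{x_0,x}$ be any minimizer of $J$ over $\mathcal{A}$, with $u_\xi$ the associated unique solution of the Carathéodory equation. Then: (1) Both $\xi$ and $u_\xi$ are of class $C^2$, and $\xi$ satisfies the Herglotz equation $$\frac{d}{ds}L_v(\xi(s),u_\xi(s),\dot\xi(s))=L_x(\xi(s),u_\xi(s),\dot\xi(s))+L_u(\xi(s),u_\xi(s),\dot\xi(s))\,L_v(\xi(s),u_\xi(s),\dot\xi(s))$$ for all $s\in[0,t]$. (2) Let $p(s)=L_v(\xi(s),u_\xi(s),\dot\xi(s))$ be the dual arc. Then $p$ is also of class $C^2$ and $(\xi,p,u_\xi)$ satisfies the Lie equation $$\begin{cases}\dot\xi(s)=H_p(\xi(s),u_\xi(s),p(s)),\\ \dot p(s)=-H_x(\xi(s),u_\xi(s),p(s))-H_u(\xi(s),u_\xi(s),p(s))\,p(s),\\ \dot u_\xi(s)=p(s)\cdot\dot\xi(s)-H(\xi(s),u_\xi(s),p(s)).\end{cases}$$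
   Context: Standing assumptions: $L:\mathbb{R}^n\times\mathbb{R}\times\mathbb{R}^n\to\mathbb{R}$, $(x,r,v)\mapsto L(x,r,v)$, is of class $C^2$ and satisfies: (L1) $L(x,r,\cdot)>0$ is strictly convex for all $(x,r)\in\mathbb{R}^n\times\mathbb{R}$. (L2') There exist two superlinear nondecreasing functions $\overline\theta_0,\theta_0:[0,+\infty)\to[0,+\infty)$ with $\theta_0(0)=0$, and $c_0>0$, such that $\overline\theta_0(|v|)\geqslant L(x,0,v)\geqslant\theta_0(|v|)-c_0$ for all $(x,v)\in\mathbb{R}^n\times\mathbb{R}^n$ (superlinear: $\theta(\rho)/\rho\to+\infty$ as $\rho\to+\infty$). Moreover there exist $R_0>1$ and, depending on the compact set $A\subset\mathbb{R}^n$, a constant $C_A>0$ such that $L(x,0,\rho v)\leqslant C_A(1+L(x,0,v))$ for all $\rho\in[1,R_0]$ and $(x,v)\in A\times\mathbb{R}^n$. (L3) There exists $K>0$ such that $|L_r(x,r,v)|\leqslant K$ for all $(x,r,v)\in\mathbb{R}^n\times\mathbb{R}\times\mathbb{R}^n$. Here $L_u$ and $L_r$ both denote the partial derivative of $L$ in its second (real) variable, and similarly $H_u$ for $H$. The Hamiltonian is $H(x,r,p)=\sup_{v\in\mathbb{R}^n}\{\langle p,v\rangle-L(x,r,v)\}$. Notation: $\Gamma^t_{x_0,x}=\{\xi\in W^{1,1}([0,t],\mathbb{R}^n):\xi(0)=x_0,\ \xi(t)=x\}$. $\mathcal{A}$ is the set of $\xi\in\Gamma^t_{x_0,x}$ for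 which the Carathéodory equation $\dot u_\xi(s)=L(\xi(s),u_\xi(s),\dot\xi(s))$ for a.e. $s\in[0,t]$, $u_\xi(0)=u_0$, admits an absolutely continuous solution $u_\xi$ on $[0,t]$ (which is then unique). For $\xi\in\mathcal{A}$, $J(\xi)=\int_0^tL(\xi(s),u_\xi(s),\dot\xi(s))\,ds$.
   Formalization: (L1) is strengthened: besides L>0 and strict convexity in v, the Hessian L_vv(x,r,v) is assumed positive definite; with strict convexity alone minimizers may fail to be C², e.g. n=1, L=1+v^4/4+V(x), V≥0 smooth bounded, V'(0)>0, x_0=x=0, t small. *)

(* Defs.v *)
(* Points of R^n are row vectors; functions on [0, t] are functions on R of which
   only the restriction to [0, t] is used. *)
From HB Require Import structures.
From mathcomp Require Import all_boot all_order all_algebra.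
From mathcomp Require Import all_classical all_reals all_analysis.

Set Implicit Arguments.
Unset Strict Implicit.
Unset Printing Implicit Defensive.

Import Order.TTheory GRing.Theory Num.Theory.
Import numFieldNormedType.Exports.

Local Open Scope classical_set_scope.
Local Open Scope ring_scope.

Section Euclidean.
Context {R : realType} {n : nat}.

Definition dotv (v w : 'rV[R]_n) : R := \sum_(i < n) v 0 i * w 0 i.

(* The library norm on 'rV[R]_n is the sup norm. *)
Definition enorm (v : 'rV[R]_n) : R := Num.sqrt (dotv v v).

Definition evec (i : 'I_n) : 'rV[R]_n := delta_mx 0 i.

End Euclidean.

(* Class C^k on a finite-dimensional space: all directional derivatives of
   order at most k exist and are continuous. *)
Fixpoint Ck {R : realType} {V W : normedModType R} (k : nat) (f : V -> W) :
    Prop :=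
  continuous f /\
  (if k is k'.+1 then
     forall w : V, (forall z, derivable f z w) /\ Ck k' ('D_w f)
   else True).

Section Interval.
Context {R : realType} {V : normedModType R}.

(* Derivative of f relative to [0, t], hence one-sided at 0 and t; it does not
   depend on the values of f outside [0, t]. *)
Definition has_der (t : R) (f : R -> V) (s : R) (d : V) : Prop :=
  (y - s)^-1 *: (f y - f s) @[y --> within `[0, t] s^'] --> d.

(* Meaningful at s only when has_der t f s d holds for some d. *)
Definition der (t : R) (f : R -> V) (s : R) : V :=
  lim ((y - s)^-1 *: (f y - f s) @[y --> within `[0, t] s^']).

Fixpoint Ck_on (t : R) (k : nat) (f : R -> V) : Prop :=
  {within `[0, t], continuous f} /\
  (if k is k'.+1 then
     (forall s, s \in `[0, t] -> has_der t f s (der t f s)) /\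
     Ck_on t k' (der t f)
   else True).

Definition abs_cont (t : R) (f : R -> V) : Prop :=
  forall e : R, 0 < e -> exists2 d : R, 0 < d &
    forall (m : nat) (a b : 'I_m -> R),
      (forall i, [/\ 0 <= a i, a i <= b i & b i <= t]) ->
      trivIset [set: 'I_m] (fun i => `]a i, b i[%classic) ->
      \sum_(i < m) (b i - a i) < d ->
      \sum_(i < m) `|f (b i) - f (a i)| < e.

End Interval.

Section Herglotz.
Context {R : realType} {n : nat}.
Notation E := 'rV[R]_n.
Implicit Types (F L : E -> R -> E -> R) (x p v w : E) (r : R).

Definition Dx F x r w : E := \row_i 'D_(evec i) (fun y => F y r w) x.
Definition Dr F x r w : R := derive1 (fun z : R => F x z w) r.
Definition Dv F x r w : E := \row_i 'D_(evec i) (F x r) w.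

Definition has_partials F x r w : Prop :=
  [/\ forall i, derivable (fun y => F y r w : R) x (evec i),
      derivable (fun z : R => F x z w : R) r 1 &
      forall i, derivable (F x r : E -> R) w (evec i)].

Definition C2_lagrangian L : Prop :=
  Ck 2 (fun z : E * R^o * E => L z.1.1 z.1.2 z.2 : R^o).

(* Strict convexity of L(x, r, .) is used in its nondegenerate form: the Hessian
   L_vv is positive definite.  Without this, minimizers need not be C^2, e.g.
   for n = 1 and L(x, r, v) = 1 + v^4 / 4 + V(x) with V smooth, bounded,
   nonnegative, V'(0) > 0, x0 = x = 0 and t small. *)
Definition cond_L1 L : Prop :=
  forall x r,
  [/\ forall v, 0 < L x r v,
      forall v w (a : R), v != w -> 0 < a -> a < 1 ->
        L x r (a *: v + (1 - a) *: w) < a * L x r v + (1 - a) * L x r w &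
      forall v w, w != 0 -> 0 < 'D_w ('D_w (L x r)) v].

(* theta stands for its restriction to [0, +oo[. *)
Definition superlinear_nondecreasing (theta : R -> R) : Prop :=
  [/\ forall r, 0 <= r -> 0 <= theta r,
      forall r s, 0 <= r -> r <= s -> theta r <= theta s &
      theta r / r @[r --> +oo] --> +oo].

Definition cond_L2' L : Prop :=
  (exists (ubtheta theta : R -> R) (c0 : R),
     [/\ superlinear_nondecreasing ubtheta,
         superlinear_nondecreasing theta,
         theta 0 = 0,
         0 < c0 &
         forall x v, theta (enorm v) - c0 <= L x 0 v <= ubtheta (enorm v)]) /\
  (exists2 R0 : R, 1 < R0 &
     forall A : set E, compact A -> exists2 CA : R, 0 < CA &
       forall (rho : R) x v, 1 <= rho <= R0 -> A x ->
         L x 0 (rho *: v) <= CA * (1 + L x 0 v)).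

Definition cond_L3 L : Prop :=
  exists2 K : R, 0 < K & forall x r v, `|Dr L x r v| <= K.

(* The supremum is finite when L is superlinear in v, as it is under the
   conditions above; sup is 0 by convention otherwise. *)
Definition hamiltonian L x r p : R :=
  sup (range (fun v => dotv p v - L x r v)).

(* W^{1,1}([0, t], R^n), with Sobolev curves identified with their absolutely
   continuous representatives. *)
Definition Gamma (t : R) (x0 x : E) (xi : R -> E) : Prop :=
  [/\ abs_cont t xi, xi 0 = x0 & xi t = x].

Definition caratheodory L (t u0 : R) (xi : R -> E) (u : R -> R) : Prop :=
  [/\ abs_cont t (u : R -> R^o),
      u 0 = u0 &
      \forall s \ae (@lebesgue_measure R), s \in `[0, t] ->
        has_der t (u : R -> R^o) s (L (xi s) (u s) (der t xi s))].

Definition calA L (t u0 : R) (x0 x : E) (xi : R -> E) : Prop :=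
  Gamma t x0 x xi /\ exists u, caratheodory L t u0 xi u.

(* J(xi) is J L t xi u for the solution u = u_xi of the Caratheodory equation,
   which is unique on [0, t]. *)
Definition J L (t : R) (xi : R -> E) (u : R -> R) : R :=
  Rintegral (@lebesgue_measure R) `[0, t] (fun s => L (xi s) (u s) (der t xi s)).

Definition minimizer L (t u0 : R) (x0 x : E) (xi : R -> E) (u : R -> R) :
    Prop :=
  [/\ calA L t u0 x0 x xi,
      caratheodory L t u0 xi u &
      forall (eta : R -> E) (w : R -> R), calA L t u0 x0 x eta -> caratheodory L t u0 eta w ->
        J L t xi u <= J L t eta w].

End Herglotz.

(* Main.v *)
(* Write g for the velocity of the minimizer xi, a priori only integrable.

   First, g is bounded.  Otherwise run xi at half speed where |g| is large and
   slightly faster on a set of positive measure where |g| is bounded, so that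
   the total duration is unchanged.  The difference D of the two actions solves
   an equation D' = m D + q with m bounded and q the gain of the change of
   speed; since 2 L(v/2) - L(v) tends to -oo as |v| does, by convexity and
   superlinearity, the integrating factor gives D(t) < 0, against minimality.

   Next, the first variation along xi + e phi, again with an integrating factor
   and with dominated convergence, yields the Du Bois-Reymond equation:
   L_v(xi, u, g) coincides almost everywhere with a Lipschitz function P such
   that P' = L_x + L_u P.

   Since L_vv is positive definite and L is superlinear, v |-> L_v(x, r, v) is a
   bijection whose inverse is Lipschitz on bounded sets.  Hence g agrees almost
   everywhere with a Lipschitz function, xi, u and P are C^1, and
   differentiating L_v(xi, u, xi') = P, with L_vv invertible, makes xi' a C^1
   function.  The same inverse is the maximizer in the definition of H, whose
   derivatives are then given by an envelope argument. *)
Require Import Defs.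
From HB Require Import structures.
From mathcomp Require Import all_boot all_order all_algebra.
From mathcomp Require Import all_classical all_reals all_analysis.
From mathcomp Require Import ring lra measurable_realfun.
Import Order.TTheory GRing.Theory Num.Theory.
Import numFieldNormedType.Exports.
Set Implicit Arguments.
Unset Strict Implicit.
Unset Printing Implicit Defensive.
Local Open Scope classical_set_scope.
Local Open Scope ring_scope.

(** * Absolutely continuous functions and their densities *)

Section AbsCont.
Context {R : realType}.
Implicit Types (t : R).

(** No growth in the velocity is known for [L_x] and [L_v], so a variation of the path cannot be
    differentiated before the velocity is known to be bounded. A change of speed keeps the path, and
    along a ray of velocities the convexity, positivity and superlinearity of [L] give the
    estimates; this is why it comes first. Every competitor must carry its own Caratheodory
    solution. It is sought as [u + D]: the equation for [D] is Lipschitz in [D] with constant a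
    multiple of [K], so Picard iteration solves it on all of [[0, t]], and since the action is
    [u t - u0], minimality gives [0 <= D t]. The equations hold only almost everywhere and
    [abs_cont] is an epsilon-delta condition, so the calculus rests on the theorem that an
    absolutely continuous function is the integral of its derivative, obtained here from the
    Radon-Nikodym theorem. Strong monotonicity of [L_v] replaces the implicit function theorem: it
    makes the velocity Lipschitz, and a Lipschitz velocity can be differentiated with the Hessian
    [L_vv] frozen at the base point. *)

Lemma abs_cont_fin {V : normedModType R} t (f : R -> V) : abs_cont t f ->
  forall e : R, 0 < e -> exists2 d : R, 0 < d &
    forall (I : finType) (a b : I -> R),
      (forall i, [/\ 0 <= a i, a i <= b i & b i <= t]) ->
      trivIset [set: I] (fun i => `]a i, b i[%classic) ->
      \sum_i (b i - a i) < d ->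
      \sum_i `|f (b i) - f (a i)| < e.
Proof.
move=> fac e /fac[d d0 H]; exists d => // I a b ab tI sd.
have eqs (F : I -> R) : \sum_i F i = \sum_(j < #|I|) F (enum_val j).
  by rewrite -(@big_enum_val _ _ _ I predT F); apply: eq_bigl => i; rewrite inE.
rewrite eqs; apply: H => //.
- apply/trivIsetP => i j _ _ ij.
  move/trivIsetP : tI => /(_ (enum_val i) (enum_val j) Logic.I Logic.I); apply.
  by apply: contra ij => /eqP/enum_val_inj ->.
- by rewrite -(eqs (fun i => b i - a i)).
Qed.

Lemma abs_cont_dist {V : normedModType R} t (f : R -> V) : abs_cont t f ->
  forall e : R, 0 < e -> exists2 d : R, 0 < d &
    forall a b, 0 <= a -> a <= b -> b <= t -> b - a < d -> `|f b - f a| < e.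
Proof.
move=> /abs_cont_fin fac e /fac[d d0 H]; exists d => // a b a0 ab bt bad.
have := H unit (fun=> a) (fun=> b); rewrite !big_const !card_unit/= !addr0.
apply => //.
by apply/trivIsetP => -[] [].
Qed.

(** Partitions in [itv_partition] list the points after [a]; with [a] put in front, piece [n] runs
    from [pt_nth a b s n] to [pt_nth a b s n.+1], for [n < size s]. *)
Definition pt_nth (a b : R) s n := nth b (a :: s) n.

Lemma variation_sum a b (f : R -> R) s :
  variation a b f s =
  \sum_(n < size s) `|f (pt_nth a b s n.+1) - f (pt_nth a b s n)|.
Proof. by rewrite /variation big_mkord. Qed.

Lemma pt_nth_lt a b s m n : itv_partition a b s -> (m < n)%N ->
  (n <= size s)%N -> pt_nth a b s m < pt_nth a b s n.
Proof.
move=> [sp _] mn ns; rewrite /pt_nth.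
rewrite (Order.POrderTheory.lt_sorted_ltn_nth b (s := a :: s))//.
by rewrite inE/= ltnS (leq_trans (ltnW mn)).
Qed.

(** All pieces of all the partitions form a single disjoint family of the same total length, to
    which the estimate applies at once. That family is indexed by dependent pairs (interval, piece),
    hence the arbitrary [finType] in the hypothesis. *)
Lemma variation_family_lt t (f : R -> R) (e d : R) :
  (forall (I : finType) (a b : I -> R),
      (forall i, [/\ 0 <= a i, a i <= b i & b i <= t]) ->
      trivIset [set: I] (fun i => `]a i, b i[%classic) ->
      \sum_i (b i - a i) < d ->
      \sum_i `|f (b i) - f (a i)| < e) ->
  forall (I : finType) (a b : I -> R),
      (forall i, [/\ 0 <= a i, a i <= b i & b i <= t]) ->
      trivIset [set: I] (fun i => `]a i, b i[%classic) ->
      \sum_i (b i - a i) < d ->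
  forall s : I -> seq R, (forall i, itv_partition (a i) (b i) (s i)) ->
  \sum_i variation (a i) (b i) f (s i) < e.
Proof.
move=> H I a b ab tI sd s sp.
pose J : finType := {i : I & 'I_(size (s i))}.
pose a' (j : J) := pt_nth (a (tag j)) (b (tag j)) (s (tag j)) (tagged j).
pose b' (j : J) := pt_nth (a (tag j)) (b (tag j)) (s (tag j)) (tagged j).+1.
have eqs (F : R -> R -> R) : \sum_(j : J) F (a' j) (b' j) =
  \sum_i \sum_(n < size (s i))
    F (pt_nth (a i) (b i) (s i) n) (pt_nth (a i) (b i) (s i) n.+1).
  symmetry.
  rewrite (@sig_big_dep _ _ _ I (fun i => 'I_(size (s i)) : finType) predT (fun i => predT)
    (fun i n => F (pt_nth (a i) (b i) (s i) n) (pt_nth (a i) (b i) (s i) n.+1)))/=.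
  by [].
under eq_bigr do rewrite variation_sum.
rewrite -(eqs (fun x y => `|f y - f x|)).
have aa' j : a (tag j) <= a' j.
  by apply: itv_partition_nth_ge => //; rewrite ltnS ltnW.
have bb' j : b' j <= b (tag j).
  by apply: itv_partition_nth_le => //; rewrite ltnS.
have a'b' j : a' j < b' j by apply: pt_nth_lt.
apply: H.
- move=> j; split; last by case: (ab (tag j)) => _ _; apply: le_trans.
  + by case: (ab (tag j)) => + _ _ => /le_trans; apply.
  + exact: ltW.
- apply/trivIsetP => -[i m] [j n] _ _ ij; apply/seteqP; split=> // x [].
  have := aa' (Tagged (fun i => 'I_(size (s i))) m).
  have := bb' (Tagged (fun i => 'I_(size (s i))) m).
  have := aa' (Tagged (fun i => 'I_(size (s i))) n).
  have := bb' (Tagged (fun i => 'I_(size (s i))) n).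
  rewrite /a' /b' /= => bn an bm am.
  rewrite !in_itv/= => /andP[x1 x2] /andP[x3 x4].
  have [eij|nij] := eqVneq i j; last first.
    move/trivIsetP : tI => /(_ i j Logic.I Logic.I nij)/seteqP[+ _] => /(_ x); apply.
    split; rewrite /= in_itv/=.
      by rewrite (le_lt_trans _ x1)// (lt_le_trans x2).
    by rewrite (le_lt_trans _ x3)// (lt_le_trans x4).
  subst j.
  have mn : m != n by apply: contra ij => /eqP ->.
  have le k l : (k <= l)%N -> (l <= size (s i))%N ->
      pt_nth (a i) (b i) (s i) k <= pt_nth (a i) (b i) (s i) l.
    rewrite leq_eqVlt => /predU1P[-> //|kl] ls.
    exact/ltW/(pt_nth_lt (sp i)).
  have [l|l|/val_inj l] := ltngtP m n; last by rewrite l eqxx in mn.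
  + have := lt_le_trans x2 (le _ _ l (ltnW (ltn_ord n))).
    by move=> /lt_trans/(_ x3); rewrite ltxx.
  + have := lt_le_trans x4 (le _ _ l (ltnW (ltn_ord m))).
    by move=> /lt_trans/(_ x1); rewrite ltxx.
- rewrite (eqs (fun x y => y - x)) (le_lt_trans _ sd)//.
  apply: ler_sum => i _.
  rewrite -(big_mkord xpredT (fun n => pt_nth (a i) (b i) (s i) n.+1 - pt_nth (a i) (b i) (s i) n)).
  rewrite telescope_sumr//= /pt_nth/=.
  have := itv_partition_nth_size (b i) (sp i) => /= ->.
  by [].
Qed.

Notation TV := total_variation.

(** Passage to the supremum over partitions: on each interval some partition comes within
    [r / (#|I| + 1)] of the total variation, so the losses add up to at most the arbitrary [r]. *)
Lemma total_variation_family_le t (f : R -> R) (e d : R) :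
  (forall (I : finType) (a b : I -> R),
      (forall i, [/\ 0 <= a i, a i <= b i & b i <= t]) ->
      trivIset [set: I] (fun i => `]a i, b i[%classic) ->
      \sum_i (b i - a i) < d ->
      \sum_i `|f (b i) - f (a i)| < e) ->
  forall (I : finType) (a b : I -> R),
      (forall i, [/\ 0 <= a i, a i <= b i & b i <= t]) ->
      trivIset [set: I] (fun i => `]a i, b i[%classic) ->
      \sum_i (b i - a i) < d ->
      (forall i, TV (a i) (b i) f \is a fin_num) /\
      \sum_i fine (TV (a i) (b i) f) <= e.
Proof.
move=> H I a b ab tI sd.
have ab' i : a i <= b i by case: (ab i).
have fin i : TV (a i) (b i) f \is a fin_num.
  rewrite ge0_fin_numE ?total_variation_ge0//.
  apply: (@le_lt_trans _ _ e%:E); last exact: ltry.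
  apply: ge_ereal_sup => _ /= [_ [s sp <-] <-].
  rewrite lee_fin; apply: ltW.
  have := @variation_family_lt _ _ _ _ H unit (fun=> a i) (fun=> b i) _ _ _ (fun=> s).
  rewrite !big_const !card_unit/= !addr0; apply => //.
    by apply/trivIsetP => -[] [].
  rewrite (le_lt_trans _ sd)// (bigD1 i)//= lerDl sumr_ge0// => j _.
  by rewrite subr_ge0.
split => //; apply/ler_addgt0Pr => r r0.
pose r' := r / (#|I|.+1%:R).
have r'0 : 0 < r' by rewrite divr_gt0.
have /choice[s Hs] : forall i, exists s, itv_partition (a i) (b i) s /\
    fine (TV (a i) (b i) f) - r' <= variation (a i) (b i) f s.
  move=> i; have [_ [_ [s sp <-] <-] lt] := ub_ereal_sup_adherent r'0 (fin i).
  exists s; split => //; rewrite -lee_fin EFinB fineK//; exact: ltW.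
have := variation_family_lt H ab tI sd (fun i => (Hs i).1).
move=> /ltW/(lerD)/(_ (lexx r)); apply: le_trans.
rewrite -lerBlDr; apply: (@le_trans _ _ (\sum_i (fine (TV (a i) (b i) f) - r'))).
  rewrite big_split/= lerD2l sumrN lerN2 big_const iter_addr_0 /r'.
  rewrite -[leLHS]mulr_natr -mulrA ler_piMr ?(ltW r0)// mulrC ler_pdivrMr// mul1r ler_nat.
  exact: leqnSn.
by apply: ler_sum => i _; case: (Hs i).
Qed.

(** Intervals shorter than [d] have variation at most 1; steps of length [d / 2] then reach any [s]
    by additivity. *)
Lemma abs_cont_TV_fin t (f : R -> R) : abs_cont t f ->
  forall s, 0 <= s <= t -> TV 0 s f \is a fin_num.
Proof.
move=> /abs_cont_fin/(_ 1 ltr01)[d d0 H].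
have small a b : 0 <= a -> a <= b -> b <= t -> b - a < d -> TV a b f \is a fin_num.
  move=> a0 ab bt bad.
  have [|||//] := @total_variation_family_le _ _ _ _ H unit (fun=> a) (fun=> b).
  - by [].
  - by apply/trivIsetP => -[] [].
  - by rewrite !big_const !card_unit/= !addr0.
  by move=> /(_ tt).
have d20 : 0 < d / 2 by rewrite divr_gt0.
have d2d : d / 2 < d by rewrite ltr_pdivrMr// ltr_pMr// ltr1n.
suff P n s : 0 <= s -> s <= t -> s <= n%:R * (d / 2) -> TV 0 s f \is a fin_num.
  move=> s /andP[s0 st]; apply: (P (Num.bound (s / (d / 2)))) => //.
  by rewrite -ler_pdivrMr// ltW// archi_boundP// divr_ge0// ltW.
elim: n s => [s s0 st|n ih s s0 st sn].
  rewrite mul0r => s0'; have -> : s = 0 by apply/le_anti; rewrite s0 s0'.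
  by rewrite total_variationxx.
have [sd|sd] := leP s (d / 2).
  by apply: small => //; rewrite subr0 (le_lt_trans sd).
have s20 : 0 <= s - d / 2 by rewrite subr_ge0 ltW.
have s2s : s - d / 2 <= s by rewrite gerBl ltW.
rewrite (total_variationD _ s20 s2s) fin_numD ih//=; last 2 first.
  - by rewrite (le_trans s2s).
  - by rewrite lerBlDr; move: sn; rewrite -[n.+1]addn1 natrD mulrDl mul1r.
by apply: small => //; rewrite subKr.
Qed.

(** The second part makes [TV 0 s f - f s] nondecreasing, so that [f] is a difference of two
    nondecreasing absolutely continuous functions. *)
Lemma abs_cont_TV t (f : R -> R) : abs_cont t f ->
  abs_cont t (fun s => fine (TV 0 s f) : R^o) /\
  (forall a b, 0 <= a -> a <= b -> b <= t ->
     `|f b - f a| <= fine (TV 0 b f) - fine (TV 0 a f)).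
Proof.
move=> fac; have fin := abs_cont_TV_fin fac.
have TVB a b : 0 <= a -> a <= b -> b <= t ->
    TV a b f \is a fin_num /\ fine (TV 0 b f) - fine (TV 0 a f) = fine (TV a b f).
  move=> a0 ab bt; have := fin b; rewrite (total_variationD _ a0 ab).
  rewrite fin_numD (le_trans a0 ab) bt => /(_ isT)/andP[f1 f2]; split => //.
  by rewrite fineD//= addrC addKr.
split=> [e e0|a b a0 ab bt]; last first.
  have [fi ->] := TVB _ _ a0 ab bt.
  by rewrite -lee_fin fineK// total_variation_ge.
have e20 : 0 < e / 2 by rewrite divr_gt0.
have [d d0 H] := abs_cont_fin fac e20; exists d => // m a b ab tI sd.
have [_ le] := total_variation_family_le H ab tI sd.
apply: (@le_lt_trans _ _ (e / 2)); last by rewrite ltr_pdivrMr// ltr_pMr// ltr1n.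
rewrite (le_trans _ le)//; apply: ler_sum => i _; have [a0 ab' bt] := ab i.
have [fi ->] := TVB _ _ a0 ab' bt.
by rewrite ger0_norm// fine_ge0// total_variation_ge0.
Qed.

End AbsCont.

(** * Densities of nondecreasing absolutely continuous functions *)

Section Stieltjes.
Context {R : realType}.
Notation mu := (@lebesgue_measure R).
Implicit Types (t : R).

Lemma open_interval_inf_sup (X : set R) : open X -> is_interval X ->
  has_lbound X -> has_ubound X -> X = `]inf X, sup X[%classic.
Proof.
move=> oX iX lX uX; rewrite -{1}(interior_id X).1//.
rewrite interval_bounded_interior//; apply/seteqP; split => x/=; rewrite in_itv//.
Qed.

Section mono.
Variables (t : R) (F : R -> R).
Hypothesis t0 : 0 < t.
Hypothesis Fac : abs_cont t (F : R -> R^o).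
Hypothesis Fnd : forall a b, 0 <= a -> a <= b -> b <= t -> F a <= F b.

(** Composing with this projection onto [[0, t]] extends [F] by constants to the whole line, where a
    Stieltjes measure can be attached to it. *)
Definition clamp (t s : R) : R := Num.max 0 (Num.min s t).

Lemma clamp_itv s : 0 <= clamp t s <= t.
Proof. by rewrite /clamp le_max lexx/= ge_max (ltW t0)/= ge_min lexx orbT. Qed.

Lemma clamp_id s : 0 <= s <= t -> clamp t s = s.
Proof. by move=> /andP[s0 st]; rewrite /clamp min_l// max_r. Qed.

Lemma clamp_nd a b : a <= b -> clamp t a <= clamp t b.
Proof.
move=> ab; rewrite /clamp ge_max le_max lexx/= le_max.
by apply/orP; right; rewrite le_min !ge_min ab lexx orbT.
Qed.

Lemma clamp_dist a b : a <= b -> clamp t b - clamp t a <= b - a.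
Proof.
move=> ab; rewrite /clamp; case: (leP b t) => bt.
- rewrite (min_l (le_trans ab bt)); case: (leP 0 b); case: (leP 0 a) => //; lra.
- rewrite (max_r (ltW t0)); case: (leP a t) => at'; last first.
    by rewrite (max_r (ltW t0)) subrr subr_ge0.
  by case: (leP 0 a) => ?; lra.
Qed.

Let Fc s := F (clamp t s).

Let Fc_nd : {homo Fc : x y / x <= y}.
Proof.
move=> a b ab; have /andP[a0 _] := clamp_itv a; have /andP[_ bt] := clamp_itv b.
by apply: Fnd => //; exact: clamp_nd.
Qed.

Let Fc_cont : continuous Fc.
Proof.
have main e d : (forall a b, 0 <= a -> a <= b -> b <= t -> b - a < d -> `|F b - F a| < e) ->
    forall x y, `|x - y| < d -> `|Fc x - Fc y| < e.
  move=> H x y.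
  wlog : x y / x <= y => [W yx|xy yx].
    have [xy|/ltW yx'] := leP x y; first exact: W.
    by rewrite distrC; apply: W => //; rewrite distrC.
  have /andP[x0 _] := clamp_itv x; have /andP[_ yt] := clamp_itv y.
  rewrite distrC; apply: H => //; first exact: clamp_nd.
  rewrite (le_lt_trans (clamp_dist xy))// -(ger0_norm (_ : 0 <= y - x)) ?subr_ge0//.
  by rewrite distrC.
move=> x; apply/cvgrPdist_lt => e e0.
have [d d0 H] := abs_cont_dist Fac e0.
near=> y; apply: (main _ _ H).
by near: y; apply: cvgr_dist_lt => //; exact: cvg_id.
Unshelve. all: by end_near. Qed.

Let Fc_rc : right_continuous Fc.
Proof. by apply: right_continuousW => x; exact: Fc_cont. Qed.

HB.instance Definition _ := isCumulative.Build R _ R Fc Fc_nd Fc_rc.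

Let nu : {measure set (measurableTypeR R) -> \bar R} :=
  lebesgue_stieltjes_measure Fc.

Let nu_oc a b : a <= b -> nu `]a, b]%classic = (Fc b - Fc a)%:E.
Proof.
move=> ab; rewrite /nu/= /lebesgue_stieltjes_measure /measure_extension.
rewrite measurable_mu_extE/=; last exact: is_ocitv.
by rewrite wlength_itv_bnd.
Qed.

Let D : set (measurableTypeR R) := `]0, t]%classic.
Let mD : measurable D. Proof. exact: measurable_itv. Qed.
Let nuD : (nu D < +oo)%E. Proof. by rewrite nu_oc ?ltW// ltry. Qed.

Let nuF : {finite_measure set (measurableTypeR R) -> \bar R} := mfrestr mD nuD.

Let nuFE A : nuF A = nu (A `&` D). Proof. by []. Qed.

(** A null set lies in an open set of small measure, whose components are disjoint intervals of
    small total length; absolute continuity bounds the sum of the increments of [F] over them, which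
    is their [nu]-measure. *)
Let nuD_dom : nuF `<< mu.
Proof.
apply/null_content_dominatesP => A mA A0; rewrite nuFE.
apply/le_anti; rewrite measure_ge0 andbT.
apply/lee_addgt0Pr => e e0; rewrite add0e.
have e20 : 0 < e / 2 by rewrite divr_gt0.
have [d d0 H] := abs_cont_fin Fac e20.
have [|U [oU AU Ud]] := lebesgue_regularity_outer mA _ d0.
  by rewrite A0.
have {}Ud : (mu U < d%:E)%E.
  rewrite (_ : U = (U `\` A) `|` A); last first.
    by rewrite setUC setDUK.
  rewrite (le_lt_trans (measureU2 _ _ _))//.
    by apply: measurableD => //; exact: open_measurable.
  by rewrite A0 adde0.
(* The intersection with []0, t[] keeps the endpoints of the components inside [[0, t]]. *)
pose U' := U `&` `]0, t[%classic.
have oU' : open U' by apply: openI => //; exact: interval_open.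
pose I := open_disjoint_itv oU'.
have UI : U' = \bigcup_q I q := open_disjoint_itv_bigcup oU'.
have mI q : measurable (I q : set (measurableTypeR R)).
  by apply: (@open_measurable R); exact: open_disjoint_itv_open.
have It q : I q `<=` `]0, t[%classic.
  move=> x Ix; have : U' x by rewrite UI; exists q.
  by move=> [].
have tI : trivIset setT I by apply: open_disjoint_itv_trivIset.
pose a q := inf (I q); pose b q := sup (I q).
have IE q : I q = `]a q, b q[%classic.
  apply: open_interval_inf_sup.
  - exact: open_disjoint_itv_open.
  - exact: open_disjoint_itv_is_interval.
  - by exists 0 => x /It/=; rewrite in_itv/= => /andP[/ltW].
  - by exists t => x /It/=; rewrite in_itv/= => /andP[_ /ltW].
have abt q : [/\ 0 <= a q, a q <= b q & b q <= t].
  (* Some of the [I q] may be empty; then [inf] and [sup] are 0 by convention and the interval is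
     degenerate. *)
  have [I0|/set0P I0] := eqVneq (I q) set0.
    by rewrite /a /b I0 inf0 sup0; split => //; exact: ltW.
  have hl : has_lbound (I q).
    by exists 0 => x /It/=; rewrite in_itv/= => /andP[/ltW].
  have hu : has_ubound (I q).
    by exists t => x /It/=; rewrite in_itv/= => /andP[_ /ltW].
  split.
  - by apply: lb_le_inf => // x /It/=; rewrite in_itv/= => /andP[/ltW].
  - by case: I0 => x Ix; rewrite (@le_trans _ _ x)//; [exact: ge_inf|exact: ub_le_sup].
  - by apply: ge_sup => // x /It/=; rewrite in_itv/= => /andP[_ /ltW].
have Fsum N : (\sum_(0 <= q < N) nu (I q) <= (e / 2)%:E)%E.
  rewrite big_mkord.
  apply: (@le_trans _ _ (\sum_(q < N) (`|F (b q) - F (a q)|)%:E)%E).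
    apply: lee_sum => q _; have [a0 ab bt] := abt q.
    rewrite ger0_norm ?subr_ge0 ?Fnd//.
    have -> : (F (b q) - F (a q))%:E = nu `]a q, b q]%classic.
      by rewrite nu_oc// /Fc !clamp_id ?a0 ?bt ?(le_trans ab)//= (le_trans a0).
    rewrite IE; apply: le_measure; rewrite ?inE; [exact: measurable_itv..|].
    by move=> z; rewrite /= !in_itv/= => /andP[-> /ltW ->].
  rewrite sumEFin lee_fin ltW//.
  apply: (H 'I_N (fun q => a q) (fun q => b q)) => //.
    apply/trivIsetP => i j _ _ ij; rewrite -!IE.
    by move/trivIsetP : tI => /(_ i j Logic.I Logic.I); apply.
  rewrite -lte_fin (le_lt_trans _ Ud)// -sumEFin.
  apply: (@le_trans _ _ (\sum_(q < N) mu (I q))%E).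
    apply: lee_sum => q _; have [a0 ab bt] := abt q.
    rewrite IE lebesgue_measure_itv/= lte_fin.
    by case: ltP => [_|ba]; [exact: lexx|rewrite lee_fin subr_le0].
  have <- := measure_bigsetU mu mI tI N.
  apply: le_measure; rewrite ?inE; [exact: bigsetU_measurable|exact: open_measurable|].
  rewrite -bigcup_mkord => x [q _ Ix].
  by have : U' x; [rewrite UI; exists q|case].
have nuU : (nu U' <= (e / 2)%:E)%E.
  rewrite UI measure_semi_bigcup//; last by rewrite -UI; exact: open_measurable.
  apply: lime_le; first exact: is_cvg_nneseries.
  by apply: nearW => N; exact: Fsum.
(* The point [t] of [D] is missed by [U']; it is covered by a short interval []c, t]] over which [F]
   increases by less than [e / 2]. *)
have [d' d'0 H'] := abs_cont_dist Fac e20.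
pose c := Num.max 0 (t - d' / 2).
have c0 : 0 <= c by rewrite /c le_max lexx.
have ct : c < t by rewrite /c gt_max t0/= gtrBl divr_gt0.
apply: (@le_trans _ _ (nu (U' `|` `]c, t]%classic))).
  apply: le_measure; rewrite ?inE//.
  - exact: measurableI.
  - by apply: measurableU; [exact: open_measurable|exact: measurable_itv].
  move=> x [Ax]; rewrite /D/= !in_itv/= => /andP[x0].
  move=> xt; have [E|ne] := eqVneq x t; first by right; rewrite E ct lexx.
  by left; split; [exact: AU|rewrite /= in_itv/= x0 lt_neqAle ne].
apply: (le_trans (measureU2 _ _ _)).
- exact: open_measurable.
- exact: measurable_itv.
rewrite (splitr e) EFinD leeD//.
suff h : ((Fc t - Fc c)%:E <= (e / 2)%:E)%E.
  by apply: le_trans h; rewrite -(nu_oc (ltW ct)); exact: lexx.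
rewrite lee_fin ltW// (le_lt_trans (ler_norm _))//.
rewrite /Fc !clamp_id ?lexx ?(ltW t0) ?(ltW ct) ?c0//.
apply: H' => //; first exact: ltW.
rewrite ltrBlDr -ltrBlDl (@lt_le_trans _ _ (t - d' / 2))//; last first.
  by rewrite /c le_max lexx orbT.
by rewrite ltrD2l ltrN2 ltr_pdivrMr// ltr_pMr// ltr1n.
Qed.

(** The density is the Radon-Nikodym derivative of [nuF]; its integrals over the intervals []0, x]]
    recover the increments of [F]. *)
Lemma abs_cont_nondecreasing_density : exists g : R -> R,
  mu.-integrable setT (EFin \o g) /\
  (forall x, 0 <= x <= t -> F x = F 0 + Rintegral mu `[0, x] g).
Proof.
have [g [g0 gfin gint gE]] := radon_nikodym_sigma_finite nuD_dom.
exists (fine \o g).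
have gg : EFin \o (fine \o g) = g by apply/funext => x /=; rewrite fineK.
split; first by rewrite gg.
move=> x /andP[x0 xt].
have := gE `]0, x]%classic (measurable_itv _).
rewrite nuFE /D.
have -> : `]0%R, x]%classic `&` `]0%R, t]%classic = `]0%R, x]%classic.
  apply/seteqP; split => [y []//|y]; rewrite /= !in_itv/= => /andP[y0 yx].
  by rewrite y0 yx (le_trans yx).
rewrite nu_oc// /Fc clamp_id ?x0// clamp_id ?lexx ?(ltW t0)// => E.
rewrite /Rintegral -integral_itv_obnd_cbnd; last first.
  have := measurable_int _ gint; rewrite -gg; exact: measurable_funS.
have -> : (\int[mu]_(x0 in `]0%R, x]) ((fine \o g) x0)%:E)%E = (F x - F 0)%:E.
  by rewrite E; apply: eq_integral => y _ /=; rewrite fineK.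
by rewrite /= addrC subrK.
Qed.

End mono.
End Stieltjes.

(** * Derivatives relative to an interval *)

Section HasDer.
Context {R : realType}.
Implicit Types (t s : R).

Lemma quotient_norm {V : normedModType R} (a : R) (v d : V) : a != 0 ->
  `|a^-1 *: v - d| * `|a| = `|v - a *: d|.
Proof. by move=> a0; rewrite mulrC -normrZ scalerBr scalerA divff// scale1r. Qed.

(** Multiplied out, the difference quotient becomes an estimate that also holds at [y = s], so later
    uses need no case distinction. *)
Lemma has_derP {V : normedModType R} t (f : R -> V) s (d : V) :
  has_der t f s d <-> forall e : R, 0 < e -> exists2 r : R, 0 < r &
    forall y, 0 <= y <= t -> `|y - s| < r ->
    `|f y - f s - (y - s) *: d| <= e * `|y - s|.
Proof.
rewrite /has_der; split.
- move=> H e e0; move/cvgrPdist_le : H => /(_ e e0).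
  rewrite /within/= -nbhs_nearE => -[r /= r0 H]; exists r => // y yt ys.
  have [->|ne] := eqVneq y s; first by rewrite !subrr scale0r subrr !normr0 mulr0.
  have /= := H y _ ne; rewrite distrC => /(_ ys).
  rewrite in_itv/= => /(_ yt); rewrite distrC => /(ler_wpM2r (normr_ge0 (y - s))).
  by rewrite quotient_norm// subr_eq0.
- move=> H; apply/cvgrPdist_le => e e0; have [r r0 {}H] := H e e0.
  exists r => //= y ys ne; rewrite /= in_itv/= => yt.
  have ys0 : 0 < `|y - s| by rewrite normr_gt0 subr_eq0.
  rewrite -(ler_pM2r ys0); apply: le_trans (H y yt _); last by rewrite distrC.
  by rewrite distrC quotient_norm// subr_eq0.
Qed.

(** For [0 < t] every point of [[0, t]] is an accumulation point of [[0, t]]; limits along this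
    filter, and so relative derivatives, are then unique. *)
Lemma within_dnbhs_proper t s : 0 < t -> 0 <= s <= t ->
  ProperFilter (within `[0, t]%classic s^').
Proof.
move=> t0 /andP[s0 st]; apply: Build_ProperFilter_ex => P [e /= e0 H].
have [ss|ss] := ltP s t.
- pose y := Num.min t (s + e / 2).
  have sy : s < y by rewrite /y lt_min ss ltrDl divr_gt0.
  exists y; apply: H => /=.
  + rewrite distrC gtr0_norm ?subr_gt0// ltrBlDl (@le_lt_trans _ _ (s + e / 2))//.
      by rewrite /y ge_min lexx orbT.
    by rewrite ltrD2l ltr_pdivrMr// ltr_pMr// ltr1n.
  + by rewrite gt_eqF.
  + by rewrite in_itv/= (le_trans s0 (ltW sy))/= /y ge_min lexx.
- have {ss}ss : s = t by apply/le_anti; rewrite st ss.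
  pose y := Num.max 0 (s - e / 2).
  have sy : y < s by rewrite /y gt_max gtrBl divr_gt0// ss t0.
  exists y; apply: H => /=.
  + rewrite gtr0_norm ?subr_gt0// ltrBlDl -ltrBlDr (@lt_le_trans _ _ (s - e / 2))//.
      by rewrite ltrD2l ltrN2 ltr_pdivrMr// ltr_pMr// ltr1n.
    by rewrite /y le_max lexx orbT.
  + by rewrite lt_eqF.
  + by rewrite in_itv/= /y le_max lexx/= -/y -ss ltW.
Qed.

Lemma has_der_der {V : normedModType R} t (f : R -> V) s (d : V) :
  0 < t -> 0 <= s <= t -> has_der t f s d -> der t f s = d.
Proof.
move=> t0 st H; rewrite /der; apply/cvg_lim => //.
exact: within_dnbhs_proper.
Qed.

Lemma has_der_unique {V : normedModType R} t (f : R -> V) s (d d' : V) :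
  0 < t -> 0 <= s <= t -> has_der t f s d -> has_der t f s d' -> d = d'.
Proof. by move=> t0 st /(has_der_der t0 st) <- /(has_der_der t0 st) <-. Qed.

Lemma has_der_eq {V : normedModType R} t (f g : R -> V) s (d : V) :
  0 <= s <= t ->
  (forall y, 0 <= y <= t -> f y = g y) -> has_der t f s d -> has_der t g s d.
Proof.
move=> st fg /has_derP H; apply/has_derP => e /H[r r0 {}H]; exists r => // y yt.
by rewrite -!fg//; exact: H.
Qed.

Lemma derivable_has_der {V : normedModType R} t (f : R -> V) s :
  derivable f s 1 -> has_der t f s ('D_1 f s).
Proof.
move=> /derivableP[fd fE]; move: fd => /cvg_ex[l fl].
have <- : l = 'D_1 f s by rewrite /derive; apply/esym/cvg_lim.
apply/has_derP => e e0; move/cvgrPdist_le : fl => /(_ e e0)[r /= r0 H].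
exists r => // y yt ys.
have [->|ne] := eqVneq y s; first by rewrite !subrr scale0r subrr !normr0 mulr0.
have /= := H (y - s); rewrite sub0r normrN => /(_ ys); rewrite subr_eq0 => /(_ ne).
rewrite /GRing.scale/= mulr1 subrK distrC => /(ler_wpM2r (normr_ge0 (y - s))).
by rewrite quotient_norm// subr_eq0.
Qed.

Lemma has_der_cst {V : normedModType R} t (c : V) s : has_der t (fun=> c) s 0.
Proof.
apply/has_derP => e e0; exists 1 => // y _ _.
by rewrite subrr scaler0 subrr normr0 mulr_ge0// ltW.
Qed.

Lemma has_derD {V : normedModType R} t (f g : R -> V) s (d d' : V) :
  has_der t f s d -> has_der t g s d' -> has_der t (fun y => f y + g y) s (d + d').
Proof.
move=> H1 H2; rewrite /has_der.
rewrite (_ : (fun y => _) = (fun y => (y - s)^-1 *: (f y - f s)) \+ (fun y => (y - s)^-1 *: (g y - g s))); first exact: cvgD.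
by apply/funext => y/=; rewrite -scalerDr opprD addrACA.
Qed.

Lemma has_derN {V : normedModType R} t (f : R -> V) s (d : V) :
  has_der t f s d -> has_der t (fun y => - f y) s (- d).
Proof.
move=> H1; rewrite /has_der.
rewrite (_ : (fun y => _) = (fun y => - ((y - s)^-1 *: (f y - f s)))); first exact: cvgN.
by apply/funext => y/=; rewrite -opprD scalerN.
Qed.

Lemma has_der_cont {V : normedModType R} t (f : R -> V) s (d : V) :
  has_der t f s d -> forall e : R, 0 < e -> exists2 r : R, 0 < r &
    forall y, 0 <= y <= t -> `|y - s| < r -> `|f y - f s| < e.
Proof.
move=> /has_derP/(_ 1 ltr01)[r r0 H] e e0.
pose M := 1 + `|d|; have M0 : 0 < M by rewrite ltr_wpDr.
exists (Num.min r (e / M)) => [|y yt]; first by rewrite lt_min r0 divr_gt0.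
rewrite lt_min => /andP[yr ye].
rewrite -(subrK ((y - s) *: d) (f y - f s)).
rewrite (le_lt_trans (ler_normD _ _))// (le_lt_trans (lerD (H y yt yr) (lexx _)))//.
by rewrite normrZ mulrC -mulrDr -/M -ltr_pdivlMr.
Qed.

Lemma has_derM t (f g : R -> R) s (d d' : R) : 0 <= s <= t ->
  has_der t (f : R -> R^o) s d -> has_der t (g : R -> R^o) s d' ->
  has_der t ((fun y => f y * g y) : R -> R^o) s (d * g s + f s * d').
Proof.
move=> st H1 H2; rewrite /has_der.
have gc : g y @[y --> within `[0, t]%classic s^'] --> g s.
  apply/cvgrPdist_lt => e /(has_der_cont H2)[r r0 H].
  exists r => //= y ys ne; rewrite /= in_itv/= => yt.
  by rewrite distrC; apply: H => //; rewrite distrC.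
rewrite (_ : (fun y => _) = (fun y => ((y - s)^-1 *: ((f y : R^o) - f s)) * g y) \+ (fun y => f s * ((y - s)^-1 *: ((g y : R^o) - g s)))).
  apply: cvgD; first exact: cvgM.
  by apply: cvgM => //; exact: cvg_cst.
apply/funext => y/=; rewrite /GRing.scale/=; ring.
Qed.

Lemma rV_norm_le {n} (v : 'rV[R]_n) (e : R) : 0 <= e ->
  (forall i, `|v 0 i| <= e) -> `|v| <= e.
Proof.
move=> e0 H; rewrite -[leLHS]/(mx_norm v) mx_normrE; apply: bigmax_le => // -[i j] _ /=.
by rewrite (ord1 i).
Qed.

Lemma le_rV_norm {n} (v : 'rV[R]_n) i : `|v 0 i| <= `|v|.
Proof. by rewrite -[leRHS]/(mx_norm v) mx_normrE (le_bigmax _ (fun ij => `|v ij.1 ij.2|) (0, i)). Qed.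

Lemma has_der_coord {n} t (f : R -> 'rV[R]_n) s (d : 'rV[R]_n) :
  has_der t f s d <-> forall i, has_der t ((fun y => f y 0 i) : R -> R^o) s (d 0 i).
Proof.
split=> [/has_derP H i|H].
- apply/has_derP => e /H[r r0 {}H]; exists r => // y yt /(H _ yt).
  by apply: le_trans; apply: le_trans (le_rV_norm _ i); rewrite !mxE.
- apply/has_derP => e e0.
  have /choice[r Hr] : forall i, exists r, 0 < r /\ forall y, 0 <= y <= t -> `|y - s| < r ->
      `|f y 0 i - f s 0 i - (y - s) * d 0 i| <= e * `|y - s|.
    by move=> i; have /has_derP/(_ e e0)[r r0 h] := H i; exists r.
  exists (\big[Num.min/1]_i r i) => [|y yt].
    by apply/bigmin_gtP; split => // i _; case: (Hr i).
  move=> /bigmin_gtP[_ yr]; apply: rV_norm_le; first by rewrite mulr_ge0// ltW.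
  by move=> i; have [_ /(_ y yt (yr i isT))] := Hr i; rewrite !mxE.
Qed.

End HasDer.

(** * Closure properties of absolutely continuous functions *)

Section IntervalFunctions.
Context {R : realType}.
Implicit Types (t : R).

(** Absolute continuity for a general function of intervals in place of [|f b - f a|]. It is stable
    under domination and sums, which handles coordinates, sums and products of absolutely continuous
    functions. *)
Definition ac_itv t (w : R -> R -> R) := forall e : R, 0 < e -> exists2 d : R, 0 < d &
    forall (m : nat) (a b : 'I_m -> R),
      (forall i, [/\ 0 <= a i, a i <= b i & b i <= t]) ->
      trivIset [set: 'I_m] (fun i => `]a i, b i[%classic) ->
      \sum_(i < m) (b i - a i) < d ->
      \sum_(i < m) w (a i) (b i) < e.

Lemma abs_contE {V : normedModType R} t (f : R -> V) :
  abs_cont t f = ac_itv t (fun a b => `|f b - f a|).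
Proof. by []. Qed.

Lemma ac_itv_le t (w w' : R -> R -> R) (C : R) :
  (forall a b, 0 <= a -> a <= b -> b <= t -> w a b <= C * w' a b) ->
  (forall a b, 0 <= w' a b) ->
  ac_itv t w' -> ac_itv t w.
Proof.
move=> ww w'0 H e e0; pose C' := Num.max C 1.
have C'0 : 0 < C' by rewrite lt_max ltr01 orbT.
have [|d d0 {}H] := H (e / C'); first by rewrite divr_gt0.
exists d => // m a b ab tI sd; have := H m a b ab tI sd.
rewrite ltr_pdivlMr// => /(le_lt_trans _); apply.
rewrite mulr_suml; apply: ler_sum => i _; have [a0 ab' bt] := ab i.
rewrite (le_trans (ww _ _ a0 ab' bt))// mulrC ler_wpM2l//.
by rewrite /C' le_max lexx.
Qed.

Lemma ac_itvD t (w w' : R -> R -> R) :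
  ac_itv t w -> ac_itv t w' -> ac_itv t (fun a b => w a b + w' a b).
Proof.
move=> H1 H2 e e0.
have e20 : 0 < e / 2 by rewrite divr_gt0.
have [d d0 {}H1] := H1 _ e20; have [d' d'0 {}H2] := H2 _ e20.
exists (Num.min d d') => [|m a b ab tI]; first by rewrite lt_min d0.
rewrite lt_min => /andP[sd sd']; rewrite big_split/= (splitr e) ltrD//.
  exact: H1.
exact: H2.
Qed.

Lemma ac_itv0 t : ac_itv t (fun=> fun=> 0).
Proof. by move=> e e0; exists 1 => // m a b _ _ _; rewrite big1. Qed.

Lemma ac_itv_sum t n (w : 'I_n -> R -> R -> R) :
  (forall i, ac_itv t (w i)) -> ac_itv t (fun a b => \sum_i w i a b).
Proof.
elim: n w => [w _|n ih w H].
  rewrite (_ : (fun a b => _) = (fun=> fun=> 0)); first exact: ac_itv0.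
  by apply/funext => a; apply/funext => b; rewrite big_ord0.
rewrite (_ : (fun a b => _) = (fun a b => w ord0 a b + \sum_i w (lift ord0 i) a b)).
  by apply: ac_itvD => //; apply: ih.
by apply/funext => a; apply/funext => b; rewrite big_ord_recl.
Qed.

Lemma abs_cont_coord n t (f : R -> 'rV[R]_n) :
  abs_cont t f <-> forall i, abs_cont t ((fun s => f s 0 i) : R -> R^o).
Proof.
split=> [H i|H]; rewrite abs_contE.
  apply: (@ac_itv_le t _ (fun a b => `|f b - f a|) 1) => //.
  by move=> a b _ _ _; rewrite mul1r; apply: le_trans (le_rV_norm _ i); rewrite !mxE.
apply: (@ac_itv_le t _ (fun a b => \sum_i `|f b 0 i - f a 0 i|) 1).
- move=> a b _ _ _; rewrite mul1r; apply: rV_norm_le; first exact: sumr_ge0.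
  by move=> i; rewrite !mxE (bigD1 i)//= lerDl sumr_ge0.
- by move=> a b; exact: sumr_ge0.
- exact: ac_itv_sum.
Qed.

Lemma abs_cont_le {V W : normedModType R} t (f : R -> V) (g : R -> W) (C : R) :
  (forall a b, 0 <= a -> a <= b -> b <= t -> `|f b - f a| <= C * `|g b - g a|) ->
  abs_cont t g -> abs_cont t f.
Proof. by move=> H; rewrite !abs_contE; exact: (@ac_itv_le t _ (fun a b => `|g b - g a|) C). Qed.

Lemma abs_contD {V : normedModType R} t (f g : R -> V) :
  abs_cont t f -> abs_cont t g -> abs_cont t (fun s => f s + g s).
Proof.
move=> H1 H2; rewrite abs_contE; apply: (@ac_itv_le t _ (fun a b => `|f b - f a| + `|g b - g a|) 1).
- by move=> a b _ _ _; rewrite mul1r opprD addrACA ler_normD.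
- by move=> a b; rewrite addr_ge0.
- exact: ac_itvD.
Qed.

Lemma abs_contN {V : normedModType R} t (f : R -> V) :
  abs_cont t f -> abs_cont t (fun s => - f s).
Proof.
apply: (@abs_cont_le _ _ t _ _ 1) => a b _ _ _.
by rewrite mul1r -opprD normrN.
Qed.

Lemma abs_cont_bounded {V : normedModType R} t (f : R -> V) : abs_cont t f ->
  exists2 M : R, 0 < M & forall s, 0 <= s <= t -> `|f s| <= M.
Proof.
move=> /abs_cont_dist/(_ 1 ltr01)[d d0 H].
have d20 : 0 < d / 2 by rewrite divr_gt0.
pose N := Num.bound (t / (d / 2)).
exists (1 + `|f 0| + N%:R); first by rewrite -addrA ltr_pwDl// addr_ge0.
have P n s : 0 <= s -> s <= t -> s <= n%:R * (d / 2) -> `|f s| <= `|f 0| + n%:R.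
  elim: n s => [s s0 st|n ih s s0 st sn].
    rewrite mul0r => s0'; have -> : s = 0 by apply/le_anti; rewrite s0 s0'.
    by rewrite addr0.
  have [sd|sd] := leP s (d / 2).
    rewrite -(subrK (f 0) (f s)) (le_trans (ler_normD _ _))// addrC lerD2l.
    apply: le_trans (_ : 1 <= _); last by rewrite ler1n.
    apply/ltW/H => //; rewrite subr0 (le_lt_trans sd)//.
    by rewrite ltr_pdivrMr// ltr_pMr// ltr1n.
  have s20 : 0 <= s - d / 2 by rewrite subr_ge0 ltW.
  have s2s : s - d / 2 <= s by rewrite gerBl ltW.
  rewrite -(subrK (f (s - d / 2)) (f s)) (le_trans (ler_normD _ _))// addrC.
  rewrite -[n.+1]addn1 natrD addrA lerD//.
    apply: ih => //; first exact: (le_trans s2s).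
    by rewrite lerBlDr; move: sn; rewrite -[n.+1]addn1 natrD mulrDl mul1r.
  by apply/ltW/H => //; rewrite subKr ltr_pdivrMr// ltr_pMr// ltr1n.
move=> s /andP[s0 st]; apply: (le_trans (P N s s0 st _)).
  by rewrite -ler_pdivrMr// (le_trans _ (ltW (archi_boundP _)))// ?ler_pM2r ?invr_gt0// divr_ge0 ?(ltW d20)// (le_trans s0).
by rewrite -addrA lerDr.
Qed.

Lemma abs_contM t (f g : R -> R) :
  abs_cont t (f : R -> R^o) -> abs_cont t (g : R -> R^o) ->
  abs_cont t ((fun s => f s * g s) : R -> R^o).
Proof.
move=> H1 H2; have [M M0 fM] := abs_cont_bounded H1.
have [N N0 gN] := abs_cont_bounded H2.
rewrite abs_contE.
apply: (@ac_itv_le t _ (fun a b => `|f b - f a| + `|g b - g a|) (M + N)).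
- move=> a b a0 ab bt.
  have -> : f b * g b - f a * g a = (f b - f a) * g b + f a * (g b - g a) by ring.
  rewrite (le_trans (ler_normD _ _))// !normrM mulrDr lerD//.
    rewrite mulrC ler_wpM2r// (le_trans (gN b _)) ?lerDr ?(ltW M0)//.
    by rewrite (le_trans a0).
  by rewrite ler_wpM2r// (le_trans (fM a _)) ?lerDl ?(ltW N0)// a0 (le_trans ab).
- by move=> a b; rewrite addr_ge0.
- exact: ac_itvD.
Qed.

(** Under a nondecreasing [C]-Lipschitz map, the open intervals between the images of the endpoints
    remain disjoint, and their total length grows at most by the factor [C]. *)
Lemma abs_cont_comp_mono {V : normedModType R} t (f : R -> V) (rho : R -> R) (C : R) :
  0 < C -> rho 0 = 0 -> rho t = t ->
  (forall a b, 0 <= a -> a < b -> b <= t -> 0 <= rho b - rho a <= C * (b - a)) ->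
  abs_cont t f -> abs_cont t (f \o rho).
Proof.
move=> C0 r0 rt H fac e /fac[d d0 {}fac]; exists (d / C); first by rewrite divr_gt0.
have H' a b : 0 <= a -> a <= b -> b <= t -> 0 <= rho b - rho a <= C * (b - a).
  by move=> a0; rewrite le_eqVlt => /predU1P[->|/H]; [rewrite !subrr mulr0 lexx|exact].
move=> m a b ab tI sd /=; apply: (fac m (rho \o a) (rho \o b)) => /=.
- move=> i; have [a0 ab' bt] := ab i; split.
  + by have /andP[+ _] := H' _ _ (lexx 0) a0 (le_trans ab' bt); rewrite r0 subr0.
  + by have /andP[+ _] := H' _ _ a0 ab' bt; rewrite subr_ge0.
  + by have /andP[+ _] := H' _ _ (le_trans a0 ab') bt (lexx t); rewrite rt subr_ge0.
- apply/trivIsetP => i j _ _ ij; apply/seteqP; split => // x [].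
  rewrite /= !in_itv/= => /andP[x1 x2] /andP[x3 x4].
  have [a0 ab' bt] := ab i; have [a0' ab'' bt'] := ab j.
  (* Strict inequalities pull back along a nondecreasing map. Hence if the images overlap so do the
     intervals, and the middle of the overlap contradicts [tI]. *)
  have lt u v : 0 <= v -> u <= t -> rho u < rho v -> u < v.
    move=> u0 vt; rewrite !ltNge; apply: contra => vu.
    by have /andP[+ _] := H' _ _ u0 vu vt; rewrite subr_ge0.
  have aibj : a i < b j by apply: lt (lt_trans x1 x4); [exact: le_trans ab''|exact: le_trans bt].
  have ajbi : a j < b i by apply: lt (lt_trans x3 x2); [exact: le_trans ab'|exact: le_trans bt'].
  have aibi : a i < b i by apply: lt (lt_trans x1 x2); [exact: le_trans ab'|exact: le_trans bt].
  have ajbj : a j < b j by apply: lt (lt_trans x3 x4); [exact: le_trans ab''|exact: le_trans bt'].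
  move/trivIsetP : tI => /(_ i j Logic.I Logic.I ij)/seteqP[+ _].
  pose l := Num.max (a i) (a j); pose u := Num.min (b i) (b j).
  have lu : l < u by rewrite /l /u gt_max !lt_min aibi aibj ajbi ajbj.
  move=> /(_ ((l + u) / 2)); apply.
  have [m1 m2] := midf_lt lu.
  have [l1 l2] : a i <= l /\ a j <= l by rewrite /l !le_max !lexx orbT.
  have [u1 u2] : u <= b i /\ u <= b j by rewrite /u !ge_min !lexx orbT.
  by split; rewrite /= in_itv/= ?(le_lt_trans l1 m1) ?(le_lt_trans l2 m1) ?(lt_le_trans m2 u1) ?(lt_le_trans m2 u2).
- move: sd; rewrite ltr_pdivlMr// => /(le_lt_trans _); apply.
  rewrite mulr_suml; apply: ler_sum => i _; have [a0 ab' bt] := ab i.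
  by rewrite mulrC; have /andP[] := H' _ _ a0 ab' bt.
Qed.

End IntervalFunctions.

(** * Primitives of integrable functions: the fundamental theorem of Lebesgue *)

Section Primitive.
Context {R : realType}.
Notation mu := (@lebesgue_measure R).
Implicit Types (t : R).

Lemma aeS (P Q : R -> Prop) : (forall x, P x -> Q x) ->
  {ae mu, forall x, P x} -> {ae mu, forall x, Q x}.
Proof. by move=> PQ; apply: filterS => //; exact: (ae_filter_ringOfSetsType mu). Qed.

Lemma aeI (P Q Z : R -> Prop) : (forall x, P x -> Q x -> Z x) ->
  {ae mu, forall x, P x} -> {ae mu, forall x, Q x} -> {ae mu, forall x, Z x}.
Proof. by move=> PQ; apply: filterS2 => //; exact: (ae_filter_ringOfSetsType mu). Qed.

(** For [0 < t] and [g] integrable, equivalent to [f] being absolutely continuous with derivative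
    [g] almost everywhere, by [primitive_abs_cont], [primitive_has_der] and [has_der_primitive]. The
    a.e. differential equations below are carried in this form. *)
Definition primitive t (f g : R -> R) :=
  mu.-integrable `[0, t] (EFin \o g) /\
  forall x, 0 <= x <= t -> f x = f 0 + Rintegral mu `[0, x] g.

Lemma integrable_sub t (g : R -> R) x : x <= t ->
  mu.-integrable `[0, t] (EFin \o g) -> mu.-integrable `[0, x] (EFin \o g).
Proof.
move=> xt; apply: integrableS => //.
by apply: subset_itvl; rewrite bnd_simp.
Qed.

(** Jordan decomposition [f = V - (V - f)] with [V] the total variation: both terms are
    nondecreasing and absolutely continuous, and their densities subtract. *)
Lemma abs_cont_primitive t (f : R -> R) : 0 < t -> abs_cont t (f : R -> R^o) ->
  exists g, primitive t f g.
Proof.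
move=> t0 fac; have [Vac fV] := abs_cont_TV fac.
set V := fun s => _ in Vac.
have [|g [gint gE]] := abs_cont_nondecreasing_density t0 Vac.
  move=> a b a0 ab bt; rewrite -subr_ge0 (le_trans _ (fV a b a0 ab bt))//.
have Wac := abs_contD Vac (abs_contN fac).
have [|h [hint hE]] := abs_cont_nondecreasing_density t0 Wac.
  move=> a b a0 ab bt; rewrite -subr_ge0.
  by have := fV a b a0 ab bt; rewrite ler_norml /V => /andP[]; lra.
exists (fun x => g x - h x); split.
  rewrite (_ : EFin \o _ = ((EFin \o g) \- (EFin \o h))%E)//.
  by apply: integrableB => //; [apply: integrableS gint|apply: integrableS hint].
move=> x xt; have := gE x xt; have := hE x xt.
rewrite RintegralB//; [|by apply: integrableS gint|by apply: integrableS hint].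
by rewrite /V; lra.
Qed.

Lemma primitive_itv t (f g : R -> R) a b : primitive t f g ->
  0 <= a -> a <= b -> b <= t -> f b - f a = Rintegral mu `]a, b] g.
Proof.
move=> [gint gE] a0 ab bt.
have b0 := le_trans a0 ab; have at' := le_trans ab bt.
rewrite (gE b) ?b0// (gE a) ?a0// opprD addrACA subrr add0r.
by rewrite Rintegral_itvB ?bnd_simp//; exact: integrable_sub gint.
Qed.

Lemma integrable_patch t (g : R -> R) : mu.-integrable `[0, t] (EFin \o g) ->
  mu.-integrable setT (EFin \o (g \_ `[0, t])).
Proof.
move=> H; rewrite (_ : EFin \o _ = (EFin \o g) \_ `[0, t]).
  by rewrite -integrable_mkcond.
by apply/funext => x /=; rewrite /patch; case: ifP.
Qed.

Lemma primitive_abs_cont t (f g : R -> R) : primitive t f g ->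
  abs_cont t (f : R -> R^o).
Proof.
move=> fg e e0; have [gint _] := fg.
have gi := integrable_patch gint.
have [d [d0 H]] := integral_normr_continuous gi e0.
exists d => // m a b ab tI sd.
have mI i : measurable (`]a i, b i[%classic : set (measurableTypeR R)) by exact: measurable_itv.
have giA (A : set (measurableTypeR R)) : measurable A ->
    mu.-integrable A (EFin \o (g \_ `[0, t])).
  by move=> mA; apply: integrableS gi.
apply: (@le_lt_trans _ _ (\sum_(i < m) Rintegral mu `]a i, b i[ (fun x => `|(g \_ `[0, t]) x|))).
  apply: ler_sum => i _; have [a0 ab' bt] := ab i.
  rewrite (primitive_itv fg a0 ab' bt) -Rintegral_itv_bndo_bndc; last first.
    apply: integrableS gint => //.
    move=> x; rewrite /= !in_itv/= => /andP[x1 x2].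
    by rewrite (le_trans a0 (ltW x1)) (le_trans (ltW x2)).
  have -> : Rintegral mu `]a i, b i[ g = Rintegral mu `]a i, b i[ (g \_ `[0, t]).
    apply: eq_Rintegral => x; rewrite inE/= in_itv/= => /andP[x1 x2]; rewrite /patch mem_set//=.
    by rewrite in_itv/= (le_trans a0 (ltW x1)) (le_trans (ltW x2)).
  by apply: le_normr_Rintegral => //; exact: giA.
have := H (\big[setU/set0]_(i < m) `]a i, b i[%classic).
rewrite /Rintegral.
have mU : measurable (\big[setU/set0]_(i < m) `]a i, b i[%classic : set (measurableTypeR R)).
  by apply: bigsetU_measurable => i _.
have tI' : trivIset [set` index_enum 'I_m] (fun i => `]a i, b i[%classic : set (measurableTypeR R)).
  exact: sub_trivIset tI.
have iabs (A : set (measurableTypeR R)) : measurable A ->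
  mu.-integrable A (fun x => `|(g \_ `[0, t]) x|%:E).
  by move=> mA; apply: (integrable_abse (giA _ mA)).
rewrite (integral_bigsetU_EFin _ mI (index_enum_uniq _) tI'); last first.
  by have /measurable_int := iabs _ mU.
rewrite sum_fine; last first.
  by move=> i _; apply: integrable_fin_num => //; exact: iabs.
apply => //.
rewrite (measure_bigsetU_ord mu _ mI tI) (le_lt_trans _ (_ : ((\sum_(i < m) (b i - a i))%:E < _)%E)) ?lte_fin//.
rewrite -[leRHS]sumEFin; apply: lee_sum => i _.
suff : (lebesgue_measure (`]a i, b i[%classic : set R) <= (b i - a i)%:E)%E by [].
rewrite lebesgue_measure_itv/= lte_fin.
have [a0 ab' bt] := ab i.
by case: ifP => _; rewrite ?EFinB// lee_fin subr_ge0.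
Qed.

Lemma primitive_has_der t (f g : R -> R) : 0 < t -> primitive t f g ->
  {ae mu, forall s, 0 <= s <= t -> has_der t (f : R -> R^o) s (g s)}.
Proof.
move=> t0 [gint gE]; have gi := integrable_patch gint.
have gY y : mu.-integrable [set` Interval (BLeft 0) (BRight y)] (EFin \o g \_ `[0, t]).
  by apply: integrableS gi.
have := FTC1 gY (open_integrable_locally openT gi).
(* The differentiation theorem concerns points strictly to the right of the lower end 0, which is
   discarded as a null set. *)
have ne0 : {ae mu, forall s, s != 0}.
  exists [set 0]; split; [exact: measurable_set1|exact: lebesgue_measure_set1|].
  by move=> x /= /negP; rewrite negbK => /eqP.
apply: aeI ne0 => s s0' Hs /andP[s0 st].
have [|dF FE] := Hs; first by rewrite /= lte_fin lt_neqAle eq_sym s0'.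
have := derivable_has_der t dF; rewrite -derive1E FE patchE mem_set; last first.
  by rewrite /= in_itv/= s0.
have H0 : has_der t ((fun=> f 0) : R -> R^o) s 0.
  by apply/has_derP => e e0; exists 1 => // y _ _; rewrite subrr scaler0 subrr normr0 mulr_ge0// ltW.
move=> H; have := has_derD H H0; rewrite addr0; apply: has_der_eq; first by rewrite s0.
move=> y /andP[y0 yt] /=; rewrite (gE y) ?y0// addrC; congr (_ + _).
apply: eq_Rintegral => z; rewrite inE/= in_itv/= => /andP[z0 zy].
by rewrite patchE mem_set//= in_itv/= z0 (le_trans zy).
Qed.

(** The density furnished by [abs_cont_primitive] coincides with [h] almost everywhere by uniqueness
    of derivatives. The product and exponential rules for [primitive] reduce through this to the
    pointwise rules. *)
Lemma has_der_primitive t (f h : R -> R) : 0 < t -> abs_cont t (f : R -> R^o) ->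
  mu.-integrable `[0, t] (EFin \o h) ->
  {ae mu, forall s, 0 <= s <= t -> has_der t (f : R -> R^o) s (h s)} ->
  primitive t f h.
Proof.
move=> t0 fac hint fh; have [g [gint gE]] := abs_cont_primitive t0 fac.
split => // x /andP[x0 xt]; rewrite gE ?x0//; congr (_ + fine _).
have gx := integrable_sub xt gint; have hx := integrable_sub xt hint.
apply: ae_eq_integral; [by []|exact: measurable_int gx|exact: measurable_int hx|].
have := primitive_has_der t0 (conj gint gE); apply: aeI fh => s hs gs.
rewrite /= in_itv/= => /andP[s0 sx]; have st : 0 <= s <= t by rewrite s0 (le_trans sx).
by rewrite (has_der_unique t0 st (hs st) (gs st)).
Qed.
Lemma primitive_eq t (f g h : R -> R) : 0 < t -> primitive t f g ->
  mu.-integrable `[0, t] (EFin \o h) ->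
  {ae mu, forall s, 0 <= s <= t -> g s = h s} -> primitive t f h.
Proof.
move=> t0 fg hint gh; apply: has_der_primitive => //; first exact: primitive_abs_cont fg.
have := primitive_has_der t0 fg; apply: aeI gh => s gh fs st.
by rewrite -gh//; exact: fs.
Qed.

Lemma integral_primitive t (h : R -> R) c : mu.-integrable `[0, t] (EFin \o h) ->
  primitive t (fun x => c + Rintegral mu `[0, x] h) h.
Proof.
move=> hint; split => // x xt.
by rewrite set_itv1 Rintegral_set1 addr0.
Qed.

Lemma primitiveM t (f g f' g' : R -> R) : 0 < t ->
  primitive t f f' -> primitive t g g' ->
  mu.-integrable `[0, t] (EFin \o (fun s => f' s * g s + f s * g' s)) ->
  primitive t (fun s => f s * g s) (fun s => f' s * g s + f s * g' s).
Proof.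
move=> t0 ff gg hint; apply: has_der_primitive => //.
  by apply: abs_contM; [exact: primitive_abs_cont ff|exact: primitive_abs_cont gg].
have := primitive_has_der t0 ff; have := primitive_has_der t0 gg.
by apply: aeI => s hg hf st; apply: has_derM => //; [exact: hf|exact: hg].
Qed.

Import HBNNSimple.

(* [h] is not assumed measurable: the integral of a nonnegative function is a
   supremum over simple functions, which ignores null sets. *)
Lemma ae_eq_integral_nonmeasurable t (g h : R -> R) :
  mu.-integrable `[0, t] (EFin \o g) -> (forall s, 0 <= h s) ->
  {ae mu, forall s, 0 <= s <= t -> h s = g s} ->
  Rintegral mu `[0, t] h = Rintegral mu `[0, t] g.
Proof.
move=> gint h0 [N [mN N0 gN]].
pose D : set (measurableTypeR R) := `[0, t]%classic.
have mD : measurable D by exact: measurable_itv.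
have mDN : measurable (D `\` N) by exact: measurableD.
have hg x : (D `\` N) x -> h x = g x.
  move=> [Dx Nx]; apply: contrapT => hgx; apply: Nx; apply: gN => /=.
  by move=> H; apply: hgx; apply: H; move: Dx; rewrite /D/= in_itv.
rewrite /Rintegral; congr fine.
rewrite [RHS](negligible_integral mN)//.
have hgE : (\int[mu]_(x in D `\` N) (g x)%:E = \int[mu]_(x in D `\` N) (h x)%:E)%E.
  by apply: eq_integral => x /set_mem /hg ->.
rewrite -/D hgE.
apply/le_anti/andP; split.
- rewrite [leLHS]integral_mkcond ge0_integralTE; last first.
    by move=> x; rewrite patchE; case: ifP => // _; rewrite lee_fin.
  apply: ge_ereal_sup => _ /= [k kh <-].
  rewrite -integralT_nnsfun -hgE [leRHS]integral_mkcond.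
  apply: ae_ge0_le_integral => //.
  + by move=> x _; rewrite lee_fin; exact: fun_ge0.
  + exact/measurable_EFinP.
  + move=> x _; rewrite patchE; case: ifPn => // /set_mem /hg <-.
    by rewrite lee_fin.
  + apply/(measurable_restrictT _ mDN).
    by apply: measurable_funS (measurable_int _ gint) => //; exact: subDsetl.
  + exists N; split => // x /= xk; apply: contrapT => Nx; apply: xk => _.
    apply: le_trans (kh x) _; rewrite !patchE.
    have [Dx|Dx] := pselect (D x).
      by rewrite !mem_set// hg.
    by rewrite !memNset// => -[].
- rewrite [leLHS]integral_mkcond [leRHS]integral_mkcond.
  rewrite !ge0_integralTE; last 2 first.
  + by move=> x; rewrite patchE; case: ifP => // _; rewrite lee_fin.
  + by move=> x; rewrite patchE; case: ifP => // _; rewrite lee_fin.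
  apply: le_ereal_sup => _ [k kh <-]; exists k => // x; apply: le_trans (kh x) _.
  rewrite !patchE; case: ifPn => [/set_mem[Dx _]|_]; first by rewrite mem_set.
  by case: ifP => // _; rewrite lee_fin.
Qed.

End Primitive.

(** * Integral equations *)

Section IntegrableOn.
Context {R : realType}.
Notation mu := (@lebesgue_measure R).
Implicit Types (t : R).

Notation intble t g := (mu.-integrable `[0, t] (EFin \o (g : R -> R))).
Notation meas t g := (measurable_fun (`[0, t]%classic : set (measurableTypeR R)) (g : R -> R)).

Lemma mItv t : measurable (`[0, t]%classic : set (measurableTypeR R)).
Proof. exact: measurable_itv. Qed.

Lemma intble_meas t (g : R -> R) : intble t g -> meas t g.
Proof. by move=> /measurable_int/measurable_EFinP. Qed.

Lemma intble_le t (g h : R -> R) : meas t g -> intble t h ->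
  (forall s, 0 <= s <= t -> `|g s| <= h s) -> intble t g.
Proof.
move=> mg ih gh; apply: (le_integrable (mItv t) _ _ ih).
  exact/measurable_EFinP.
by move=> x; rewrite /= in_itv/= lee_fin => /gh/le_trans; apply; exact: ler_norm.
Qed.

Lemma intble_bounded t (g : R -> R) M : meas t g ->
  (forall s, 0 <= s <= t -> `|g s| <= M) -> intble t g.
Proof.
move=> mg gM; apply: (@intble_le _ _ (fun=> M)) => //.
apply: continuous_compact_integrable; first exact: segment_compact.
by apply: continuous_subspaceT => x; exact: cvg_cst.
Qed.

Lemma intble_cst t (c : R) : intble t (fun=> c).
Proof. by apply: (intble_bounded (M := `|c|)) => [|s _]; [exact: measurable_cst|]. Qed.

Lemma intbleD t (g h : R -> R) : intble t g -> intble t h ->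
  intble t (fun s => g s + h s).
Proof.
move=> ig ih; rewrite (_ : EFin \o _ = ((EFin \o g) \+ (EFin \o h))%E)//.
exact: integrableD.
Qed.

Lemma intbleZ t (g : R -> R) c : intble t g -> intble t (fun s => c * g s).
Proof.
move=> ig; rewrite (_ : EFin \o _ = (fun x => c%:E * (EFin \o g) x)%E)//.
exact: integrableZl.
Qed.

Lemma intbleN t (g : R -> R) : intble t g -> intble t (fun s => - g s).
Proof.
move=> /(intbleZ (-1)); congr (_.-integrable _ _); apply/funext => x /=.
by rewrite mulN1r.
Qed.

Lemma intble_norm t (g : R -> R) : intble t g -> intble t (fun s => `|g s|).
Proof. by move=> /integrable_abse. Qed.

Lemma intble_Ml t (g h : R -> R) M : meas t g ->
  (forall s, 0 <= s <= t -> `|g s| <= M) -> intble t h ->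
  intble t (fun s => g s * h s).
Proof.
move=> mg gM ih; apply: (@intble_le _ _ (fun s => M * `|h s|)).
- by apply: measurable_funM => //; exact: intble_meas.
- by apply: intbleZ; exact: intble_norm.
- by move=> s /gM gs; rewrite normrM ler_wpM2r.
Qed.

Lemma within_cont_meas t (g : R -> R) : {within `[0, t]%classic, continuous g} -> meas t g.
Proof. by move=> cg; apply: (subspace_continuous_measurable_fun (mItv t)). Qed.

Lemma within_cont_dist {V : normedModType R} t (f : R -> V) :
  (forall s, 0 <= s <= t -> forall e : R, 0 < e -> exists2 d : R, 0 < d &
    forall y, 0 <= y <= t -> `|y - s| < d -> `|f y - f s| < e) <->
  {within `[0, t]%classic, continuous f}.
Proof.
split=> [H|].
- apply/subspace_continuousP => s; rewrite /= in_itv/= => st.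
  apply/cvgrPdist_lt => e /(H s st)[d d0 {}H].
  exists d => //= y; rewrite /= distrC => ys; rewrite in_itv/= => yt.
  by rewrite distrC; exact: H.
- move=> /subspace_continuousP H s st e e0.
  have := H s; rewrite /= in_itv/= => /(_ st)/cvgrPdist_lt/(_ e e0)[d /= d0 {}H].
  exists d => // y yt ys; rewrite distrC; apply: H; first by rewrite /= distrC.
  by rewrite /= in_itv.
Qed.

Lemma abs_cont_within {V : normedModType R} t (f : R -> V) : abs_cont t f ->
  {within `[0, t]%classic, continuous f}.
Proof.
move=> fac; apply/within_cont_dist => s /andP[s0 st] e e0.
have [d d0 H] := abs_cont_dist fac e0; exists d => // y /andP[y0 yt] ys.
have [sy|ys'] := leP s y.
  by apply: H => //; rewrite (le_lt_trans (ler_norm _)).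
by rewrite distrC; apply: H => //; [exact: ltW|rewrite (le_lt_trans (ler_norm _))// distrC].
Qed.

Lemma primitive_intble t (f g : R -> R) : primitive t f g -> intble t f.
Proof.
move=> /primitive_abs_cont fac; have [M M0 fM] := abs_cont_bounded fac.
by apply: (@intble_bounded _ _ M) => //; apply: within_cont_meas; exact: abs_cont_within.
Qed.

Lemma Rint_le t (g h : R -> R) s : 0 <= s <= t -> intble t g -> intble t h ->
  (forall x, 0 <= x <= t -> g x <= h x) ->
  Rintegral mu `[0, s] g <= Rintegral mu `[0, s] h.
Proof.
move=> /andP[s0 st] ig ih gh; apply: le_Rintegral => //; [exact: integrable_sub ig|exact: integrable_sub ih|].
by move=> x; rewrite /= in_itv/= => /andP[x0 xs]; apply: gh; rewrite x0 (le_trans xs).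
Qed.

Lemma Rint_abs_le t (g h : R -> R) s : 0 <= s <= t -> intble t g -> intble t h ->
  (forall x, 0 <= x <= t -> `|g x| <= h x) ->
  `|Rintegral mu `[0, s] g| <= Rintegral mu `[0, s] h.
Proof.
move=> st ig ih gh; apply: le_trans (Rint_le st (intble_norm ig) ih gh).
by move: st => /andP[s0 st]; apply: le_normr_Rintegral => //; exact: integrable_sub ig.
Qed.

Lemma Rint_mono t (g : R -> R) s : 0 <= s <= t -> intble t g ->
  (forall x, 0 <= x <= t -> 0 <= g x) ->
  Rintegral mu `[0, s] g <= Rintegral mu `[0, t] g.
Proof.
move=> /andP[s0 st] ig g0; rewrite -subr_ge0 Rintegral_itvB ?bnd_simp//.
apply: Rintegral_ge0 => x; rewrite /= in_itv/= => /andP[sx xt].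
by apply: g0; rewrite xt (le_trans s0 (ltW sx)).
Qed.

Lemma Rint_cst s (c : R) : 0 <= s -> Rintegral mu `[0, s] (fun=> c) = c * s.
Proof.
move=> s0; rewrite Rintegral_cst//.
have E : lebesgue_measure (`[0, s]%classic : set R) = s%:E.
  rewrite lebesgue_measure_itv/= lte_fin.
  by case: ltgtP s0 => // [_ _|<- _]; rewrite ?sube0.
by rewrite [X in fine X](E : mu _ = _).
Qed.

Lemma C1_primitive t (f g : R -> R) : 0 < t ->
  (forall x : R, is_derive x 1 f (g x)) -> continuous g -> primitive t f g.
Proof.
move=> t0 fg cg.
have gw s : {within `[0, s]%classic, continuous g} by apply: continuous_subspaceT.
have fc : continuous f.
  by move=> x; apply/differentiable_continuous/derivable1_diffP; exact: (@ex_derive _ _ _ _ _ _ _ (fg x)).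
split; first by apply: continuous_compact_integrable => //; exact: segment_compact.
move=> x /andP[]; rewrite le_eqVlt => /predU1P[<- _|x0 xt].
  by rewrite set_itv1 Rintegral_set1 addr0.
rewrite /Rintegral (@continuous_FTC2 _ _ f)//=; last 2 first.
- split => [y _||]; first exact: (@ex_derive _ _ _ _ _ _ _ (fg y)).
  + exact/cvg_at_right_filter/fc.
  + exact/cvg_at_left_filter/fc.
- by move=> y _; rewrite derive1E; exact: derive_val.
by rewrite addrC; lra.
Qed.

(** The weight [expR (2 * K * x)] makes [K] times integration a contraction of ratio [1 / 2], on an
    interval of any length; see [picard_solution]. *)
Lemma expR_lin_int (K : R) s t : 0 < K -> 0 < t -> 0 <= s <= t ->
  intble t (fun x => K * expR (2 * K * x)) /\
  Rintegral mu `[0, s] (fun x => K * expR (2 * K * x)) <= expR (2 * K * s) / 2.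
Proof.
move=> K0 t0 st.
have [] := @C1_primitive t (fun x => expR (2 * K * x) / 2) (fun x => K * expR (2 * K * x)) t0.
- move=> x; apply: is_derive_eq; by rewrite /GRing.scale/=; field.
- move=> x; apply: cvgM; first exact: cvg_cst.
  apply: continuous_comp; last exact: continuous_expR.
  by apply: cvgM; [exact: cvg_cst|exact: cvg_id].
move=> i /(_ s st); rewrite mulr0 expR0 => E; split => //.
by rewrite E lerDr divr_ge0.
Qed.

(* [v k - 2 * C / 2 ^ k] is nondecreasing in [k]. *)
Lemma geometric_cauchy_limit (v : nat -> R) (C : R) : 0 <= C ->
  (forall k, `|v k.+1 - v k| <= C * 2^-1 ^+ k) ->
  exists l, forall k, `|l - v k| <= 2 * C * 2^-1 ^+ k.
Proof.
move=> C0 H; pose d k : R := 2 * C * 2^-1 ^+ k.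
have dS k : d k - d k.+1 = C * 2^-1 ^+ k.
  by rewrite /d exprS; field.
have d0 k : 0 <= d k by rewrite /d !mulr_ge0// exprn_ge0.
have lo k : v k - d k <= v k.+1 - d k.+1.
  by have := H k; rewrite -dS ler_norml => /andP[]; lra.
have hi k : v k.+1 + d k.+1 <= v k + d k.
  by have := H k; rewrite -dS ler_norml => /andP[]; lra.
have lo' j k : (j <= k)%N -> v j - d j <= v k - d k.
  by move=> jk; apply: (@homo_leq _ (fun k => v k - d k) <=%R _ _ _ j k jk) => //; exact: le_trans.
have hi' j k : (j <= k)%N -> v k + d k <= v j + d j.
  have /nondecreasing_seqP nd : forall k, - (v k + d k) <= - (v k.+1 + d k.+1).
    by move=> n; rewrite lerN2.
  by move=> jk; have := nd _ _ jk; rewrite lerN2.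
pose A := range (fun k => v k - d k).
have ub k : ubound A (v k + d k).
  move=> _ [j _ <-]; have [jk|kj] := leqP j k.
    by have := lo' _ _ jk; have := d0 k; lra.
  by have := hi' _ _ (ltnW kj); have := d0 j; lra.
exists (sup A) => k; rewrite ler_norml; apply/andP; split.
  have : v k - d k <= sup A by apply: ub_le_sup; [exists (v 0%N + d 0%N); exact: ub|exists k].
  by rewrite /d; lra.
have : sup A <= v k + d k by apply: ge_sup; [exists (v 0%N - d 0%N); exists 0%N|exact: ub].
by rewrite /d; lra.
Qed.

Lemma cvg_geometric_dist (v : nat -> R) l (C : R) :
  (forall k, `|l - v k| <= C * 2^-1 ^+ k) -> v @ \oo --> l.
Proof.
move=> H; apply: (@squeeze_cvgr _ _ _ _ (fun k => l - C * 2^-1 ^+ k) (fun k => l + C * 2^-1 ^+ k)).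
- by near=> k; have := H k; rewrite ler_norml => /andP[]; lra.
- rewrite -[X in _ --> X]subr0; apply: cvgB; first exact: cvg_cst.
  by apply: (cvg_geometric C); rewrite ger0_norm// invf_lt1// ltr1n.
- rewrite -[X in _ --> X]addr0; apply: cvgD; first exact: cvg_cst.
  by apply: (cvg_geometric C); rewrite ger0_norm// invf_lt1// ltr1n.
Unshelve. all: by end_near. Qed.

(** Picard iteration from 0, measured in the weighted norm given by the supremum of
    [|w s| / expR (2 * K * s)]: consecutive iterates are at distance at most [G / 2 ^ k], whence a
    solution on all of [[0, t]] and the explicit bound. That the bound is proportional to the size
    of [h s 0] later makes [D] of the order of the perturbation. *)
Lemma picard_solution t (K : R) (h : R -> R -> R) : 0 < t -> 0 < K ->
  (forall w : R -> R, meas t w -> meas t (fun s => h s (w s))) ->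
  intble t (fun s => h s 0) ->
  (forall s r r', 0 <= s <= t -> `|h s r - h s r'| <= K * `|r - r'|) ->
  exists D : R -> R, [/\ D 0 = 0, primitive t D (fun s => h s (D s)) &
    forall s, 0 <= s <= t -> `|D s| <=
      2 * (Rintegral mu `[0, t] (fun s => `|h s 0|)) * expR (2 * K * t)].
Proof.
move=> t0 K0 hm h0 hK.
have hint w : intble t w -> intble t (fun s => h s (w s)).
  move=> iw; apply: (@intble_le _ _ (fun s => `|h s 0| + K * `|w s|)).
  - by apply: hm; exact: intble_meas.
  - by apply: intbleD; [exact: intble_norm|apply: intbleZ; exact: intble_norm].
  - move=> s st; have := hK s (w s) 0 st; rewrite subr0 => H.
    rewrite -(subrK (h s 0) (h s (w s))) (le_trans (ler_normD _ _))// addrC.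
    by rewrite lerD2l.
pose Phi (w : R -> R) s := 0 + Rintegral mu `[0, s] (fun x => h x (w x)).
have PhiP w : intble t w -> primitive t (Phi w) (fun x => h x (w x)).
  by move=> iw; apply: integral_primitive; exact: hint.
pose D k := iter k Phi (fun=> 0).
have Dint k : intble t (D k).
  elim: k => [|k ih].
    by apply: (@intble_bounded _ _ 0) => [|s _]; [exact: measurable_cst|rewrite normr0].
  by apply: primitive_intble; exact: PhiP ih.
pose G := Rintegral mu `[0, t] (fun s => `|h s 0|).
have G0 : 0 <= G by apply: Rintegral_ge0.
pose E s := expR (2 * K * s).
have E1 s : 0 <= s -> 1 <= E s.
  by move=> s0; rewrite -expR0 ler_expR !mulr_ge0// ltW.
have step (w w' : R -> R) (f : R -> R) c s : 0 <= s <= t -> intble t w -> intble t w' ->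
    intble t f -> (forall x, 0 <= x <= t -> K * `|w x - w' x| <= c * f x) ->
    `|Phi w s - Phi w' s| <= c * Rintegral mu `[0, s] f.
  move=> st iw iw' fi H; have /andP[s0 s_t] := st.
  rewrite /Phi !add0r -RintegralB//; [|exact: integrable_sub s_t (hint _ iw)|exact: integrable_sub s_t (hint _ iw')].
  rewrite -RintegralZl//; last exact: integrable_sub s_t fi.
  apply: (Rint_abs_le st).
  - by apply: intbleD; [exact: hint|apply: intbleN; exact: hint].
  - exact: intbleZ.
  - by move=> x xt; rewrite (le_trans (hK _ _ _ xt))// H.
have bound k s : 0 <= s <= t -> `|D k.+1 s - D k s| <= G * 2^-1 ^+ k * E s.
  elim: k s => [|k ih] s st.
    have /andP[s0 s_t] := st.
    rewrite subr0 expr0 mulr1 /D/= /Phi add0r.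
    apply: (@le_trans _ _ G); last by rewrite ler_peMr// E1.
    apply: le_trans (Rint_abs_le st h0 (intble_norm h0) _) _ => //.
    by apply: Rint_mono => //; exact: intble_norm.
  have [Ei EI] := expR_lin_int K0 t0 st.
  have H : forall x, 0 <= x <= t ->
      K * `|D k.+1 x - D k x| <= G * 2^-1 ^+ k * (K * expR (2 * K * x)).
    move=> x xt; rewrite [leRHS]mulrCA; apply: ler_wpM2l; first exact: ltW.
    exact: ih.
  have := step (D k.+1) (D k) _ (G * 2^-1 ^+ k) s st (Dint _) (Dint _) Ei H.
  move=> /le_trans; apply; apply: le_trans (ler_wpM2l _ EI) _; first by rewrite mulr_ge0// exprn_ge0.
  rewrite -/(E s) exprSr le_eqVlt; apply/orP; left; apply/eqP; by field.
pose C := G * E t.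
have C0 : 0 <= C by rewrite mulr_ge0// expR_ge0.
have /choice[L HL] : forall s, exists l, 0 <= s <= t ->
    forall k, `|l - D k s| <= 2 * C * 2^-1 ^+ k.
  move=> s; have [st|nst] := boolP (0 <= s <= t); last by exists 0 => H; case/negP: nst.
  have [|l Hl] := @geometric_cauchy_limit (D ^~ s) C C0; last by exists l.
  move=> k; apply: le_trans (bound k s st) _.
  rewrite /C -!mulrA ler_wpM2l// mulrC ler_wpM2r ?exprn_ge0//.
  by rewrite ler_expR ler_wpM2l ?mulr_ge0 ?(ltW K0)//; case/andP: st.
have LC s : 0 <= s <= t -> `|L s| <= 2 * C.
  by move=> st; have := HL s st 0%N; rewrite subr0 expr0 mulr1.
have Lm : meas t L.
  apply: (@measurable_fun_cvg _ _ _ _ D).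
    by move=> m; exact: intble_meas.
  move=> s; rewrite /= in_itv/= => st.
  exact: (@cvg_geometric_dist (D ^~ s) (L s) (2 * C)) (HL s st).
have Lint : intble t L by apply: (@intble_bounded _ _ (2 * C)).
(* Through [D k.+1 = Phi (D k)], the number [L s - Phi L s] is at most a constant divided by [2 ^ k]
   for every [k], hence is 0. *)
have LE s : 0 <= s <= t -> L s = Phi L s.
  move=> st; have /andP[s0 s_t] := st.
  apply/eqP; rewrite -subr_eq0; apply/eqP.
  have : (fun=> 0 : R) @ \oo --> L s - Phi L s.
    apply: (@cvg_geometric_dist _ _ (2 * C + 2 * C * K * t)) => k.
    rewrite subr0 -(subrK (D k.+1 s) (L s)) -addrA (le_trans (ler_normD _ _))// mulrDl lerD//.
      apply: le_trans (HL s st k.+1) _; apply: ler_wpM2l; first exact: mulr_ge0.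
      by rewrite exprS ler_piMl ?exprn_ge0// invf_le1// ler1n.
    have := @step (D k) L (fun=> 1) (2 * C * K * 2^-1 ^+ k) s st (Dint k) Lint.
    rewrite Rint_cst// mul1r => H; apply: le_trans (H _ _) _.
    - by apply: (@intble_bounded _ _ 1) => [|x _]; [exact: measurable_cst|rewrite normr1].
    - move=> x xt; rewrite mulr1 distrC (le_trans (ler_wpM2l (ltW K0) (HL x xt k)))//.
      rewrite le_eqVlt; apply/orP; left; apply/eqP; by ring.
    - have -> : 2 * C * K * t * 2^-1 ^+ k = 2 * C * K * 2^-1 ^+ k * t by ring.
      apply: ler_wpM2l => //.
      by rewrite !mulr_ge0 ?exprn_ge0 ?invr_ge0 ?expR_ge0 ?(ltW K0).
  by move=> /(cvg_lim (@Rhausdorff R)) <-; apply: lim_cst; exact: Rhausdorff.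
exists L; split.
- rewrite LE ?lexx ?(ltW t0)// /Phi set_itv1 Rintegral_set1 addr0//.
- have [i1 i2] := PhiP L Lint; split => // s st.
  rewrite !LE ?lexx ?(ltW t0)//; exact: i2.
- by move=> s st; rewrite -mulrA; exact: LC.
Qed.

End IntegrableOn.

(** * Functions of class C^1 *)

Section DirectionalDerivatives.
Context {R : realType} {V : normedModType R}.
Implicit Types (F : V -> R^o).

Lemma derive_dist F z v d :
  (forall e : R, 0 < e -> exists2 r : R, 0 < r &
    forall h, h != 0 -> `|h| < r -> `|F (z + h *: v) - F z - h * d| <= e * `|h|) ->
  derivable F z v /\ 'D_v F z = d.
Proof.
move=> H.
have cv : h^-1 *: (F (h *: v + z) - F z) @[h --> 0^'] --> (d : R^o).
  apply/cvgrPdist_le => e e0; have [r r0 {}H] := H e e0.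
  exists r => //= h hr h0.
  have {}hr : `|h| < r by move: hr; rewrite /= distrC subr0.
  have h0' : 0 < `|h| by rewrite normr_gt0.
  rewrite -(ler_pM2r h0') distrC (quotient_norm (V := R^o))// [_ + z]addrC.
  exact: H.
split; first by apply/cvg_ex; exists d.
by apply/cvg_lim => //; exact: Rhausdorff.
Qed.

Lemma derivable_line F z v s : derivable F (z + s *: v) v ->
  is_derive s 1 (fun a : R => F (z + a *: v)) ('D_v F (z + s *: v)).
Proof.
move=> Fd.
have E : (fun h : R => h^-1 *: (F (z + (h *: 1 + s) *: v) - F (z + s *: v))) =
         (fun h => h^-1 *: (F (h *: v + (z + s *: v)) - F (z + s *: v))).
  apply/funext => h; congr (_ *: (F _ - _)).
  by rewrite scalerDl addrCA /GRing.scale/= mulr1.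
apply: DeriveDef.
  by move: Fd; rewrite /derivable -E.
by rewrite /derive -E.
Qed.

(** The loose location [|c| <= |a|] treats zero, positive and negative [a] alike and suffices for
    the estimates below. This is the substitute for a Frechet derivative, which [Ck] does not
    provide directly. *)
Lemma mvt_line F z v a : (forall z, derivable F z v) ->
  exists2 c : R, `|c| <= `|a| & F (z + a *: v) - F z = a * 'D_v F (z + c *: v).
Proof.
move=> Fd; pose f s := F (z + s *: v).
have fd (s : R) : is_derive s (1 : R) f ('D_v F (z + s *: v)) by apply: derivable_line.
have fc : continuous f.
  by move=> x; apply/differentiable_continuous/derivable1_diffP; exact: (@ex_derive _ _ _ _ _ _ _ (fd x)).
have [a0|a0|->] := ltgtP a 0; last first.
- by exists 0; rewrite // scale0r addr0 subrr mul0r.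
- have [c] := MVT a0 (fun x _ => fd x) (continuous_subspaceT fc).
  rewrite in_itv/= => /andP[c0 ca] E; exists c.
    by rewrite !ger0_norm// ltW.
  by move: E; rewrite /f scale0r addr0 subr0 mulrC.
- have [c] := MVT a0 (fun x _ => fd x) (continuous_subspaceT fc).
  rewrite in_itv/= => /andP[c0 ca] E; exists c.
    by rewrite !ltr0_norm// lerN2 ltW.
  move: E; rewrite /f scale0r addr0 sub0r => E.
  by rewrite -[LHS]opprB E mulrN opprK mulrC.
Qed.

Lemma cont_dist (W : normedModType R) (G : V -> W) z : {for z, continuous G} ->
  forall e : R, 0 < e -> exists2 r : R, 0 < r &
    forall y, `|y - z| < r -> `|G y - G z| <= e.
Proof.
move=> /cvgrPdist_le Gc e e0; have /nbhs_ballP[r /= r0 H] := Gc e e0.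
exists r => // y yz; rewrite distrC; apply: H.
by rewrite -ball_normE /= distrC.
Qed.

Lemma deriveZ_dir F z v (a : R) : (forall z, derivable F z v) ->
  {for z, continuous ('D_v F)} ->
  derivable F z (a *: v) /\ 'D_(a *: v) F z = a * 'D_v F z.
Proof.
move=> Fd Fc; apply: derive_dist => e e0.
have a1 : 0 < 1 + `|a| by rewrite ltr_pwDl.
have [r r0 H] := cont_dist Fc (divr_gt0 e0 a1).
pose B := 1 + `|a| * `|v|; have B0 : 0 < B by rewrite ltr_pwDl// mulr_ge0.
exists (r / B); first by rewrite divr_gt0.
move=> h h0; rewrite ltr_pdivlMr// => hr; rewrite scalerA.
have [c ca ->] := mvt_line z (h * a) Fd.
rewrite mulrA -mulrBr normrM mulrC.
have Hc : `|'D_v F (z + c *: v) - 'D_v F z| <= e / (1 + `|a|).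
  apply: H; rewrite addrC addKr normrZ.
  apply: le_lt_trans hr; rewrite /B mulrDr mulr1.
  rewrite (le_trans (ler_wpM2r (normr_ge0 v) ca))// normrM -mulrA lerDr//.
rewrite (le_trans (ler_wpM2r (normr_ge0 _) Hc))// normrM.
rewrite [leLHS](_ : _ = e * `|h| * (`|a| / (1 + `|a|))); last by field; rewrite gt_eqF.
by rewrite ler_piMr ?mulr_ge0 ?(ltW e0)// ler_pdivrMr// mul1r lerDr.
Qed.

(** Additivity in the direction is not built into [Ck]: it comes from going along [v] and then along
    [w], with the mean value theorem on each leg and continuity of both directional derivatives at
    [z]. *)
Lemma deriveD_dir F z v w : (forall z, derivable F z v) -> (forall z, derivable F z w) ->
  {for z, continuous ('D_v F)} -> {for z, continuous ('D_w F)} ->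
  derivable F z (v + w) /\ 'D_(v + w) F z = 'D_v F z + 'D_w F z.
Proof.
move=> Fv Fw cv cw; apply: derive_dist => e e0.
have e20 : 0 < e / 2 by rewrite divr_gt0.
have [r r0 H] := cont_dist cv e20; have [r' r'0 H'] := cont_dist cw e20.
pose B := 1 + `|v| + `|w|.
have B0 : 0 < B by rewrite /B -addrA ltr_pwDl// addr_ge0.
exists (Num.min r r' / B); first by rewrite divr_gt0// lt_min r0.
move=> h h0; rewrite ltr_pdivlMr// lt_min => /andP[hr hr'].
have [c ch E1] := mvt_line z h Fv.
have [d dh E2] := mvt_line (z + h *: v) h Fw.
have -> : F (z + h *: (v + w)) - F z - h * ('D_v F z + 'D_w F z) =
  h * ('D_v F (z + c *: v) - 'D_v F z) + h * ('D_w F (z + h *: v + d *: w) - 'D_w F z).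
  by rewrite !mulrBr -E1 -E2 scalerDr addrA; ring.
rewrite (le_trans (ler_normD _ _))// !normrM (splitr e) mulrDl lerD//.
  rewrite mulrC ler_wpM2r//; apply: H; rewrite addrC addKr normrZ.
  apply: le_lt_trans hr; rewrite /B !mulrDr mulr1 -addrA.
  rewrite (le_trans (ler_wpM2r (normr_ge0 v) ch))// addrCA lerDl addr_ge0//.
rewrite mulrC ler_wpM2r//; apply: H'.
rewrite (_ : z + h *: v + d *: w - z = h *: v + d *: w); last first.
  by rewrite -[z + _ + _]addrA addrAC subrr add0r.
rewrite (le_lt_trans (ler_normD _ _))// !normrZ; apply: le_lt_trans hr'.
rewrite /B !mulrDr mulr1 -addrA (le_trans (lerD (lexx _) (ler_wpM2r (normr_ge0 w) dh)))//.
by rewrite lerDr.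
Qed.

Lemma Ck0 (W : normedModType R) k (f : V -> W) : Ck k f -> continuous f.
Proof. by case: k => [|k] []. Qed.

Lemma CkS (W : normedModType R) k (f : V -> W) : Ck k.+1 f -> Ck k f.
Proof.
elim: k f => [|k ih] f [fc H]; first by split.
by split => // w; have [h1 h2] := H w; split => //; exact: ih.
Qed.

Section Basis.
Variables (I : finType) (b : I -> V) (c : V -> I -> R).
Hypothesis cb : forall v, v = \sum_i c v i *: b i.
Hypothesis c_le : forall v i, `|c v i| <= `|v|.

Lemma derive_lin F z v : Ck 1 F -> 'D_v F z = \sum_i c v i * 'D_(b i) F z.
Proof.
move=> [Fc H]; have Hd w x : derivable F x w by have [] := H w.
have Hc w : continuous ('D_w F) by have [_ []] := H w.
rewrite {1}(cb v); elim/big_rec2 : _ => [|i y1 y2 _ <-]; first by rewrite derive0.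
have [_ ->] := deriveD_dir (Hd (c v i *: b i)) (Hd y2) (@Hc _ z) (@Hc _ z).
by have [_ ->] := deriveZ_dir (c v i) (Hd (b i)) (@Hc _ z).
Qed.

(** The move from [y'] to [y] is made one basis direction at a time. The partial derivatives are
    controlled only near [z], so the broken path has to stay in the ball of radius [r0]. *)
Lemma C1_lipschitz_near F z : Ck 1 F -> exists2 C : R, 0 < C & exists2 r : R, 0 < r &
  forall y y', `|y - z| < r -> `|y' - z| < r -> `|F y - F y'| <= C * `|y - y'|.
Proof.
move=> [Fc H]; have Hd w x : derivable F x w by have [] := H w.
have Hc w : continuous ('D_w F) by have [_ []] := H w.
have /choice[rho Hrho] : forall i, exists r : R, 0 < r /\
    forall y, `|y - z| < r -> `|'D_(b i) F y - 'D_(b i) F z| <= 1.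
  by move=> i; have [r r0 h] := cont_dist (Hc (b i) z) ltr01; exists r.
pose r0 := \big[Num.min/1]_i rho i.
have r00 : 0 < r0 by apply/bigmin_gtP; split => // i _; case: (Hrho i).
pose B := 1 + \sum_i `|b i|.
have B1 : 1 <= B by rewrite /B lerDl sumr_ge0.
have B0 : 0 < B by rewrite (lt_le_trans ltr01).
pose C := 1 + \sum_i (1 + `|'D_(b i) F z|).
have C0 : 0 < C by rewrite ltr_pwDl// sumr_ge0// => i _; rewrite addr_ge0.
(* The path starts within [r0 / 3] of [z], and its legs have total length at most [2 * r0 / 3], as
   [B] dominates the sum of the norms of the basis vectors. *)
exists C => //; exists (r0 / (3 * B)); first by rewrite divr_gt0// mulr_gt0.
move=> y y' yz y'z; set k := y - y'.
have kr : `|k| < 2 * (r0 / (3 * B)).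
  rewrite (_ : k = (y - z) - (y' - z)); last by rewrite opprB addrA subrK.
  by rewrite (le_lt_trans (ler_normB _ _))// mulr_natl mulr2n ltrD.
have main (s : seq I) x : `|x - z| + \sum_(i <- s) `|k| * `|b i| < r0 ->
    `|F (x + \sum_(i <- s) c k i *: b i) - F x| <= \sum_(i <- s) `|k| * (1 + `|'D_(b i) F z|).
  elim: s x => [x _|i s ih x]; first by rewrite !big_nil addr0 subrr normr0.
  rewrite !big_cons => xr.
  have x1 : `|x + c k i *: b i - z| <= `|x - z| + `|k| * `|b i|.
    by rewrite addrAC (le_trans (ler_normD _ _))// lerD2l normrZ ler_wpM2r.
  rewrite addrA; set x' := x + c k i *: b i in x1 *; set x'' := (X in F X - _).
  have -> : F x'' - F x = (F x' - F x) + (F x'' - F x') by ring.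
  rewrite (le_trans (ler_normD _ _))// lerD//.
    rewrite /x'.
    have [d dc ->] := mvt_line x (c k i) (Hd (b i)).
    rewrite normrM ler_pM//.
    have [_ /(_ (x + d *: b i))] := Hrho i.
    set u := 'D_(b i) F (x + _); set u0 := 'D_(b i) F z => h.
    rewrite -(subrK u0 u) (le_trans (ler_normD _ _))// lerD2r; apply: h.
    apply: (@lt_le_trans _ _ r0); last by apply: bigmin_le_cond.
    apply: le_lt_trans xr; rewrite addrAC (le_trans (ler_normD _ _))// lerD2l normrZ.
    rewrite (le_trans (ler_wpM2r (normr_ge0 _) (le_trans dc (c_le k i))))// lerDl.
    by rewrite sumr_ge0// => j _; rewrite mulr_ge0.
  apply: ih; apply: le_lt_trans xr; rewrite addrA lerD2r//.
have := main (index_enum I) y'.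
have -> : y' + \sum_i c k i *: b i = y by rewrite -(cb k) /k addrC subrK.
move=> H'; apply: le_trans (H' _) _.
  rewrite -mulr_sumr.
  have h1 : r0 / (3 * B) <= r0 / 3.
    by rewrite invfM mulrA ler_piMr ?divr_ge0 ?(ltW r00)// invf_le1.
  have h2 : `|k| * (\sum_i `|b i|) <= 2 * (r0 / 3).
    apply: le_trans (_ : `|k| * B <= _); first by rewrite ler_wpM2l// /B lerDr.
    rewrite -ler_pdivlMr// (le_trans (ltW kr))// le_eqVlt; apply/orP; left; apply/eqP.
    by field; rewrite gt_eqF.
  have := lt_le_trans y'z h1; lra.
rewrite -mulr_sumr mulrC ler_wpM2r// /C lerDr//.
Qed.

(** [F (z y)] is compared with [F (z s + (y - s) *: d)] by the local Lipschitz bound, and the latter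
    is treated by the mean value theorem along the fixed direction [d]. *)
Lemma has_der_comp t F (z : R -> V) s d : Ck 1 F -> has_der t z s d ->
  has_der t ((fun y => F (z y)) : R -> R^o) s ('D_d F (z s)).
Proof.
move=> F1 zd; have [C C0 [r r0 HC]] := C1_lipschitz_near (z s) F1.
have [Fc H] := F1; have Hd w x : derivable F x w by have [] := H w.
have Hc w : continuous ('D_w F) by have [_ []] := H w.
apply/has_derP => e e0.
have e20 : 0 < e / 2 by rewrite divr_gt0.
have [r1 r10 H1] := cont_dist (Hc d (z s)) e20.
have [r2 r20 H2] := has_der_cont zd r0.
have [r3 r30 H3] := (has_derP t z s d).1 zd (e / 2 / C) (divr_gt0 e20 C0).
pose B := 1 + `|d|; have B0 : 0 < B by rewrite ltr_pwDl.
exists (Num.min (Num.min r r1 / B) (Num.min r2 r3)).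
  by rewrite lt_min divr_gt0 ?lt_min ?r0 ?r10 ?r20.
move=> y yt; rewrite lt_min ltr_pdivlMr// !lt_min => /andP[/andP[yr yr1] /andP[yr2 yr3]].
have dB : `|(y - s) *: d| <= `|y - s| * B.
  by rewrite normrZ ler_wpM2l// /B lerDr.
have [a cy E] := mvt_line (z s) (y - s) (Hd d).
have -> : F (z y) - F (z s) - (y - s) *: ('D_d F (z s) : R^o) =
   (F (z y) - F (z s + (y - s) *: d)) + (y - s) * ('D_d F (z s + a *: d) - 'D_d F (z s)).
  by rewrite mulrBr -E /GRing.scale/=; ring.
rewrite (le_trans (ler_normD _ _))// (splitr e) [leRHS]mulrDl lerD//.
  apply: le_trans (HC _ _ _ _) _.
  - exact: H2.
  - by rewrite addrC addKr (le_lt_trans dB).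
  - by rewrite opprD addrA -ler_pdivlMl// mulrA [C^-1 * _]mulrC; exact: H3.
rewrite normrM mulrC ler_wpM2r//; apply: H1; rewrite addrC addKr normrZ.
apply: le_lt_trans yr1; rewrite (le_trans (ler_wpM2r (normr_ge0 d) cy))//.
by rewrite ler_wpM2l// /B lerDr.
Qed.

End Basis.

End DirectionalDerivatives.

Section MeasurableComposition.
Context {R : realType} {V : normedModType R}.
Variables (I : finType) (b : I -> V) (c : V -> I -> R).
Hypothesis cb : forall v, v = \sum_i c v i *: b i.

(* [F \o z] is the pointwise limit of compositions of [F] with the dyadic
   discretizations of [z], which take countably many values. *)
Lemma measurable_continuous_comp t (F : V -> R) (z : R -> V) :
  continuous (F : V -> R^o) ->
  (forall i, measurable_fun (`[0, t]%classic : set (measurableTypeR R)) (fun s => c (z s) i)) ->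
  measurable_fun (`[0, t]%classic : set (measurableTypeR R)) (fun s => F (z s)).
Proof.
move=> Fc zm.
pose q (k : nat) s : {ffun I -> int} := [ffun i => Num.floor (2 ^+ k * c (z s) i)].
pose pt (k : nat) (f : {ffun I -> int}) : V := \sum_i ((f i)%:~R * 2^-1 ^+ k) *: b i.
apply: (@measurable_fun_cvg _ _ _ _ (fun k s => F (pt k (q k s)))).
- move=> k mD Y mY.
  have mq f : measurable ((`[0, t]%classic : set (measurableTypeR R)) `&` [set s | q k s = f]).
    have -> : (`[0, t]%classic : set (measurableTypeR R)) `&` [set s | q k s = f] =
      \bigcap_(i in [set: I]) (`[0, t]%classic `&` (fun s => c (z s) i) @^-1`
         `[(f i)%:~R * 2^-1 ^+ k, (f i + 1)%:~R * 2^-1 ^+ k[%classic)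
       `&` `[0, t]%classic.
      apply/seteqP; split=> s /=.
        move=> [st qs]; split => // i _; split => //.
        have := Num.Theory.floor_itv (2 ^+ k * c (z s) i).
        have -> : Num.floor (2 ^+ k * c (z s) i) = f i by rewrite -qs ffunE.
        by rewrite /preimage/= in_itv/= exprVn ler_pdivrMr ?exprn_gt0// ltr_pdivlMr ?exprn_gt0// [c _ _ * _]mulrC.
      move=> [H st]; split => //; apply/ffunP => i; rewrite ffunE.
      have [_] := H i Logic.I; rewrite /preimage/= in_itv/= exprVn.
      rewrite ler_pdivrMr ?exprn_gt0// ltr_pdivlMr ?exprn_gt0// [c _ _ * _]mulrC.
      exact: Num.Theory.floor_def.
    apply: measurableI => //; apply: fin_bigcap_measurable => // i _.
    by apply: zm => //; exact: measurable_itv.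
  have -> : (`[0, t]%classic : set (measurableTypeR R)) `&` (fun s => F (pt k (q k s))) @^-1` Y =
     \bigcup_f (if pselect (Y (F (pt k f))) then (`[0, t]%classic `&` [set s | q k s = f]) else set0).
    apply/seteqP; split => s.
      by move=> [st Ys]; exists (q k s) => //; case: pselect.
    by move=> [f _]; case: pselect => // Yf [st /= sf]; split => //=; rewrite sf.
  apply: countable_bigcupT_measurable; first exact: countableP.
  by move=> f; case: (pselect _) => Yf; [exact: mq|exact: measurable0].
- move=> s st; apply: (continuous_cvg _ (Fc (z s))).
  pose B := \sum_i `|b i|.
  apply/cvgrPdist_le => e e0.
  have : (fun k => B * 2^-1 ^+ k) @ \oo --> (0 : R).
    by apply: (cvg_geometric B); rewrite ger0_norm// invf_lt1// ltr1n.
  move=> /cvgrPdist_le/(_ e e0); apply: filterS => k.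
  rewrite sub0r normrN ger0_norm; last by rewrite mulr_ge0 ?exprn_ge0// sumr_ge0.
  apply: le_trans; rewrite {1}(cb (z s)) /pt -sumrB mulr_suml.
  apply: (le_trans (ler_norm_sum _ _ _)); apply: ler_sum => i _.
  rewrite -scalerBl normrZ mulrC ler_wpM2l// /q ffunE.
  have k0 : (0 : R) < 2 ^+ k by rewrite exprn_gt0.
  have kV : 2 ^+ k * 2^-1 ^+ k = 1 :> R by rewrite -exprMn divff// expr1n.
  set x := c (z s) i; have := Num.Theory.floor_itv (2 ^+ k * x).
  rewrite intrD mulr1z; set m := _%:~R => /andP[mx xm].
  have -> : x - m * 2^-1 ^+ k = (2 ^+ k * x - m) * 2^-1 ^+ k.
    by rewrite mulrBl mulrAC kV mul1r.
  by rewrite normrM [`|2^-1 ^+ k|]ger0_norm ?exprn_ge0// ler_piMl ?exprn_ge0// ger0_norm; lra.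
Qed.

End MeasurableComposition.

Section DotProduct.
Context {R : realType} {n : nat}.
Notation E := 'rV[R]_n.

Lemma dotvC (v w : E) : dotv v w = dotv w v.
Proof. by apply: eq_bigr => i _; rewrite mulrC. Qed.

Lemma dotvDr (p v w : E) : dotv p (v + w) = dotv p v + dotv p w.
Proof. by rewrite /dotv -big_split/=; apply: eq_bigr => i _; rewrite mxE mulrDr. Qed.

Lemma dotvZr (a : R) (p v : E) : dotv p (a *: v) = a * dotv p v.
Proof. by rewrite /dotv mulr_sumr; apply: eq_bigr => i _; rewrite mxE mulrCA. Qed.

Lemma dotv0 (p : E) : dotv p 0 = 0.
Proof. by rewrite -[0](scale0r p) dotvZr mul0r. Qed.

Lemma dotv_evec (v : E) (a : R) i : dotv v (a *: evec i) = a * v 0 i.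
Proof.
rewrite /dotv (bigD1 i)//= big1 => [|j ji]; rewrite !mxE ?eqxx/=; last first.
  by rewrite (negbTE ji) !mulr0.
by rewrite mulr1 addr0 mulrC.
Qed.

Lemma dotv_norm_le (v w : E) : `|dotv v w| <= n%:R * (`|v| * `|w|).
Proof.
rewrite (le_trans (ler_norm_sum _ _ _))//.
rewrite (_ : n%:R * _ = \sum_(i < n) `|v| * `|w|); last first.
  by rewrite sumr_const card_ord mulr_natl.
by apply: ler_sum => i _; rewrite normrM ler_pM// le_rV_norm.
Qed.

End DotProduct.

(** * The space of triples (x, r, v) and the partial derivatives of [L] *)

Section Phase.
Context {R : realType} {n : nat}.
Notation E := 'rV[R]_n.
Notation V := (E * R^o * E)%type.
Notation ix := ('I_n + unit + 'I_n)%type.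

Definition phase_basis (i : ix) : V :=
  match i with
  | inl (inl i) => (evec i, 0, 0)
  | inl (inr _) => (0, 1, 0)
  | inr i => (0, 0, evec i)
  end.

Definition phase_coord (v : V) (i : ix) : R :=
  match i with
  | inl (inl i) => v.1.1 0 i
  | inl (inr _) => v.1.2
  | inr i => v.2 0 i
  end.

Lemma rV_sum_evec (v : E) : v = \sum_i v 0 i *: evec i.
Proof. by rewrite {1}(row_sum_delta v). Qed.

Lemma big_unit_sum (A : nmodType) (F : unit -> A) : \sum_u F u = F tt.
Proof. by rewrite (bigD1 tt)//= big1 ?addr0// => -[]. Qed.

Lemma phase_coordE (v : V) : v = \sum_i phase_coord v i *: phase_basis i.
Proof.
rewrite !big_sumType/= big_unit_sum.
rewrite (eq_bigr (fun i => (v.1.1 0 i *: evec i, 0, 0) : V)); last first.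
  by move=> i _; congr (_, _, _); rewrite scaler0.
rewrite [X in _ + X](eq_bigr (fun i => (0, 0, v.2 0 i *: evec i) : V)); last first.
  by move=> i _; congr (_, _, _); rewrite scaler0.
have S1 (f : 'I_n -> E) : \sum_i ((f i, 0, 0) : V) = (\sum_i f i, 0, 0).
  by elim/big_rec2 : _ => [//|i y1 y2 _ ->]; congr (_, _, _); rewrite addr0.
have S2 (f : 'I_n -> E) : \sum_i ((0, 0, f i) : V) = (0, 0, \sum_i f i).
  by elim/big_rec2 : _ => [//|i y1 y2 _ ->]; congr (_, _, _); rewrite addr0.
rewrite S1 S2 -!rV_sum_evec; case: v => -[x r] w /=.
congr (_, _, _) => /=.
- by rewrite scaler0 !addr0.
- by rewrite add0r addr0 /GRing.scale/= mulr1.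
- by rewrite scaler0 !add0r.
Qed.

Lemma phase_coord_le (v : V) i : `|phase_coord v i| <= `|v|.
Proof.
rewrite !prod_normE/= !le_max; case: i => [[i|[]]|i] /=.
- by rewrite le_rV_norm.
- by rewrite lexx orbT.
- by rewrite le_rV_norm orbT.
Qed.

Lemma phase_norm_le (v : V) (e : R) : `|v.1.1| <= e -> `|v.1.2| <= e -> `|v.2| <= e ->
  `|v| <= e.
Proof. by move=> h1 h2 h3; rewrite !prod_normE/= !ge_max h1 h2 h3. Qed.

Lemma phase_line (x : E) (r : R) (w dx : E) (dr : R) (dw : E) (y : R) :
  (x, r, w) + y *: ((dx, dr, dw) : V) = (x + y *: dx, r + y * dr, w + y *: dw).
Proof. by []. Qed.

Lemma phase_line_v (x : E) (r : R) (w d : E) (y : R) :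
  (x, r, w) + y *: ((0, 0, d) : V) = (x, r, w + y *: d).
Proof. by rewrite phase_line !scaler0 mulr0 !addr0. Qed.

Lemma has_der_phase t (x : R -> E) (u : R -> R) (w : R -> E) s dx du dw :
  has_der t x s dx -> has_der t (u : R -> R^o) s du -> has_der t w s dw ->
  has_der t (fun y => (x y, u y, w y) : V) s (dx, du, dw).
Proof.
move=> hx hu hw; apply/has_derP => e e0.
have [r1 r10 H1] := (has_derP _ _ _ _).1 hx e e0.
have [r2 r20 H2] := (has_derP _ _ _ _).1 hu e e0.
have [r3 r30 H3] := (has_derP _ _ _ _).1 hw e e0.
exists (Num.min r1 (Num.min r2 r3)); first by rewrite !lt_min r10 r20.
move=> y yt; rewrite !lt_min => /and3P[y1 y2 y3].
by apply: phase_norm_le; [exact: H1|exact: H2|exact: H3].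
Qed.

Variable L : E -> R -> E -> R.
Definition phaseL : V -> R^o := fun z => L z.1.1 z.1.2 z.2.

Lemma derive_phase_x x r w d :
  'D_((d, 0, 0) : V) phaseL (x, r, w) = 'D_d (fun y => L y r w : R^o) x.
Proof.
have H : (fun h : R => h^-1 *: (phaseL (h *: ((d, 0, 0) : V) + (x, r, w)) - phaseL (x, r, w))) =
    (fun h : R => h^-1 *: ((L (h *: d + x) r w : R^o) - L x r w)).
  by apply/funext => h; rewrite /phaseL/= !scaler0 !add0r.
by rewrite /derive H.
Qed.

Lemma derive_phase_r x r w :
  'D_((0, 1, 0) : V) phaseL (x, r, w) = derive1 (fun z : R => L x z w) r.
Proof.
have H : (fun h : R => h^-1 *: (phaseL (h *: ((0, 1, 0) : V) + (x, r, w)) - phaseL (x, r, w))) =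
    (fun h : R => h^-1 *: ((L x (h + r) w : R^o) - L x r w)).
  by apply/funext => h; rewrite /phaseL/= !scaler0 !add0r /GRing.scale/= mulr1.
by rewrite /derive H.
Qed.

Lemma derive_phase_v x r w d :
  'D_((0, 0, d) : V) phaseL (x, r, w) = 'D_d (L x r : E -> R^o) w.
Proof.
have H : (fun h : R => h^-1 *: (phaseL (h *: ((0, 0, d) : V) + (x, r, w)) - phaseL (x, r, w))) =
    (fun h : R => h^-1 *: ((L x r (h *: d + w) : R^o) - L x r w)).
  by apply/funext => h; rewrite /phaseL/= !scaler0 !add0r.
by rewrite /derive H.
Qed.

Hypothesis hC2 : C2_lagrangian L.

Lemma phaseL_C2 : Ck 2 phaseL. Proof. exact: hC2. Qed.

Lemma phaseL_dC1 d : Ck 1 ('D_d phaseL).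
Proof. by have [_ /(_ d)[]] := phaseL_C2. Qed.

Lemma derive_phaseL x r w (d : V) : 'D_d phaseL (x, r, w) =
  dotv (Dx L x r w) d.1.1 + Dr L x r w * d.1.2 + dotv (Dv L x r w) d.2.
Proof.
rewrite (derive_lin phase_coordE (x, r, w) d (CkS phaseL_C2)).
rewrite !big_sumType/= big_unit_sum /= derive_phase_r; congr (_ + _ + _).
- by apply: eq_bigr => i _; rewrite mulrC derive_phase_x mxE.
- by rewrite mulrC.
- by apply: eq_bigr => i _; rewrite mulrC derive_phase_v mxE.
Qed.

Lemma DxE x r w i : Dx L x r w 0 i = 'D_((evec i, 0, 0) : V) phaseL (x, r, w).
Proof. by rewrite derive_phase_x mxE. Qed.

Lemma DrE x r w : Dr L x r w = 'D_((0, 1, 0) : V) phaseL (x, r, w).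
Proof. by rewrite derive_phase_r. Qed.

Lemma DvE x r w i : Dv L x r w 0 i = 'D_((0, 0, evec i) : V) phaseL (x, r, w).
Proof. by rewrite derive_phase_v mxE. Qed.

Lemma phase_has_der t (F : V -> R^o) x u w s dx du dw : Ck 1 F ->
  has_der t x s dx -> has_der t (u : R -> R^o) s du -> has_der t w s dw ->
  has_der t ((fun y => F (x y, u y, w y)) : R -> R^o) s ('D_((dx, du, dw) : V) F (x s, u s, w s)).
Proof.
move=> F1 hx hu hw.
by apply: (has_der_comp phase_coordE phase_coord_le F1); exact: has_der_phase.
Qed.

Lemma phase_measurable t (F : V -> R) (x : R -> E) (u : R -> R) (w : R -> E) : continuous (F : V -> R^o) ->
  (forall i, measurable_fun (`[0, t]%classic : set (measurableTypeR R)) (fun s => x s 0 i)) ->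
  measurable_fun (`[0, t]%classic : set (measurableTypeR R)) u ->
  (forall i, measurable_fun (`[0, t]%classic : set (measurableTypeR R)) (fun s => w s 0 i)) ->
  measurable_fun (`[0, t]%classic : set (measurableTypeR R)) (fun s => F (x s, u s, w s)).
Proof.
move=> Fc mx mu mw.
by apply: (measurable_continuous_comp (z := fun s => (x s, u s, w s)) phase_coordE Fc) => -[[i|[]]|i] /=.
Qed.

End Phase.

(** * Integrating factors *)

Section IntegratingFactor.
Context {R : realType}.
Notation mu := (@lebesgue_measure R).
Notation intble t g := (mu.-integrable `[0, t] (EFin \o (g : R -> R))).
Notation meas t g := (measurable_fun (`[0, t]%classic : set (measurableTypeR R)) (g : R -> R)).
Implicit Types t : R.

Lemma expR_lip (M a b : R) : a <= M -> b <= M -> `|expR b - expR a| <= expR M * `|b - a|.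
Proof.
wlog ab : a b / a <= b => [W|] aM bM.
  have [ab|/ltW ba] := leP a b; first exact: W.
  by rewrite distrC [`|b - a|]distrC; apply: W.
rewrite !ger0_norm ?subr_ge0 ?ler_expR//.
have -> : expR b - expR a = expR b * (1 - expR (a - b)).
  by rewrite mulrBr mulr1 -expRD [b + _]addrC subrK.
have h1 : 1 - expR (a - b) <= b - a.
  by have := expR_ge1Dx (a - b); lra.
apply: (@le_trans _ _ (expR b * (b - a))); first by rewrite ler_wpM2l ?expR_ge0.
by rewrite ler_wpM2r ?subr_ge0// ler_expR.
Qed.

Lemma derive_expR (w z : R) :
  derivable (expR : R^o -> R^o) z w /\ 'D_w (expR : R^o -> R^o) z = w * expR z.
Proof.
have E1 : 'D_1 (expR : R^o -> R^o) = expR by apply/funext => x; exact: derive_val.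
have Ew : w *: (1 : R^o) = w by rewrite /GRing.scale/= mulr1.
have [||] := @deriveZ_dir R R^o (expR : R^o -> R^o) z (1 : R^o) w.
- by move=> x; exact: (@ex_derive _ _ _ _ _ _ _ (is_derive_expR x)).
- rewrite E1; exact: continuous_expR.
have E2 : 'D_1 (expR : R^o -> R^o) z = expR z by exact: derive_val.
by rewrite Ew E2.
Qed.

Lemma expR_C1 : Ck 1 (expR : R^o -> R^o).
Proof.
split; first exact: continuous_expR.
move=> w; split; first by move=> z; exact: (derive_expR w z).1.
split => //; rewrite (_ : 'D_w _ = fun z => w * expR z).
  by move=> z; apply: cvgM; [exact: cvg_cst|exact: continuous_expR].
by apply/funext => z; exact: (derive_expR w z).2.
Qed.

Lemma primitive_exp t (f g : R -> R) : 0 < t -> primitive t f g ->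
  primitive t (fun s => expR (f s)) (fun s => g s * expR (f s)).
Proof.
move=> t0 fg; have fac := primitive_abs_cont fg.
have [M M0 fM] := abs_cont_bounded fac.
have fM' s : 0 <= s <= t -> f s <= M by move=> /fM; apply: le_trans; exact: ler_norm.
apply: has_der_primitive => //.
- apply: (abs_cont_le (C := expR M) _ fac) => a b a0 ab bt.
  by apply: expR_lip; apply: fM'; rewrite ?a0 ?bt ?andbT /= ?(le_trans a0)// (le_trans ab).
- rewrite (_ : (fun s => g s * expR (f s)) = (fun s => expR (f s) * g s)); last first.
    by apply/funext => s; rewrite mulrC.
  apply: (@intble_Ml _ _ _ _ (expR M)).
  + by apply: (measurableT_comp (@measurable_expR R)); apply: intble_meas; exact: primitive_intble fg.
  + by move=> s st; rewrite ger0_norm ?expR_ge0// ler_expR fM'.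
  + by case: fg.
have := primitive_has_der t0 fg; apply: aeS => s hf st.
have := @has_der_comp R R^o unit (fun=> 1) (fun v _ => v) _ _ t _ f s (g s) expR_C1 (hf st).
rewrite (derive_expR (g s) (f s)).2; apply.
- by move=> v; rewrite big_unit_sum /GRing.scale/= mulr1.
- by move=> v _.
Qed.

(** Along [D' = m * D + q] the function [expR (- lam) * D] has derivative [expR (- lam) * q]; the
    sign of [D t] is therefore that of a weighted integral of [q]. *)
Lemma integrating_factor t (D m q lam : R -> R) M : 0 < t ->
  meas t m -> (forall s, 0 <= s <= t -> `|m s| <= M) -> intble t q ->
  primitive t D (fun s => m s * D s + q s) -> D 0 = 0 ->
  primitive t lam m ->
  expR (- lam t) * D t = Rintegral mu `[0, t] (fun s => expR (- lam s) * q s) /\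
  intble t (fun s => expR (- lam s) * q s).
Proof.
move=> t0 mm mM iq Dp D0 lp.
have nlp : primitive t (fun s => - lam s) (fun s => - m s).
  apply: has_der_primitive => //.
  - by apply: abs_contN; exact: primitive_abs_cont lp.
  - by apply: intbleN; case: lp.
  - by have := primitive_has_der t0 lp; apply: aeS => s h st; apply: has_derN; exact: h.
have Ep := primitive_exp t0 nlp; set E := fun s => expR (- lam s).
have lac := primitive_abs_cont nlp; have [N N0 lN] := abs_cont_bounded lac.
have iEq : intble t (fun s => E s * q s).
  apply: (@intble_Ml _ _ _ _ (expR N)) => //.
  + by apply: (measurableT_comp (@measurable_expR R)); apply: intble_meas; exact: primitive_intble nlp.
  + move=> s st; rewrite ger0_norm ?expR_ge0// ler_expR.
    by apply: le_trans (lN s st); exact: ler_norm.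
have eqf : (fun s => - m s * expR (- lam s) * D s + expR (- lam s) * (m s * D s + q s)) =
   (fun s => E s * q s).
  by apply/funext => s; rewrite /E; ring.
have := primitiveM t0 Ep Dp; rewrite eqf => /(_ iEq)[_ /(_ t)].
by rewrite lexx (ltW t0) D0 mulr0 add0r => /(_ isT).
Qed.

End IntegratingFactor.

(** * Competitors and time changes *)

Section Competitors.
Context {R : realType} {n : nat}.
Notation mu := (@lebesgue_measure R).
Notation E := 'rV[R]_n.
Notation intble t g := (mu.-integrable `[0, t] (EFin \o (g : R -> R))).
Notation meas t g := (measurable_fun (`[0, t]%classic : set (measurableTypeR R)) (g : R -> R)).
Variables (L : E -> R -> E -> R) (t u0 : R).
Hypothesis t0 : 0 < t.
Hypothesis hL1 : cond_L1 L.

Definition velocity (xi : R -> E) (g : R -> E) :=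
  forall i, primitive t (fun s => xi s 0 i) (fun s => g s 0 i).

Lemma velocity_exists xi : abs_cont t xi -> exists g, velocity xi g.
Proof.
move=> /abs_cont_coord H.
have /choice[g Hg] : forall i, exists g, primitive t (fun s => xi s 0 i) g.
  by move=> i; apply: abs_cont_primitive.
exists (fun s => \row_i g i s) => i.
have -> : (fun s => (\row_i0 g i0 s) 0 i) = g i by apply/funext => s; rewrite mxE.
exact: Hg.
Qed.

Lemma ae_forall_ord (P : 'I_n -> R -> Prop) : (forall i, {ae mu, forall s, P i s}) ->
  {ae mu, forall s, forall i, P i s}.
Proof.
move=> H; have : {ae mu, forall s, forall k : nat, forall i : 'I_n, i = k :> nat -> P i s}.
  apply: ae_foralln => k; have [kn|nk] := ltnP k n.
    by apply: aeS (H (Ordinal kn)) => s Ps i ik; rewrite (_ : i = Ordinal kn)//; exact: val_inj.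
  exists set0; split => // s /= []; move=> i ik.
  by have := ltn_ord i; rewrite ik ltnNge nk.
by apply: aeS => s Hs i; exact: (Hs i).
Qed.

Lemma velocity_has_der xi g : velocity xi g ->
  {ae mu, forall s, 0 <= s <= t -> has_der t xi s (g s)}.
Proof.
move=> H; have : {ae mu, forall s, forall i, 0 <= s <= t -> has_der t ((fun y => xi y 0 i) : R -> R^o) s (g s 0 i)}.
  by apply: ae_forall_ord => i; exact: primitive_has_der.
by apply: aeS => s h st; apply/has_der_coord => i; exact: h.
Qed.

Lemma velocity_abs_cont xi g : velocity xi g -> abs_cont t xi.
Proof. by move=> H; apply/abs_cont_coord => i; exact: primitive_abs_cont (H i). Qed.

Lemma velocity_der xi g : velocity xi g ->
  {ae mu, forall s, 0 <= s <= t -> der t xi s = g s}.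
Proof.
move=> /velocity_has_der; apply: aeS => s h st.
by apply: has_der_der => //; exact: h.
Qed.

(** Because of this, minimality compares the final values of Caratheodory solutions. Measurability
    of the integrand is not established: it agrees almost everywhere with the density of [u], and
    positivity of [L] lets the integral ignore the exceptional null set. *)
Lemma J_value xi u : caratheodory L t u0 xi u -> J L t xi u = u t - u0.
Proof.
move=> [uac u00 uc]; have [g gp] := abs_cont_primitive t0 uac.
have [gi gE] := gp; rewrite /J (@ae_eq_integral_nonmeasurable _ _ g)//.
- by rewrite (gE t) ?lexx ?(ltW t0)// u00 addrC addKr.
- by move=> s; have [/(_ (der t xi s))/ltW] := hL1 (xi s) (u s).
- have := primitive_has_der t0 gp; apply: aeI uc => s h1 h2 st.
  by apply: (has_der_unique t0 st _ (h2 st)); apply: h1; rewrite in_itv.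
Qed.

(** Integrability of [L (xi s) (u s) (g s)] is inherited from the density of [u], with which it
    agrees almost everywhere; it does not come from a bound on [L]. *)
Lemma caratheodory_primitive xi g u : velocity xi g -> caratheodory L t u0 xi u ->
  meas t (fun s => L (xi s) (u s) (g s)) ->
  primitive t u (fun s => L (xi s) (u s) (g s)).
Proof.
move=> xg [uac u00 uc] mL; have [h hp] := abs_cont_primitive t0 uac.
have hL : {ae mu, forall s, 0 <= s <= t -> h s = L (xi s) (u s) (g s)}.
  have H1 := velocity_der xg; have H2 := primitive_has_der t0 hp.
  apply: (aeI _ uc (aeI (fun s a b => conj a b) H1 H2)) => s h1 [h3 h2] st; rewrite -h3//.
  by apply: (has_der_unique t0 st (h2 st)); apply: h1; rewrite in_itv.
apply: (primitive_eq t0 hp _ hL); have [hi _] := hp.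
have hi' := intble_norm hi.
have /integrableP[/= mh fh] := hi.
apply/integrableP; split; first exact/measurable_EFinP.
rewrite (_ : (\int[mu]_(x in `[0%R, t]) _)%E = \int[mu]_(x in `[0%R, t]) `|(h x)%:E|)%E//.
apply: ae_eq_integral => //.
- by apply: measurableT_comp => //; exact/measurable_EFinP.
- exact: measurableT_comp.
- by apply: aeS hL => s H; rewrite /= in_itv/= => st; rewrite H.
Qed.

(** The a.e. form serves reparametrized curves, for which only pointwise derivatives are at hand;
    [competitor_le] serves perturbed curves, given together with their velocity. *)
Lemma competitor_le_ae x0 x xi u eta (k : R -> E) w :
  minimizer L t u0 x0 x xi u -> abs_cont t eta ->
  {ae mu, forall s, 0 <= s <= t -> has_der t eta s (k s)} ->
  eta 0 = x0 -> eta t = x ->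
  w 0 = u0 -> abs_cont t (w : R -> R^o) ->
  {ae mu, forall s, 0 <= s <= t -> has_der t (w : R -> R^o) s (L (eta s) (w s) (k s))} ->
  u t <= w t.
Proof.
move=> [_ cu Hmin] ea ek e0 et w0 wa wk.
have cw : caratheodory L t u0 eta w.
  split => //; apply: aeI ek wk => s h1 h2; rewrite in_itv/= => st.
  by rewrite (has_der_der t0 st (h1 st)); exact: h2.
have ce : calA L t u0 x0 x eta by split; [|exists w].
by have := Hmin eta w ce cw; rewrite !J_value// lerD2r.
Qed.

Lemma competitor_le x0 x xi u eta k w :
  minimizer L t u0 x0 x xi u -> velocity eta k -> eta 0 = x0 -> eta t = x ->
  w 0 = u0 -> primitive t w (fun s => L (eta s) (w s) (k s)) -> u t <= w t.
Proof.
move=> Hmin ek e0 et w0 wp.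
apply: (competitor_le_ae Hmin (velocity_abs_cont ek) (velocity_has_der ek) e0 et w0).
  exact: primitive_abs_cont wp.
exact: primitive_has_der.
Qed.

End Competitors.

(** * Bi-Lipschitz changes of time *)

Section TimeChange.
Context {R : realType}.
Notation mu := (@lebesgue_measure R).
Notation intble t g := (mu.-integrable `[0, t] (EFin \o (g : R -> R))).
Notation meas t g := (measurable_fun (`[0, t]%classic : set (measurableTypeR R)) (g : R -> R)).
Implicit Types t : R.

(** Inversion is discontinuous at 0, where its value is 0 by convention; the continuous functions
    [x / (x ^+ 2 + 1 / (k + 1))] converge to it everywhere, including at 0. *)
Lemma measurable_inv t (f : R -> R) : meas t f -> meas t (fun s => (f s)^-1).
Proof.
move=> mf; apply: (@measurable_fun_cvg _ _ _ _ (fun (k : nat) s => f s / (f s ^+ 2 + k.+1%:R^-1))).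
- move=> k.
  have c : continuous (fun x : R => x / (x ^+ 2 + k.+1%:R^-1)).
    move=> x; apply: cvgM; first exact: cvg_id.
    apply: cvgV; first by rewrite gt_eqF// ltr_wpDl ?sqr_ge0 ?invr_gt0.
    by apply: cvgD; [exact: exprn_continuous|exact: cvg_cst].
  exact: (measurableT_comp (continuous_measurable_fun c) mf).
- move=> s _; have [fs0|fs0] := eqVneq (f s) 0.
    rewrite fs0 invr0; under eq_fun do rewrite mul0r; exact: cvg_cst.
  rewrite (_ : (f s)^-1 = f s / (f s ^+ 2 + 0)); last by rewrite addr0 expr2 invfM mulrA divff// mul1r.
  apply: cvgM; first exact: cvg_cst.
  apply: cvgV; first by rewrite addr0 expf_neq0.
  by apply: cvgD; [exact: cvg_cst|exact: cvg_harmonic].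
Qed.

Lemma rho_mono_arith (a b c d : R) : a <= b -> d < c -> (c - d) / 2 <= a - b -> False.
Proof. lra. Qed.

Lemma rho_lip_arith (x y : R) : y <= 2 * x -> x / 2 <= y -> y <= 2 * x /\ x <= 2 * y.
Proof. by move=> ? ?; split; lra. Qed.

Lemma rho_end_arith (x : R) : 0 <= x -> x / 2 <= 0 -> x = 0.
Proof. by move=> ? ?; lra. Qed.

Lemma le2_3 (x : R) : 0 <= x -> 2 * x <= x * 3.
Proof. by move=> ?; lra. Qed.

Variables (t : R) (tau rho : R -> R).
Hypothesis t0 : 0 < t.
Hypothesis rho_itv : forall s, 0 <= s <= t -> 0 <= rho s <= t.
Hypothesis tauK : forall s, 0 <= s <= t -> tau (rho s) = s.
Hypothesis tau_lo : forall a b, 0 <= a -> a <= b -> b <= t -> (b - a) / 2 <= tau b - tau a.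
Hypothesis tau_hi : forall a b, 0 <= a -> a <= b -> b <= t -> tau b - tau a <= 2 * (b - a).
Hypothesis tau0 : tau 0 = 0.
Hypothesis taut : tau t = t.

(** [rho] is assumed only to be a right inverse of the clock [tau]; the slopes of [tau], between
    [1 / 2] and 2, make it monotone and bi-Lipschitz. *)
Lemma rho_mono a b : 0 <= a -> a <= b -> b <= t -> rho a <= rho b.
Proof.
move=> a0 ab bt; have at' := le_trans ab bt; have b0 := le_trans a0 ab.
have /andP[ra0 rat] : 0 <= rho a <= t by apply: rho_itv; rewrite a0.
have /andP[rb0 rbt] : 0 <= rho b <= t by apply: rho_itv; rewrite b0.
rewrite leNgt; apply/negP => h.
have := tau_lo rb0 (ltW h) rat; rewrite !tauK ?a0 ?b0//.
exact: rho_mono_arith.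
Qed.

Lemma rho_lip a b : 0 <= a -> a <= b -> b <= t ->
  b - a <= 2 * (rho b - rho a) /\ rho b - rho a <= 2 * (b - a).
Proof.
move=> a0 ab bt; have at' := le_trans ab bt; have b0 := le_trans a0 ab.
have /andP[ra0 rat] : 0 <= rho a <= t by apply: rho_itv; rewrite a0.
have /andP[rb0 rbt] : 0 <= rho b <= t by apply: rho_itv; rewrite b0.
have ra := rho_mono a0 ab bt.
have := tau_lo ra0 ra rbt; have := tau_hi ra0 ra rbt; rewrite !tauK ?a0 ?b0//.
exact: rho_lip_arith.
Qed.

Lemma rho_dist a b : 0 <= a <= t -> 0 <= b <= t -> `|rho b - rho a| <= 2 * `|b - a|.
Proof.
wlog ab : a b / a <= b => [W|] at' bt.
  have [ab|/ltW ba] := leP a b; first exact: W.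
  by rewrite distrC [`|b - a|]distrC; apply: W.
case/andP: at' => a0 _; case/andP: bt => _ bt.
have [_ h] := rho_lip a0 ab bt.
by rewrite !ger0_norm ?subr_ge0// rho_mono.
Qed.

Lemma rho0 : rho 0 = 0.
Proof.
have /andP[r0 rt] : 0 <= rho 0 <= t by apply: rho_itv; rewrite lexx ltW.
have := tau_lo (lexx 0) r0 rt; rewrite tauK ?lexx ?(ltW t0)// tau0 !subr0.
exact: rho_end_arith.
Qed.

Lemma rhot : rho t = t.
Proof.
have /andP[r0 rt] : 0 <= rho t <= t by apply: rho_itv; rewrite lexx ltW.
have := tau_lo r0 rt (lexx t); rewrite tauK ?lexx ?(ltW t0)// taut subrr.
by rewrite -subr_ge0 in rt => h; apply/esym/subr0_eq/rho_end_arith.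
Qed.

(** Serves for preimages of intervals under [rho], of which only the diameter is estimated. *)
Lemma diameter_measure (S : set R) (d : R) : 0 <= d ->
  measurable (S : set (measurableTypeR R)) ->
  (forall x y, S x -> S y -> x <= y -> y - x <= d) -> (mu S <= d%:E)%E.
Proof.
move=> d0 mS H; have [->|/set0P[x0 Sx0]] := eqVneq S set0.
  by rewrite measure0 lee_fin.
have lb : has_lbound S.
  exists (x0 - d) => x Sx; have [xx|xx] := leP x x0; first by have := H _ _ Sx Sx0 xx; lra.
  by rewrite (le_trans _ (ltW xx))// gerBl.
apply: (@le_trans _ _ (mu `[inf S, inf S + d]%classic)).
  apply: le_measure; [by rewrite inE|by rewrite inE; exact: measurable_itv|].
  move=> x Sx; rewrite /= in_itv/= ge_inf//= -lerBlDr.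
  apply: lb_le_inf; first by exists x0.
  move=> y Sy; rewrite lerBlDr -lerBlDl; have [yx|yx] := leP y x; first exact: H.
  by rewrite (le_trans _ d0)// subr_le0 ltW.
suff : (lebesgue_measure (`[inf S, (inf S + d)%R]%classic : set R) <= d%:E)%E by [].
rewrite lebesgue_measure_itv/= lte_fin; case: ifP => _; last by rewrite lee_fin.
by rewrite -EFinD lee_fin addrC addKr.
Qed.

(** As [tau] is 2-Lipschitz, the preimage under [rho] of an interval has at most twice its length;
    covering a null set by an open set of small measure shows that its preimage is null. *)
Lemma ae_time_change (P : R -> Prop) :
  {ae mu, forall s, 0 <= s <= t -> P s} ->
  {ae mu, forall s, 0 <= s <= t -> P (rho s)}.
Proof.
move=> [N [mN N0 PN]].
pose T : set (measurableTypeR R) := `[0, t]%classic.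
have rc : {within T, continuous rho}.
  apply/within_cont_dist => s st e e0.
  exists (e / 2) => [|y yt ys]; first by rewrite divr_gt0.
  by rewrite (le_lt_trans (rho_dist st yt))// mulrC -ltr_pdivlMr.
have mrho := within_cont_meas rc.
have mT : measurable T by exact: measurable_itv.
have mpre A : measurable (A : set (measurableTypeR R)) -> measurable (T `&` rho @^-1` A).
  by move=> mA; exact: mrho.
exists (T `&` rho @^-1` N); split.
- exact: mpre.
- apply/eqP; rewrite eq_le measure_ge0 andbT; apply/lee_addgt0Pr => e e0; rewrite add0e.
  have e20 : 0 < e / 2 by rewrite divr_gt0.
  have [|U [oU NU Ue]] := lebesgue_regularity_outer mN _ e20; first by apply: (@le_lt_trans _ _ 0%E) (ltry 0); rewrite le_eqVlt; apply/orP; left; apply/eqP; exact: N0.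
  have {}Ue : (mu U <= (e / 2)%:E)%E.
    rewrite (_ : U = (U `\` N) `|` N); last by rewrite setUC setDUK.
    rewrite (le_trans (measureU2 _ _ _))//.
      by apply: measurableD => //; exact: open_measurable.
    rewrite -[leRHS]adde0; apply: leeD; first exact: ltW.
    by rewrite le_eqVlt; apply/orP; left; apply/eqP; exact: N0.
  pose I := open_disjoint_itv oU.
  have UI : U = \bigcup_q I q := open_disjoint_itv_bigcup oU.
  have mI q : measurable (I q : set (measurableTypeR R)).
    by apply: (@open_measurable R); exact: open_disjoint_itv_open.
  have tI : trivIset setT I by apply: open_disjoint_itv_trivIset.
  have bnd q : (mu (T `&` rho @^-1` (I q)) <= 2%:E * mu (I q))%E.
    have iI : is_interval (I q) by exact: open_disjoint_itv_is_interval.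
    (* A component of infinite length satisfies the bound trivially. *)
    have [fI|] := boolP (mu (I q) \is a fin_num); last first.
      rewrite ge0_fin_numE ?measure_ge0// ltey negbK => /eqP ->.
      by rewrite gt0_muley ?leey// lte_fin.
    rewrite -(fineK fI) -EFinM; apply: diameter_measure.
    - by rewrite mulr_ge0// fine_ge0.
    - exact: mpre.
    move=> x y [Tx Ix] [Ty Iy] xy; move: Tx Ty; rewrite /T /= !in_itv/= => /andP[x0 xt] /andP[y0 yt].
    have [h1 _] := rho_lip x0 xy yt; rewrite (le_trans h1)// ler_wpM2l//.
    rewrite -lee_fin fineK//; apply: (@le_trans _ _ (mu `[rho x, rho y]%classic)).
      suff : ((rho y - rho x)%:E <= lebesgue_measure (`[rho x, rho y]%classic : set R))%E by [].
      rewrite lebesgue_measure_itv/= lte_fin; case: ltP => h; first by rewrite EFinB.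
      by rewrite lee_fin subr_le0.
    apply: le_measure; [by rewrite inE; exact: measurable_itv|by rewrite inE|].
    by move=> z; rewrite /= in_itv/= => /(iI _ _ Ix Iy).
  apply: (@le_trans _ _ (\sum_(0 <= q <oo) mu (T `&` rho @^-1` (I q)))%E).
    apply: (@le_trans _ _ (mu (\bigcup_q (T `&` rho @^-1` (I q))))).
      apply: le_measure; rewrite ?inE//.
      + exact: mpre.
      + by apply: bigcupT_measurable => q; exact: mpre.
      move=> s [Ts /NU]; rewrite UI => -[q _ Iq]; by exists q.
    have mp q : measurable (T `&` rho @^-1` I q) by exact: mpre.
    by apply: (generalized_Boole_inequality lebesgue_measure); [exact: mp|exact: bigcupT_measurable].
  apply: (@le_trans _ _ (\sum_(0 <= q <oo) (2%:E * mu (I q)))%E).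
    apply: lee_nneseries => [q _ _|q _]; last exact: bnd.
    by rewrite measure_ge0.
  rewrite nneseriesZl; last by move=> q _; exact: measure_ge0.
  rewrite -measure_semi_bigcup//; last by rewrite -UI; exact: open_measurable.
  rewrite -UI (le_trans (lee_wpmul2l _ Ue))//.
  by rewrite -EFinM lee_fin mulrC divfK.
- move=> s /= nP; have [st|nst] := pselect (0 <= s <= t); last by exfalso; apply: nP.
  split; first by rewrite /T /= in_itv.
  by apply: PN => /= H; apply: nP => _; apply: H; exact: rho_itv.
Qed.

(** [rho] itself is never differentiated: differentiability of [tau] at [rho s] gives
    [D = (y - s) / a] up to a small error, and the Lipschitz bound on [rho] turns errors small
    against [D] into errors small against [y - s]. *)
Lemma has_der_time_change {V : normedModType R} (f : R -> V) s (d : V) (a : R) : 0 <= s <= t ->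
  a != 0 -> has_der t f (rho s) d -> has_der t (tau : R -> R^o) (rho s) a ->
  has_der t (f \o rho) s (a^-1 *: d).
Proof.
move=> st a0 fd taud; apply/has_derP => e e0.
have na : 0 < `|a| by rewrite normr_gt0.
pose C := `|d| / `|a| + 1; have C0 : 0 < C by rewrite ltr_wpDl// divr_ge0.
have e1 : 0 < e / (4 * C) by rewrite divr_gt0// mulr_gt0.
have e2 : 0 < e / 4 by rewrite divr_gt0.
have [r1 r10 H1] := (has_derP _ _ _ _).1 taud _ e1.
have [r2 r20 H2] := (has_derP _ _ _ _).1 fd _ e2.
exists (Num.min r1 r2 / 3); first by rewrite divr_gt0// lt_min r10.
move=> y yt; rewrite ltr_pdivlMr// lt_min => /andP[y1 y2] /=.
have ry : `|rho y - rho s| <= 2 * `|y - s|.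
  exact: rho_dist.
have ys3 : 2 * `|y - s| <= `|y - s| * 3 by rewrite le2_3.
have ryt := rho_itv yt.
have h1 := H1 _ ryt (le_lt_trans ry (le_lt_trans ys3 y1)).
have h2 := H2 _ ryt (le_lt_trans ry (le_lt_trans ys3 y2)).
rewrite !tauK// in h1.
set D := rho y - rho s in ry h1 h2 *.
have -> : f (rho y) - f (rho s) - (y - s) *: (a^-1 *: d) =
  (f (rho y) - f (rho s) - D *: d) - ((y - s - D * a) / a) *: d.
  have -> : (y - s - D * a) / a = (y - s) / a - D by field.
  rewrite scalerA [(_ / a - D) *: d]scalerBl.
  by move: (f _ - f _) (D *: d) (((y - s) / a) *: d) => p1 p2 p3; rewrite opprB addrA subrK.
rewrite (le_trans (ler_normB _ _))// normrZ normrM normfV.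
have -> : e * `|y - s| = e / 4 * (2 * `|y - s|) + e / (4 * C) * (2 * `|y - s|) * C.
  by field; rewrite gt_eqF.
apply: lerD; first by rewrite (le_trans h2)// ler_wpM2l// ltW.
rewrite -[_ / `|a| * _]mulrA [(`|a|)^-1 * `|d|]mulrC.
apply: ler_pM; [exact: normr_ge0|exact: divr_ge0| |].
  by rewrite (le_trans h1)// ler_wpM2l// ltW.
by rewrite /C lerDl.
Qed.

End TimeChange.

(** * Growth of the Lagrangian and boundedness of the velocity *)

Section Growth.
Context {R : realType} {n : nat}.
Notation E := 'rV[R]_n.

Lemma enorm_ge0 (v : E) : 0 <= enorm v.
Proof. exact: sqrtr_ge0. Qed.

Lemma enormZ (a : R) (v : E) : enorm (a *: v) = `|a| * enorm v.
Proof.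
have -> : enorm (a *: v) = Num.sqrt (a ^+ 2 * dotv v v).
  by rewrite /enorm /dotv; congr Num.sqrt; rewrite mulr_sumr; apply: eq_bigr => i _; rewrite mxE; ring.
by rewrite sqrtrM ?sqr_ge0// sqrtr_sqr.
Qed.

Lemma coord_le_enorm (v : E) i : `|v 0 i| <= enorm v.
Proof.
rewrite /enorm -sqrtr_sqr ler_wsqrtr// /dotv (bigD1 i)//= -expr2 lerDl.
by apply: sumr_ge0 => j _; rewrite -expr2 sqr_ge0.
Qed.

Lemma enorm_le (v : E) (M : R) : 0 <= M -> (enorm v <= M) = (dotv v v <= M ^+ 2).
Proof.
move=> M0; rewrite -[RHS](@ler_sqrt _ _ (M ^+ 2)) ?sqr_ge0//.
by rewrite sqrtr_sqr ger0_norm.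
Qed.

Lemma superlinear_ge (theta : R -> R) Q : superlinear_nondecreasing theta ->
  exists2 S : R, 1 < S & forall s, S <= s -> Q * s <= theta s.
Proof.
move=> [_ _ /cvgryPge/(_ Q)[M [_ HM]]].
exists (`|M| + 2) => [|s Ss]; first by rewrite (lt_le_trans (ltr1n _ 2))// lerDr.
have M0 := normr_ge0 M; have MM := ler_norm M.
have s0 : 0 < s by apply: lt_le_trans Ss; rewrite ltr_wpDl.
rewrite -ler_pdivlMr//; apply: HM.
by apply: le_lt_trans MM _; apply: lt_le_trans Ss; rewrite ltrDl.
Qed.

Lemma slow_arith (s p1 ps p2 Q C P B : R) : 1 < s -> (2 * s - 1) * ps <= (s - 1) * p2 + s * p1 ->
  p1 <= C -> Q * s - B <= ps -> Q = C + P + B -> 0 <= P -> 0 <= B -> 2 * ps - p2 <= - P.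
Proof.
move=> s1 H pC pQ QE P0 B0; rewrite -subr_ge0 -(pmulr_rge0 _ (_ : 0 < s - 1)) ?subr_gt0//.
have h1 : s * p1 <= s * C by rewrite ler_wpM2l//; lra.
have h2 : 0 <= (s - 1) * B by rewrite mulr_ge0//; lra.
by subst Q; nra.
Qed.

Variable L : E -> R -> E -> R.
Hypothesis hC2 : C2_lagrangian L.
Hypothesis hL1 : cond_L1 L.
Hypothesis hL2 : cond_L2' L.
Variable K : R.
Hypothesis hK : forall x r v, `|Dr L x r v| <= K.

Lemma lagrangian_gt0 x r v : 0 < L x r v.
Proof. by have [] := hL1 x r. Qed.

Lemma lagrangian_lip x r r' v : `|L x r' v - L x r v| <= K * `|r' - r|.
Proof.
have [_ /(_ (0, 1, 0))[F1 _]] := phaseL_C2 hC2.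
have [c _] := mvt_line (x, r, v) (r' - r) F1.
rewrite !phase_line !scaler0 !addr0 !mulr1 [r + (_ - _)]addrC subrK.
rewrite -DrE /phaseL/= => ->; rewrite normrM mulrC.
by rewrite ler_wpM2r.
Qed.

Lemma lagrangian_convex x r v w (a : R) : 0 <= a <= 1 ->
  L x r (a *: v + (1 - a) *: w) <= a * L x r v + (1 - a) * L x r w.
Proof.
move=> /andP[]; rewrite le_eqVlt => /predU1P[<- _|a0].
  by rewrite scale0r subr0 scale1r !add0r mul0r mul1r add0r.
rewrite le_eqVlt => /predU1P[->|a1].
  by rewrite subrr !scale0r scale1r mul0r mul1r !addr0.
have [->|vw] := eqVneq v w.
  by rewrite -scalerDl -mulrDl addrCA subrr addr0 scale1r mul1r.
by have [_ H _] := hL1 x r; apply/ltW/H.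
Qed.

Lemma lagrangian_upper M rho : exists2 C : R, 0 < C &
  forall x r v, `|r| <= rho -> enorm v <= M -> L x r v <= C.
Proof.
have [[ubt [th [c0 [[u0 um _] _ _ _ H]]] _]] := hL2.
pose M' := `|M|; have M'0 : 0 <= M' by exact: normr_ge0.
have K0 : 0 <= K by apply: le_trans (hK 0 0 0).
exists (ubt M' + K * `|rho| + 1) => [|x r v rr vM].
  by rewrite ltr_wpDl// addr_ge0 ?u0// mulr_ge0.
have h1 := lagrangian_lip x 0 r v; rewrite subr0 in h1.
have h2 : L x r v - L x 0 v <= K * `|rho|.
  rewrite (le_trans (ler_norm _))// (le_trans h1)// ler_wpM2l//.
  by rewrite (le_trans rr)// ler_norm.
have h3 : L x 0 v <= ubt M'.
  have /andP[_ h] := H x v; rewrite (le_trans h)// um ?enorm_ge0//.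
  by rewrite (le_trans vM)// ler_norm.
have := lerD h2 h3; rewrite subrK => h; rewrite (le_trans h)//.
by rewrite [ubt _ + _]addrC lerDl.
Qed.

Lemma scale_arith (d a e b s ps p2 p1 : R) : 0 <= d -> d * a = e -> d * b = s ->
  ps <= a * p2 + b * p1 -> d * ps <= e * p2 + s * p1.
Proof. by move=> d0 <- <- h; rewrite -!mulrA -mulrDr ler_wpM2l. Qed.

Lemma superlinear_arith (k a e l0 l c0 q : R) : l0 - l <= k -> a - c0 <= l0 -> q * e <= a -> q * e - (c0 + k) <= l.
Proof. lra. Qed.

(** The order of quantifiers matters: [B] does not depend on [Q], so [lagrangian_slow] can choose
    [Q] in terms of [B]. *)
Lemma lagrangian_superlinear rho : exists2 B : R, 0 <= B & forall Q, exists2 S : R, 1 < S &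
  forall x r v, `|r| <= rho -> S <= enorm v -> Q * enorm v - B <= L x r v.
Proof.
have [[ubt [th [c0 [_ hth _ c00 H]]] _]] := hL2.
have K0 : 0 <= K by apply: le_trans (hK 0 0 0).
exists (c0 + K * `|rho|) => [|Q]; first by rewrite addr_ge0 ?(ltW c00)// mulr_ge0.
have [S S1 HS] := superlinear_ge Q hth.
exists S => // x r v rr vS.
have h1 := lagrangian_lip x 0 r v; rewrite subr0 in h1.
have h2 : L x 0 v - L x r v <= K * `|rho|.
  rewrite (le_trans (ler_norm _))// distrC (le_trans h1)// ler_wpM2l//.
  by rewrite (le_trans rr)// ler_norm.
have /andP[h3 _] := H x v.
exact: superlinear_arith h2 h3 (HS _ vS).
Qed.

(** Let [s] be half the length of [v] and [w] the unit vector along [v]. Then [v / 2] is a convex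
    combination of [v] and [w], which gives [(s - 1) * (2 L(v/2) - L(v)) <= s * L(w) - L(v/2)]. Here
    [L(w)] is at most [C] and [L(v/2)] at least [Q * s - B], and [Q = C + P + B] makes the right
    side at most [- (s - 1) * P]. *)
Lemma lagrangian_slow rho P : 0 <= P -> exists2 N : R, 0 < N &
  forall x r v, `|r| <= rho -> N <= enorm v -> 2 * L x r (2^-1 *: v) - L x r v <= - P.
Proof.
move=> P0; have [B B0 H] := lagrangian_superlinear rho.
have [C C0 HC] := lagrangian_upper 1 rho.
have [S S1 HS] := H (C + P + B).
exists (2 * S) => [|x r v rr vS]; first by rewrite mulr_gt0// (lt_trans _ S1).
set s := enorm v / 2; have sS : S <= s by rewrite ler_pdivlMr// mulrC.
have s1 : 1 < s by exact: lt_le_trans sS.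
have s0 : 0 < s by rewrite (lt_trans _ s1).
have es : enorm (2^-1 *: v) = s by rewrite enormZ ger0_norm// mulrC.
pose a := (s - 1) / (2 * s - 1).
have d0 : 0 < 2 * s - 1 by move: s1; move: (s) => z; lra.
have aI : 0 <= a <= 1.
  rewrite /a divr_ge0//= ?ler_pdivrMr//; move: s1; move: (s) => z; lra.
have := lagrangian_convex x r v (s^-1 *: (2^-1 *: v)) aI.
have -> : a *: v + (1 - a) *: (s^-1 *: (2^-1 *: v)) = 2^-1 *: v.
  rewrite !scalerA -scalerDl; congr (_ *: _); rewrite /a.
  by field; rewrite !gt_eqF.
move=> h; apply: (@slow_arith s (L x r (s^-1 *: (2^-1 *: v))) _ _ (C + P + B) C P B) => //.
- have E1 : (2 * s - 1) * a = s - 1 by rewrite mulrC divfK ?gt_eqF.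
  have E2 : (2 * s - 1) * (1 - a) = s by rewrite mulrBr E1 mulr1; ring.
  exact: scale_arith (ltW d0) E1 E2 h.
- by apply: HC => //; rewrite enormZ es gtr0_norm ?invr_gt0// mulVf// gt_eqF.
- by rewrite -es; apply: HS => //; rewrite es.
Qed.

(** [v / (1 - k)] lies on the segment from [v] to [2 v], at parameter [k / (1 - k)]. Convexity
    bounds the cost by [k * L(2 v) - 2 k * L(v)], and positivity of [L] removes the last term; the
    cost of speeding up is thus linear in [k]. *)
Lemma lagrangian_fast rho M : 0 <= M -> exists2 C : R, 0 < C &
  forall x r v k, `|r| <= rho -> enorm v <= M -> 0 <= k <= 2^-1 ->
    (1 - k) * L x r ((1 - k)^-1 *: v) - L x r v <= k * C.
Proof.
move=> M0; have [C C0 HC] := lagrangian_upper (2 * M) rho.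
exists C => // x r v k rr vM /andP[k0 k1].
have k10 : 0 < 1 - k by move: k1; move: (k) => z; lra.
have aI : 0 <= k / (1 - k) <= 1.
  rewrite divr_ge0//= ?ler_pdivrMr//; first by move: k1; move: (k) => z; lra.
  exact: ltW.
have := lagrangian_convex x r (2 *: v) v aI.
have -> : (k / (1 - k)) *: (2 *: v) + (1 - k / (1 - k)) *: v = (1 - k)^-1 *: v.
  rewrite !scalerA -scalerDl; congr (_ *: _).
  by field; rewrite gt_eqF.
move=> /(ler_wpM2l (ltW k10)).
have -> : (1 - k) * (k / (1 - k) * L x r (2 *: v) + (1 - k / (1 - k)) * L x r v) =
    k * L x r (2 *: v) + (1 - 2 * k) * L x r v by field; rewrite gt_eqF.
have h2 : k * L x r (2 *: v) <= k * C.
  by rewrite ler_wpM2l// HC// enormZ ger0_norm// ler_wpM2l.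
have h3 := mulr_ge0 k0 (ltW (lagrangian_gt0 x r v)).
move: h2 h3; move: (L x r v) (L x r (2 *: v)) (L x r (_ *: v)) => p1 p2 p3 h2 h3 h4.
nra.
Qed.

End Growth.

(** * Linear form of the comparison equation; auxiliary integral estimates *)

Section PicardFactor.
Context {R : realType}.
Notation mu := (@lebesgue_measure R).
Notation intble t g := (mu.-integrable `[0, t] (EFin \o (g : R -> R))).
Notation meas t g := (measurable_fun (`[0, t]%classic : set (measurableTypeR R)) (g : R -> R)).

Lemma quotient_bound (a b k : R) : 0 <= k -> `|a| <= k * `|b| -> `|a / b| <= k.
Proof.
move=> k0; have [->|b0] := eqVneq b 0; first by rewrite invr0 mulr0 normr0.
by rewrite normrM normfV ler_pdivrMr// normr_gt0.
Qed.

(** The difference quotient [m] of [h] between [D] and 0 is bounded by [K] and turns the equation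
    into the linear one [D' = m * D + h s 0]. Where [D s = 0], division gives [m s = 0] and the
    identity persists. *)
Lemma picard_factor t (K : R) (h : R -> R -> R) : 0 < t -> 0 < K ->
  (forall w : R -> R, meas t w -> meas t (fun s => h s (w s))) ->
  intble t (fun s => h s 0) ->
  (forall s r r', 0 <= s <= t -> `|h s r - h s r'| <= K * `|r - r'|) ->
  exists D lam : R -> R, [/\ D 0 = 0, primitive t D (fun s => h s (D s)),
    forall s, 0 <= s <= t -> `|lam s| <= K * t,
    intble t (fun s => expR (- lam s) * h s 0) &
    expR (- lam t) * D t = Rintegral mu `[0, t] (fun s => expR (- lam s) * h s 0)].
Proof.
move=> t0 K0 hm h0 hK; have [D [D0 Dp _]] := picard_solution t0 K0 hm h0 hK.
pose m s := (h s (D s) - h s 0) / D s.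
have mD : meas t D by exact: intble_meas (primitive_intble Dp).
have mm : meas t m.
  apply: measurable_funM; last exact: measurable_inv.
  by apply: measurable_funB; [exact: hm|exact: intble_meas h0].
have mK s : 0 <= s <= t -> `|m s| <= K.
  move=> st; apply: quotient_bound; first exact: ltW.
  by rewrite (le_trans (hK s _ _ st))// subr0.
have im : intble t m := intble_bounded mm mK.
pose lam s := 0 + Rintegral mu `[0, s] m.
have lp : primitive t lam m by exact: integral_primitive.
have Dp' : primitive t D (fun s => m s * D s + h s 0).
  apply: (primitive_eq t0 Dp).
    apply: intbleD => //; apply: (intble_Ml mm mK); exact: primitive_intble Dp.
  apply/aeW => s _; rewrite /m; have [E|Dn] := eqVneq (D s) 0.
    by rewrite E mulr0 add0r.
  by rewrite divfK// subrK.
have [E iE] := integrating_factor t0 mm mK h0 Dp' D0 lp.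
exists D, lam; split => // s st.
rewrite /lam add0r (le_trans (Rint_abs_le st im (intble_cst t K) mK))//.
by case/andP: st => s0 st; rewrite Rint_cst// ler_wpM2l// ltW.
Qed.

Lemma primitive_incr t (f g : R -> R) c d a b : primitive t f g ->
  0 <= a -> a <= b -> b <= t -> (forall s, a <= s <= b -> c <= g s <= d) ->
  c * (b - a) <= f b - f a <= d * (b - a).
Proof.
move=> fg a0 ab bt gcd; rewrite (primitive_itv fg)//.
have E : lebesgue_measure (`]a, b]%classic : set R) = (b - a)%:E.
  rewrite lebesgue_measure_itv/= lte_fin.
  by case: ltgtP ab => // <- _; rewrite subrr.
have I (r : R) : Rintegral mu `]a, b] (fun=> r) = r * (b - a).
  by rewrite Rintegral_cst// [X in fine X](E : mu _ = _).
have mab : measurable (`]a, b]%classic : set (measurableTypeR R)) by exact: measurable_itv.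
have ig : mu.-integrable `]a, b] (EFin \o g).
  have [ig _] := fg; apply: integrableS ig => //.
  by apply: subset_itv; rewrite bnd_simp.
have ic (r : R) : mu.-integrable `]a, b] (EFin \o (fun=> r)).
  by apply: integrableS (intble_cst t r) => //; apply: subset_itv; rewrite bnd_simp.
have st s : `]a, b]%classic s -> a <= s <= b.
  by rewrite /= in_itv/= => /andP[sa sb]; rewrite (ltW sa).
by rewrite -!I; apply/andP; split; apply: le_Rintegral => // s /st /gcd /andP[].
Qed.

Lemma intble_sum t (I : Type) (r : seq I) (F : I -> R -> R) : (forall i, intble t (F i)) ->
  intble t (fun s => \sum_(i <- r) F i s).
Proof.
move=> H; elim: r => [|i r IH].
  by under [X in EFin \o X]eq_fun do rewrite big_nil; exact: intble_cst.
by under [X in EFin \o X]eq_fun do rewrite big_cons; exact: intbleD.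
Qed.

(** The integrals over [[0, s]] lie between 0 and the one over [[0, t]], so the zero function is a
    primitive of [f], and its derivative is [f] almost everywhere. *)
Lemma nonneg_null t (f : R -> R) : 0 < t -> intble t f -> (forall s, 0 <= s <= t -> 0 <= f s) ->
  Rintegral mu `[0, t] f = 0 -> {ae mu, forall s, 0 <= s <= t -> f s = 0}.
Proof.
move=> t0 bi f0 bE.
have bp : primitive t (fun=> 0) f.
  split => // s st; rewrite add0r; apply/eqP; rewrite eq_le; apply/andP; split.
    case/andP: (st) => s0 _; rewrite -[X in X <= _](mul0r s) -(Rint_cst 0 s0).
    by apply: (Rint_le st) => //; exact: intble_cst.
  by rewrite -[leRHS]bE; apply: Rint_mono.
apply: aeS (primitive_has_der t0 bp) => s H st.
apply: (has_der_unique t0 st (H st)).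
exact: has_der_cst.
Qed.

End PicardFactor.

(** * Boundedness of the velocity by a change of speed *)

Section LipschitzMinimizer.
Context {R : realType} {n : nat}.
Notation mu := (@lebesgue_measure R).
Notation E := 'rV[R]_n.
Notation intble t g := (mu.-integrable `[0, t] (EFin \o (g : R -> R))).
Notation meas t g := (measurable_fun (`[0, t]%classic : set (measurableTypeR R)) (g : R -> R)).

Lemma enorm_le_sum (v : E) : enorm v <= \sum_i `|v 0 i|.
Proof.
have s0 : 0 <= \sum_i `|v 0 i| by apply: sumr_ge0.
rewrite enorm_le// expr2 mulr_suml; apply: ler_sum => i _.
rewrite (le_trans (ler_norm _))// normrM ler_wpM2l//.
by rewrite (bigD1 i)//= lerDl sumr_ge0.
Qed.

Variables (L : E -> R -> E -> R) (t u0 : R) (x0 x : E) (xi : R -> E) (u : R -> R).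
Hypothesis t0 : 0 < t.
Hypothesis hC2 : C2_lagrangian L.
Hypothesis hL1 : cond_L1 L.
Hypothesis hL2 : cond_L2' L.
Variable K : R.
Hypothesis K0 : 0 < K.
Hypothesis hK : forall x r v, `|Dr L x r v| <= K.
Hypothesis hmin : minimizer L t u0 x0 x xi u.
Variable g : R -> E.
Hypothesis xg : velocity t xi g.

Lemma velocity_meas i : meas t (fun s => g s 0 i).
Proof. by have [gi _] := xg i; exact: intble_meas gi. Qed.

Lemma minimizer_ac : abs_cont t xi.
Proof. exact: velocity_abs_cont xg. Qed.

Lemma curve_meas i : meas t (fun s => xi s 0 i).
Proof. exact: intble_meas (primitive_intble (xg i)). Qed.

Lemma action_ac : abs_cont t (u : R -> R^o).
Proof. by have [_ []] := hmin. Qed.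

Lemma action_meas : meas t u.
Proof. exact: within_cont_meas (abs_cont_within action_ac). Qed.

Lemma lagrangian_meas (y : R -> E) (r : R -> R) (w : R -> E) :
  (forall i, meas t (fun s => y s 0 i)) -> meas t r -> (forall i, meas t (fun s => w s 0 i)) ->
  meas t (fun s => L (y s) (r s) (w s)).
Proof.
move=> my mr mw; apply: (phase_measurable (F := phaseL L)) => //.
by apply: Ck0 (phaseL_C2 hC2).
Qed.

Lemma action_primitive : primitive t u (fun s => L (xi s) (u s) (g s)).
Proof.
have [_ cu _] := hmin; apply: (caratheodory_primitive t0 xg cu).
by apply: lagrangian_meas; [exact: curve_meas|exact: action_meas|exact: velocity_meas].
Qed.

Lemma speed_meas : meas t (fun s => enorm (g s)).
Proof.
have c : continuous (Num.sqrt : R -> R) by exact: sqrt_continuous.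
apply: (measurableT_comp (continuous_measurable_fun c)).
rewrite /dotv; apply: measurable_sum => i.
by apply: measurable_funM; exact: velocity_meas.
Qed.

Definition total_speed := Rintegral mu `[0, t] (fun s => \sum_i `|g s 0 i|).

Lemma indicator_intble (N : R) : intble t (fun s => if N <= enorm (g s) then 1 else 0).
Proof.
apply: (@intble_bounded _ _ _ 1) => [|s _]; last by case: ifP => _; rewrite ?normr1 ?normr0.
apply: measurable_fun_if => //.
- by apply: measurable_fun_ler => //; exact: speed_meas.
Qed.

Lemma markov_speed (N : R) : 0 < N ->
  Rintegral mu `[0, t] (fun s => if N <= enorm (g s) then 1 else 0) <= total_speed / N.
Proof.
move=> N0; rewrite ler_pdivlMr// mulrC.
have tt : 0 <= t <= t by rewrite lexx ltW.
have ig : intble t (fun s => \sum_i `|g s 0 i|).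
  by apply: intble_sum => i; apply: intble_norm; have [] := xg i.
rewrite -RintegralZl//; last exact: indicator_intble.
apply: (Rint_le tt) => //; first by apply: intbleZ; exact: indicator_intble.
move=> s _; case: ifP => [h|_].
  by rewrite mulr1 (le_trans h)// enorm_le_sum.
by rewrite mulr0 sumr_ge0.
Qed.

(** The competitor follows the path of [xi] with velocity [(a s)^-1 *: g s], spending [a s] units of
    time per unit of the old one; the condition on the integral of [a] keeps the total duration.
    Expressed in the old time its action is [u + D] with [D' = h s D], whose linear form has the
    source term [q], and minimality gives [0 <= D t]. *)
Lemma slow_motion (a : R -> R) (C : R) : meas t a ->
  (forall s, 2^-1 <= a s <= 2) -> Rintegral mu `[0, t] a = t ->
  (forall s, 0 <= s <= t ->
    `|a s * L (xi s) (u s) ((a s)^-1 *: g s) - L (xi s) (u s) (g s)| <= L (xi s) (u s) (g s) + C) ->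
  let q s := a s * L (xi s) (u s) ((a s)^-1 *: g s) - L (xi s) (u s) (g s) in
  exists lam : R -> R, [/\ forall s, 0 <= s <= t -> `|lam s| <= 2 * K * t,
    intble t (fun s => expR (- lam s) * q s) &
    0 <= Rintegral mu `[0, t] (fun s => expR (- lam s) * q s)].
Proof.
move=> ma aI at1 qC q.
have a0 s : 0 < a s by apply: lt_le_trans (proj1 (andP (aI s))); rewrite invr_gt0.
have a2 s : `|a s| <= 2 by rewrite gtr0_norm//; case/andP: (aI s).
have mga i : meas t (fun s => ((a s)^-1 *: g s) 0 i).
  rewrite (_ : (fun s => _) = (fun s => (a s)^-1 * g s 0 i)); last by apply/funext => s; rewrite mxE.
  apply: measurable_funM; last exact: velocity_meas.
  exact: measurable_inv.
have mL : meas t (fun s => L (xi s) (u s) (g s)) by have [/intble_meas] := action_primitive.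
have iL : intble t (fun s => L (xi s) (u s) (g s)) by have [] := action_primitive.
pose h s y := a s * L (xi s) (u s + y) ((a s)^-1 *: g s) - L (xi s) (u s) (g s).
have hm w : meas t w -> meas t (fun s => h s (w s)).
  move=> mw; apply: measurable_funB => //; apply: measurable_funM => //.
  apply: lagrangian_meas => //; first exact: curve_meas.
  by apply: measurable_funD => //; exact: action_meas.
have q0 : q = (fun s => h s 0) by apply/funext => s; rewrite /h addr0.
have iq : intble t q.
  have mq : meas t q by rewrite q0; apply: (hm (fun=> 0)); exact: measurable_cst.
  apply: (intble_le mq) qC; apply: intbleD => //; exact: intble_cst.
have hlip s r r' : 0 <= s <= t -> `|h s r - h s r'| <= 2 * K * `|r - r'|.
  move=> _; rewrite /h opprB addrA subrK -mulrBr normrM -mulrA.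
  apply: ler_pM => //; have := lagrangian_lip hC2 hK (xi s) (u s + r') (u s + r) ((a s)^-1 *: g s).
  by rewrite opprD addrACA subrr add0r.
have K20 : 0 < 2 * K by rewrite mulr_gt0.
rewrite q0 in iq; have [D [lam [D0 Dp lamK ilq DE]]] := picard_factor t0 K20 hm iq hlip.
exists lam; rewrite q0; split => //; rewrite -DE; apply: mulr_ge0; first exact: expR_ge0.
have ia : intble t a := intble_bounded ma (fun s _ => a2 s).
(* With [rho] the inverse of the clock [tau], [u + D] composed with [rho] solves
   the Caratheodory equation along [xi \o rho]. *)
pose tau s := 0 + Rintegral mu `[0, s] a.
have tp : primitive t tau a by exact: integral_primitive.
have tau0 : tau 0 = 0 by rewrite /tau set_itv1 Rintegral_set1 addr0.
have taut : tau t = t by rewrite /tau add0r.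
have tau_b p r : 0 <= p -> p <= r -> r <= t -> 2^-1 * (r - p) <= tau r - tau p <= 2 * (r - p).
  by move=> p0 pr rt; apply: (primitive_incr tp).
have tau_lo p r : 0 <= p -> p <= r -> r <= t -> (r - p) / 2 <= tau r - tau p.
  by move=> p0 pr rt; rewrite mulrC; case/andP: (tau_b p r p0 pr rt).
have tau_hi p r : 0 <= p -> p <= r -> r <= t -> tau r - tau p <= 2 * (r - p).
  by move=> p0 pr rt; case/andP: (tau_b p r p0 pr rt).
have /choice[rho Hrho] : forall s, exists r, 0 <= s <= t -> 0 <= r <= t /\ tau r = s.
  move=> s; have [st|nst] := pselect (0 <= s <= t); last by exists 0.
  have tc := abs_cont_within (primitive_abs_cont tp).
  have [|c] := IVT (v := s) (ltW t0) tc.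
    by rewrite tau0 taut min_l ?max_r ?(ltW t0).
  by rewrite in_itv/= => ct cE; exists c.
have rho_itv s : 0 <= s <= t -> 0 <= rho s <= t by move=> /Hrho[].
have tauK s : 0 <= s <= t -> tau (rho s) = s by move=> /Hrho[].
have r0 := rho0 t0 rho_itv tauK tau_lo tau0.
have rt := rhot t0 rho_itv tauK tau_lo taut.
have rlip p r : 0 <= p -> p < r -> r <= t -> 0 <= rho r - rho p <= 2 * (r - p).
  move=> p0 /ltW pr rt'; have [_ ->] := rho_lip rho_itv tauK tau_lo tau_hi p0 pr rt'.
  by rewrite subr_ge0 (rho_mono rho_itv tauK tau_lo).
have uDac : abs_cont t ((fun s => u s + D s) : R -> R^o).
  by apply: abs_contD; [exact: action_ac|exact: primitive_abs_cont Dp].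
have main : {ae mu, forall s, 0 <= s <= t -> [/\ has_der t xi (rho s) (g (rho s)),
    has_der t (tau : R -> R^o) (rho s) (a (rho s)) &
    has_der t ((fun s => u s + D s) : R -> R^o) (rho s)
      (L (xi (rho s)) (u (rho s)) (g (rho s)) + h (rho s) (D (rho s)))]}.
  apply: (ae_time_change rho_itv tauK tau_lo tau_hi (P := fun s =>
    [/\ has_der t xi s (g s), has_der t (tau : R -> R^o) s (a s) &
    has_der t ((fun s => u s + D s) : R -> R^o) s (L (xi s) (u s) (g s) + h s (D s))])).
  have H1 := aeI (fun s a b => conj a b) (velocity_has_der t0 xg) (primitive_has_der t0 tp).
  have H2 := aeI (fun s a b => conj a b) (primitive_has_der t0 action_primitive) (primitive_has_der t0 Dp).
  apply: aeI H1 H2 => s [h1 h2] [h3 h4] st.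
  by split; [exact: h1|exact: h2|apply: has_derD; [exact: h3|exact: h4]].
pose w s := u (rho s) + D (rho s).
have cmp : u t <= w t.
  have [_ _ Hm] := hmin; have [[[_ xi0 xit] _] [_ u00 _] _] := hmin.
  apply: (competitor_le_ae t0 hL1 (eta := xi \o rho) (k := fun s => (a (rho s))^-1 *: g (rho s)) (w := w) hmin).
  - exact: (abs_cont_comp_mono _ r0 rt rlip minimizer_ac).
  - apply: aeS main => s H st; have [h1 h2 h3] := H st.
    by apply: (has_der_time_change rho_itv tauK tau_lo tau_hi st) => //; rewrite gt_eqF.
  - by rewrite /= r0.
  - by rewrite /= rt.
  - by rewrite /w r0 D0 addr0.
  - exact: (abs_cont_comp_mono _ r0 rt rlip uDac).
  - apply: aeS main => s H st; have [h1 h2 h3] := H st.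
    have an : a (rho s) != 0 by rewrite gt_eqF.
    have := has_der_time_change rho_itv tauK tau_lo tau_hi st an h3 h2.
    by rewrite /h addrCA subrr addr0 /GRing.scale/= mulKf.
by move: cmp; rewrite /w rt lerDl.
Qed.

Let ind N s : R := if N <= enorm (g s) then 1 else 0.

Lemma indicator_comb N M c0 c1 c2 :
  intble t (fun s => c0 + c1 * ind N s + c2 * ind M s) /\
  Rintegral mu `[0, t] (fun s => c0 + c1 * ind N s + c2 * ind M s) =
  c0 * t + c1 * Rintegral mu `[0, t] (ind N) + c2 * Rintegral mu `[0, t] (ind M).
Proof.
have ic := intble_cst t c0.
have iN := intbleZ c1 (indicator_intble N); have iM := intbleZ c2 (indicator_intble M).
have icN := intbleD ic iN; split; first exact: intbleD.
rewrite RintegralD// RintegralD// Rint_cst ?(ltW t0)//.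
by rewrite !RintegralZl//; exact: indicator_intble.
Qed.

Lemma speed_bound_arith (P e C al k be aM tt : R) : 0 < e -> 0 < al -> k * be = al ->
  be = tt - aM -> P = e ^+ 2 * C + 1 ->
  e * (k * C) * tt + (- P / e) * al + (- (e * (k * C))) * aM < 0.
Proof.
move=> e0 al0 E1 E2 E3.
have -> : e * (k * C) * tt + (- P / e) * al + (- (e * (k * C))) * aM =
  e * C * (k * be) - P / e * al by rewrite E2; ring.
rewrite E1 E3.
have -> : e * C * al - (e ^+ 2 * C + 1) / e * al = - (al / e) by field; rewrite gt_eqF.
by rewrite oppr_lt0 divr_gt0.
Qed.

Lemma comb_arith (kC p m l C : R) : 0 <= p -> 0 <= m -> kC <= 1 * C -> 0 <= l ->
  kC - p - m <= l + C.
Proof. lra. Qed.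

Lemma speed_bounded : exists2 N : R, 0 < N &
  {ae mu, forall s, 0 <= s <= t -> enorm (g s) <= N}.
Proof.
have [U U0 HU] := abs_cont_bounded action_ac.
have I0 : 0 <= total_speed by apply: Rintegral_ge0 => s _; apply: sumr_ge0.
(* By Markov's inequality the speed is at least [M] on a set of measure at most [t / 2], which
   leaves at least [t / 2] for catching up. *)
pose M := 2 * total_speed / t + 1.
have M0 : 0 < M by rewrite ltr_wpDl// divr_ge0 ?(ltW t0)// mulr_ge0.
pose aM := Rintegral mu `[0, t] (ind M).
have aM2 : aM <= t / 2.
  rewrite (le_trans (markov_speed M0))// ler_pdivrMr// /M mulrDr mulr1.
  have -> : t / 2 * (2 * total_speed / t) = total_speed by field; rewrite gt_eqF.
  by rewrite lerDl divr_ge0// ltW.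
have [C C0 HC] := lagrangian_fast hC2 hL1 hL2 hK U (ltW M0).
pose e := expR (2 * K * t); have e0 : 0 < e by exact: expR_gt0.
(* The integrating factor lies between [1 / e] and [e]. Slowing down gains at least [P / e] per unit
   of fast time, in total [P / e * al]; catching up costs at most [e * k * C * be = e * C * al].
   With this [P] the balance is at most [- al / e]. *)
pose P := e ^+ 2 * C + 1.
have P0 : 0 <= P by rewrite addr_ge0// mulr_ge0 ?sqr_ge0// ltW.
have [N1 N10 HN1] := lagrangian_slow hC2 hL1 hL2 hK U P0.
(* The last summand forces [al <= t / 4], hence [k <= 1 / 2], as [lagrangian_fast] requires. *)
pose N := N1 + M + (4 * total_speed / t).
have IN : 0 <= 4 * total_speed / t by rewrite divr_ge0 ?(ltW t0)// mulr_ge0.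
have NN1 : N1 <= N by rewrite /N -addrA lerDl addr_ge0// ltW.
have NM : M <= N by rewrite /N addrAC lerDr addr_ge0// ltW.
have N0 : 0 < N by exact: lt_le_trans NM.
exists N => //.
pose al := Rintegral mu `[0, t] (ind N).
have al4 : al <= t / 4.
  rewrite (le_trans (markov_speed N0))// ler_pdivrMr//.
  have {1}-> : total_speed = t / 4 * (4 * total_speed / t) by field; rewrite gt_eqF.
  rewrite ler_wpM2l ?divr_ge0 ?(ltW t0)// /N lerDr addr_ge0// ltW//.
have al0 : 0 <= al by apply: Rintegral_ge0 => s _; rewrite /ind; case: ifP.
have [alE|aln] := eqVneq al 0.
  have ind0 s : 0 <= ind N s by rewrite /ind; case: ifP.
  apply: aeS (nonneg_null t0 (indicator_intble N) (fun s _ => ind0 s) alE) => s H st.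
  by have := H st; rewrite /ind; case: ltP => [/ltW//|_ /eqP]; rewrite oner_eq0.
have {al0 aln} al0 : 0 < al by rewrite lt_neqAle eq_sym aln.
pose be := t - aM.
have be2 : 2 * al <= be by rewrite /be; move: al4 aM2; move: (al) (aM) => p r; lra.
have be0 : 0 < be by apply: lt_le_trans be2; rewrite mulr_gt0.
(* Doubling the time spent on the fast set costs an extra [al], recovered at the rate [k] over the
   set, of measure [be], where the speed is below [M]. *)
pose k := al / be.
have kbe : k * be = al by rewrite divfK// gt_eqF.
have k0 : 0 < k by exact: divr_gt0.
have k12 : 0 <= k <= 2^-1 by rewrite ltW//= ler_pdivrMr// ler_pdivlMl.
have [k12l k12r] := andP k12.
(* [a] is 2 where the speed is at least N, 1 - k where it is below M, and 1
   elsewhere. *)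
pose a s := (1 - k) + 1 * ind N s + k * ind M s.
have [ia aE] := indicator_comb N M (1 - k) 1 k.
have aP s : [\/ N <= enorm (g s) /\ a s = 2, ind N s = 0 /\ ind M s = 1 /\ a s = 1 |
    [/\ enorm (g s) <= M, ind N s = 0, ind M s = 0 & a s = 1 - k]].
  rewrite /a /ind; have [h1|h1] := leP N (enorm (g s)).
    by rewrite (le_trans NM h1); constructor 1; split => //; ring.
  have [h2|h2] := leP M (enorm (g s)); first by constructor 2; split => //; split => //; ring.
  by constructor 3; split => //; [exact: ltW|ring].
have aI s : 2^-1 <= a s <= 2.
  case: (aP s) => [[_ ->]|[_ [_ ->]]|[_ _ _ ->]]; move: k12l k12r; move: (k) => z; lra.
have at1 : Rintegral mu `[0, t] a = t.
  rewrite aE -/al -/aM mul1r -[in LHS]kbe /be; ring.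
pose q s := a s * L (xi s) (u s) ((a s)^-1 *: g s) - L (xi s) (u s) (g s).
have qle s : 0 <= s <= t -> q s <= k * C + (- P) * ind N s + (- (k * C)) * ind M s.
  move=> st; rewrite /q; case: (aP s) => [[h ->]|[-> [-> ->]]|[h -> -> ->]].
  - rewrite /ind h (le_trans NM h) !mulr1 addrAC subrr add0r.
    by apply: HN1; [exact: HU|exact: le_trans NN1 h].
  - by rewrite invr1 scale1r mul1r subrr mulr1 mulr0 addr0 subrr.
  - by rewrite !mulr0 !addr0; apply: HC => //; exact: HU.
have qC s : 0 <= s <= t -> `|q s| <= L (xi s) (u s) (g s) + C.
  move=> st; have L0 := ltW (lagrangian_gt0 hL1 (xi s) (u s) (g s)).
  rewrite ler_norml opprD; apply/andP; split.
    have h : 0 <= a s * L (xi s) (u s) ((a s)^-1 *: g s).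
      by rewrite mulr_ge0 ?(ltW (lagrangian_gt0 hL1 _ _ _))// (le_trans _ (proj1 (andP (aI s)))) ?invr_ge0.
    by rewrite /q; move: h C0; move: (a s * _) (L _ _ (g s)) => z1 z2; lra.
  rewrite (le_trans (qle s st))//.
  have h1 : 0 <= P * ind N s by rewrite mulr_ge0// /ind; case: ifP.
  have h2 : 0 <= k * C * ind M s by apply: mulr_ge0; [rewrite mulr_ge0// ltW|rewrite /ind; case: ifP].
  have h3 : k * C <= 1 * C by rewrite ler_wpM2r ?(ltW C0)// (le_trans k12r)// invf_le1 ?ler1n.
  by rewrite !mulNr; exact: comb_arith.
have ma : meas t a by exact: intble_meas ia.
have [lam [lamK ilq]] := slow_motion ma aI at1 qC.
suff h : Rintegral mu `[0, t] (fun s => expR (- lam s) * q s) < 0.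
  by move=> h'; have := le_lt_trans h' h; rewrite ltxx.
(* These give a pointwise bound of the weighted [q]: [c'] on the fast set, 0 between the two
   thresholds, [c] below [M]. *)
pose c := e * (k * C); pose c' := - P / e.
have [ic cE] := indicator_comb N M c c' (- c).
have tt : 0 <= t <= t by rewrite lexx ltW.
apply: le_lt_trans (Rint_le tt ilq ic _) _; last first.
  by rewrite cE; apply: (speed_bound_arith e0 al0 kbe).
move=> s st.
have /ler_normlP[l1 l2] := lamK s st.
have el : expR (- lam s) <= e by rewrite ler_expR.
have eu : e^-1 <= expR (- lam s) by rewrite -expRN ler_expR lerN2.
have h := ler_wpM2l (expR_ge0 (- lam s)) (qle s st).
apply: (le_trans h); rewrite /c /c' /ind.
case: (aP s) => [[hN _]|[hN [hM _]]|[hM hN0 hM0 _]].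
- rewrite hN (le_trans NM hN) !mulr1 addrAC subrr add0r addrAC subrr add0r.
  by rewrite mulrN mulNr lerN2 mulrC; apply: ler_wpM2r.
- rewrite /ind in hN hM; rewrite hN hM !mulr0 !addr0 !mulr1 subrr mulr0 subrr//.
- rewrite /ind in hN0 hM0; rewrite hN0 hM0 !mulr0 !addr0.
  by rewrite ler_wpM2r// mulr_ge0// ltW.
Qed.

End LipschitzMinimizer.

(** * First variation *)

Section PhaseBounds.
Context {R : realType} {n : nat}.
Notation E := 'rV[R]_n.
Notation V := (E * R^o * E)%type.

Lemma rV_closed_ball_compact (X : R) : compact [set v : E | forall i, `[- X, X]%classic (v 0 i)].
Proof. by apply: (rV_compact (A := fun=> `[- X, X]%classic)) => i; exact: segment_compact. Qed.

Lemma phase_bounded (F : V -> R^o) (X : R) : continuous F -> exists2 C : R, 0 < C &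
  forall x r w, `|x| <= X -> `|r| <= X -> `|w| <= X -> `|F (x, r, w)| <= C.
Proof.
move=> Fc; pose A := [set v : E | forall i, `[- X, X]%classic (v 0 i)].
have cA : compact (A `*` (`[- X, X]%classic : set R^o) `*` A).
  apply: compact_setX; last exact: rV_closed_ball_compact.
  by apply: compact_setX; [exact: rV_closed_ball_compact|exact: segment_compact].
have /compact_bounded[M [_ HM]] := continuous_compact (continuous_subspaceT Fc) cA.
exists (`|M| + 1); first by rewrite ltr_wpDl.
have inA (v : E) : `|v| <= X -> A v.
  by move=> vX i; rewrite /= in_itv/= -ler_norml (le_trans (le_rV_norm v i)).
move=> x r w xX rX wX; apply: (HM (`|M| + 1)); first by rewrite (le_lt_trans (ler_norm M))// ltrDl.
exists (x, r, w) => //; split => /=; last exact: inA.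
by split => /=; [exact: inA|rewrite /= in_itv/= -ler_norml].
Qed.

Lemma norm_evec_le (a : R) i : `|a *: evec i : E| <= `|a|.
Proof.
apply: rV_norm_le => // j; rewrite !mxE eqxx/= normrM.
by case: (j == i); rewrite ?normr1 ?mulr1// normr0 mulr0.
Qed.

Variable L : E -> R -> E -> R.
Hypothesis hC2 : C2_lagrangian L.

(** The three arguments move together along one line of the phase space, so a single intermediate
    parameter [c] serves all three partial derivatives. *)
Lemma variation_mvt x r w i (p d q e : R) : exists2 c : R, `|c| <= `|e| &
  let x' := x + c *: (p *: evec i) in let r' := r + c * d in let w' := w + c *: (q *: evec i) in
  L (x + e *: (p *: evec i)) (r + e * d) (w + e *: (q *: evec i)) - L x r w =
  e * (p * Dx L x' r' w' 0 i + Dr L x' r' w' * d + q * Dv L x' r' w' 0 i).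
Proof.
have [_ /(_ ((p *: evec i, d, q *: evec i) : V))[F1 _]] := phaseL_C2 hC2.
have [c ce H] := mvt_line (x, r, w) e F1.
exists c => //=; move: H; rewrite !phase_line derive_phaseL// /phaseL/= => ->.
by rewrite !dotv_evec.
Qed.

Lemma variation_mvt0 x r w i (p q e : R) : exists2 c : R, `|c| <= `|e| &
  let x' := x + c *: (p *: evec i) in let w' := w + c *: (q *: evec i) in
  L (x + e *: (p *: evec i)) (r + 0) (w + e *: (q *: evec i)) - L x r w =
  e * (p * Dx L x' r w' 0 i + q * Dv L x' r w' 0 i).
Proof.
have [c ce H] := variation_mvt x r w i p 0 q e; exists c => //=.
by move: H => /=; rewrite !mulr0 !addr0.
Qed.

End PhaseBounds.

Section DominatedLimit.
Context {R : realType}.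
Notation mu := (@lebesgue_measure R).
Notation intble t g := (mu.-integrable `[0, t] (EFin \o (g : R -> R))).
Notation meas t g := (measurable_fun (`[0, t]%classic : set (measurableTypeR R)) (g : R -> R)).

Lemma primitiveD t (f g f' g' : R -> R) : primitive t f f' -> primitive t g g' ->
  primitive t (fun s => f s + g s) (fun s => f' s + g' s).
Proof.
move=> [if' fE] [ig' gE]; split; first exact: intbleD.
move=> x xt; case/andP: (xt) => _ xt'.
rewrite fE// gE// RintegralD//; [|exact: integrable_sub xt' if'|exact: integrable_sub xt' ig'].
by rewrite addrACA.
Qed.

Lemma primitiveZ t (c : R) (f f' : R -> R) : primitive t f f' ->
  primitive t (fun s => c * f s) (fun s => c * f' s).
Proof.
move=> [if' fE]; split; first exact: intbleZ.
move=> x xt; case/andP: (xt) => _ xt'.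
by rewrite fE// RintegralZl ?mulrDr//; exact: integrable_sub xt' if'.
Qed.

Lemma bounded_limit_ge0 t (f_ : nat -> R -> R) (f : R -> R) (C : R) :
  (forall k, meas t (f_ k)) -> (forall k s, 0 <= s <= t -> `|f_ k s| <= C) ->
  (forall s, 0 <= s <= t -> f_ ^~ s @ \oo --> f s) ->
  (forall k, 0 <= Rintegral mu `[0, t] (f_ k)) -> 0 <= Rintegral mu `[0, t] f.
Proof.
move=> mf fC ff f0.
have ifk k : intble t (f_ k) := intble_bounded (mf k) (fC k).
apply: fine_ge0.
have iC := intble_cst t C.
have cv : (\int[mu]_(x in `[0%R, t]) (f_ k x)%:E)%E @[k --> \oo] --> (\int[mu]_(x in `[0%R, t]) (f x)%:E)%E.
  apply: (@dominated_cvg _ _ _ mu _ _ (fun k => EFin \o f_ k) (EFin \o f) (EFin \o (fun=> C))) => //.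
  - by move=> k; apply/measurable_EFinP; exact: mf.
  - move=> s; rewrite /= in_itv/= => st; apply: cvg_EFin; [exact: nearW|exact: ff].
rewrite -(cvg_lim _ cv)//; apply: lime_ge; first by apply/cvg_ex; eexists; exact: cv.
apply: nearW => k; have := f0 k; rewrite /Rintegral.
have fk : (\int[mu]_(x in `[0%R, t]) (f_ k x)%:E)%E \is a fin_num by exact: (integrable_fin_num (mItv t) (ifk k)).
by rewrite -lee_fin fineK.
Qed.

(* Test against [b] minus its mean. *)
Lemma orthogonal_to_mean_zero t (b : R -> R) (M : R) : 0 < t -> meas t b ->
  (forall s, 0 <= s <= t -> `|b s| <= M) ->
  (forall (psi : R -> R) (N : R), meas t psi -> (forall s, 0 <= s <= t -> `|psi s| <= N) ->
    Rintegral mu `[0, t] psi = 0 -> Rintegral mu `[0, t] (fun s => psi s * b s) = 0) ->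
  exists c : R, {ae mu, forall s, 0 <= s <= t -> b s = c}.
Proof.
move=> t0 mb bM H; pose c := Rintegral mu `[0, t] b / t; exists c.
have ib := intble_bounded mb bM.
have ic := intble_cst t (- c).
pose psi s := b s + (- c).
have ipsi : intble t psi by exact: intbleD.
have mpsi := intble_meas ipsi.
have psiM s : 0 <= s <= t -> `|psi s| <= M + `|c|.
  by move=> st; rewrite (le_trans (ler_normD _ _))// normrN lerD2r bM.
have psi0 : Rintegral mu `[0, t] psi = 0.
  rewrite RintegralD// Rint_cst ?(ltW t0)// /c mulNr divfK ?subrr//.
  by rewrite gt_eqF.
have H1 := H psi _ mpsi psiM psi0.
have i1 : intble t (fun s => psi s * b s) by apply: (intble_Ml mpsi psiM).
have i2 : intble t (fun s => - c * psi s) by exact: intbleZ.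
have sqE : (fun s => psi s * psi s) = (fun s => psi s * b s + - c * psi s).
  by apply/funext => s; rewrite {2}/psi mulrDr [_ * - c]mulrC.
have sq0 : Rintegral mu `[0, t] (fun s => psi s * psi s) = 0.
  by rewrite sqE RintegralD// H1 RintegralZl// psi0 mulr0 addr0.
have isq : intble t (fun s => psi s * psi s) by apply: (intble_Ml mpsi psiM).
apply: aeS (nonneg_null t0 isq (fun s _ => sqr_ge0 (psi s)) sq0) => s h st.
by have /eqP := h st; rewrite mulf_eq0 orbb subr_eq0 => /eqP.
Qed.

End DominatedLimit.

(** * The Du Bois-Reymond equation *)

Section FirstVariation.
Context {R : realType} {n : nat}.
Notation mu := (@lebesgue_measure R).
Notation E := 'rV[R]_n.
Notation intble t g := (mu.-integrable `[0, t] (EFin \o (g : R -> R))).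
Notation meas t g := (measurable_fun (`[0, t]%classic : set (measurableTypeR R)) (g : R -> R)).

Lemma seq_cvg_comp (V : normedModType R) (F : V -> R^o) (z : V) (z_ : nat -> V) (M : R) :
  continuous F -> (forall k, `|z_ k - z| <= k.+1%:R^-1 * M) -> F (z_ k) @[k --> \oo] --> F z.
Proof.
move=> Fc zM; apply: continuous_cvg; first exact: Fc.
apply/cvgrPdist_le => e e0.
have h0 : k.+1%:R^-1 * M @[k --> \oo] --> (0 : R).
  rewrite -[X in _ --> X](mul0r M); apply: cvgM; [exact: cvg_harmonic|exact: cvg_cst].
near=> k; rewrite distrC (le_trans (zM k))// (le_trans (ler_norm _))//.
rewrite -normrN -sub0r.
by near: k; move/cvgrPdist_le : h0; exact.
Unshelve. all: by end_near.
Qed.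

Lemma cvg0_bounded (a b : nat -> R) (M : R) : a k @[k --> \oo] --> (0 : R) ->
  (forall k, `|b k| <= M) -> a k * b k @[k --> \oo] --> (0 : R).
Proof.
move=> a0 bM; have M0 : 0 <= M := le_trans (normr_ge0 _) (bM 0%N).
apply/cvgrPdist_le => e e0.
have e1 : 0 < e / (M + 1) by rewrite divr_gt0// ltr_wpDl.
near=> k; rewrite sub0r normrN normrM.
apply: (@le_trans _ _ (e / (M + 1) * (M + 1))); last by rewrite divfK// gt_eqF// ltr_wpDl.
apply: ler_pM => //; last by rewrite (le_trans (bM k))// lerDl.
by near: k; move/cvgrPdist_le : a0 => /(_ _ e1); apply: filterS => k; rewrite sub0r normrN.
Unshelve. all: by end_near.
Qed.

Variables (L : E -> R -> E -> R) (t u0 : R) (x0 x : E) (xi : R -> E) (u : R -> R).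
Hypothesis t0 : 0 < t.
Hypothesis hC2 : C2_lagrangian L.
Hypothesis hL1 : cond_L1 L.
Variable K : R.
Hypothesis K0 : 0 < K.
Hypothesis hK : forall x r v, `|Dr L x r v| <= K.
Hypothesis hmin : minimizer L t u0 x0 x xi u.
Variable g : R -> E.
Hypothesis xg : velocity t xi g.
Variable X : R.
Hypothesis xiX : forall s, 0 <= s <= t -> `|xi s| <= X.
Hypothesis uX : forall s, 0 <= s <= t -> `|u s| <= X.
Hypothesis gX : forall s, 0 <= s <= t -> `|g s| <= X.

Let Lx i s := Dx L (xi s) (u s) (g s) 0 i.
Let Lr s := Dr L (xi s) (u s) (g s).
Let Lv i s := Dv L (xi s) (u s) (g s) 0 i.

Lemma Dx_continuous i : continuous ((fun z => Dx L z.1.1 z.1.2 z.2 0 i) : E * R^o * E -> R^o).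
Proof.
have [c _] := phaseL_dC1 hC2 (evec i, 0, 0).
by rewrite (_ : (fun z => _) = 'D_(evec i, 0, 0) (phaseL L))//; apply/funext => -[[y r] w]; rewrite DxE.
Qed.

Lemma Dv_continuous i : continuous ((fun z => Dv L z.1.1 z.1.2 z.2 0 i) : E * R^o * E -> R^o).
Proof.
have [c _] := phaseL_dC1 hC2 (0, 0, evec i).
by rewrite (_ : (fun z => _) = 'D_(0, 0, evec i) (phaseL L))//; apply/funext => -[[y r] w]; rewrite DvE.
Qed.

Lemma Dr_continuous : continuous ((fun z => Dr L z.1.1 z.1.2 z.2) : E * R^o * E -> R^o).
Proof.
have [c _] := phaseL_dC1 hC2 (0, 1, 0).
by rewrite (_ : (fun z => _) = 'D_(0, 1, 0) (phaseL L))//; apply/funext => -[[y r] w]; rewrite DrE.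
Qed.

Lemma along_meas (F : E * R^o * E -> R^o) : continuous F -> meas t (fun s => F (xi s, u s, g s)).
Proof.
move=> Fc; apply: phase_measurable => //.
- exact: curve_meas xg.
- exact: action_meas hmin.
- exact: velocity_meas xg.
Qed.

Lemma Lx_meas i : meas t (Lx i).
Proof. exact: along_meas (@Dx_continuous i). Qed.

Lemma Lr_meas : meas t Lr.
Proof. exact: along_meas Dr_continuous. Qed.

Lemma Lv_meas i : meas t (Lv i).
Proof. exact: along_meas (@Dv_continuous i). Qed.

Lemma Lr_intble : intble t Lr.
Proof. by apply: (@intble_bounded _ _ _ K Lr_meas) => s _; exact: hK. Qed.

(** Exponent of the integrating factor of the linearized equation [D' = Lr * D + q]. *)
Definition lam s := 0 + Rintegral mu `[0, s] Lr.

Lemma lam_primitive : primitive t lam Lr.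
Proof. exact/integral_primitive/Lr_intble. Qed.

Lemma lam_bound s : 0 <= s <= t -> `|lam s| <= K * t.
Proof.
move=> st.
rewrite /lam add0r (le_trans (Rint_abs_le st Lr_intble (intble_cst t K) (fun s _ => hK _ _ _)))//.
by case/andP: st => s0 st; rewrite Rint_cst// ler_wpM2l// ltW.
Qed.

Lemma lam_meas : meas t lam.
Proof. exact: intble_meas (primitive_intble lam_primitive). Qed.

Lemma expNlam_meas : meas t (fun s => expR (- lam s)).
Proof.
apply: (measurableT_comp (continuous_measurable_fun (@continuous_expR R))).
by apply: measurableT_comp => //; exact: lam_meas.
Qed.

Lemma expNlam_bound s : 0 <= s <= t -> `|expR (- lam s)| <= expR (K * t).
Proof.
move=> st; rewrite ger0_norm ?expR_ge0// ler_expR.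
by have := lam_bound st; rewrite ler_norml => /andP[h _]; rewrite lerNl.
Qed.

(** For small [ep > 0], the curve [xi] moved by [ep * phi] in coordinate [i] has a Caratheodory
    solution [u + D] with [D] of order [ep]. With the equation written as [D' = Lr * D + q],
    minimality makes the weighted integral of [q] nonnegative, and [q / ep] tends boundedly to
    [phi * Lx + psi * Lv]. *)
Lemma first_variation_ge0 i (phi psi : R -> R) (B : R) : primitive t phi psi ->
  phi 0 = 0 -> phi t = 0 -> (forall s, 0 <= s <= t -> `|phi s| <= B) ->
  (forall s, 0 <= s <= t -> `|psi s| <= B) ->
  0 <= Rintegral mu `[0, t] (fun s => expR (- lam s) * (phi s * Lx i s + psi s * Lv i s)).
Proof.
move=> pp phi0 phit phiB psiB.
have tt : 0 <= t <= t by rewrite lexx ltW.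
have B0 : 0 <= B by apply: le_trans (phiB t tt).
have [C1 C10 HC1] := phase_bounded (X + B) (@Dx_continuous i).
have [C2 C20 HC2] := phase_bounded (X + B) (@Dv_continuous i).
pose ep (k : nat) : R := k.+1%:R^-1.
have ep0 k : 0 < ep k by rewrite invr_gt0.
have ep1 k : ep k <= 1 by rewrite invf_le1 ?ler1n.
pose h k s y := L (xi s + ep k *: (phi s *: evec i)) (u s + y) (g s + ep k *: (psi s *: evec i)) -
  L (xi s) (u s) (g s).
have iL := (action_primitive t0 hC2 hmin xg).1.
have mphi : meas t phi := intble_meas (primitive_intble pp).
have mpsi : meas t psi := intble_meas pp.1.
have mxi i' k : meas t (fun s => (xi s + ep k *: (phi s *: evec i)) 0 i').
  rewrite (_ : (fun s => _) = (fun s => xi s 0 i' + ep k * (phi s * (evec i : E) 0 i'))).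
    apply: measurable_funD; first exact: curve_meas xg i'.
    by apply: measurable_funM; [exact: measurable_cst|apply: measurable_funM].
  by apply/funext => s; rewrite !mxE.
have mg i' k : meas t (fun s => (g s + ep k *: (psi s *: evec i)) 0 i').
  rewrite (_ : (fun s => _) = (fun s => g s 0 i' + ep k * (psi s * (evec i : E) 0 i'))).
    apply: measurable_funD; first exact: velocity_meas xg i'.
    by apply: measurable_funM; [exact: measurable_cst|apply: measurable_funM].
  by apply/funext => s; rewrite !mxE.
have hm k w : meas t w -> meas t (fun s => h k s (w s)).
  move=> mw; apply: measurable_funB; last exact: intble_meas iL.
  apply: lagrangian_meas => //; apply: measurable_funD => //; exact: action_meas hmin.
have shiftB s (c p : R) k : 0 <= s <= t -> `|c| <= `|ep k| -> `|p| <= B -> `|c * p| <= B.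
  move=> st; rewrite (gtr0_norm (ep0 k)) => cE pB.
  by rewrite normrM -[leRHS]mul1r ler_pM// (le_trans cE).
have curveB s (c p : R) k (y : E) : 0 <= s <= t -> `|c| <= `|ep k| -> `|p| <= B -> `|y| <= X ->
    `|y + c *: (p *: evec i)| <= X + B.
  move=> st cE pB yX; rewrite (le_trans (ler_normD _ _))// lerD// scalerA.
  by rewrite (le_trans (norm_evec_le _ _))// (shiftB s _ _ k).
have h0B k s : 0 <= s <= t -> `|h k s 0| <= ep k * (B * C1 + B * C2).
  move=> st; rewrite /h.
  have [c cE] := variation_mvt0 hC2 (xi s) (u s) (g s) i (phi s) (psi s) (ep k).
  move=> /= ->; rewrite normrM (gtr0_norm (ep0 k)).
  rewrite ler_wpM2l ?(ltW (ep0 k))// (le_trans (ler_normD _ _))// !normrM.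
  have uB : `|u s| <= X + B by rewrite (le_trans (uX st))// lerDl.
  apply: lerD; apply: ler_pM => //.
  - exact: phiB.
  - by apply: HC1 => //; [apply: (curveB s _ _ k) => //; [exact: phiB|exact: xiX]|apply: (curveB s _ _ k) => //; [exact: psiB|exact: gX]].
  - exact: psiB.
  - by apply: HC2 => //; [apply: (curveB s _ _ k) => //; [exact: phiB|exact: xiX]|apply: (curveB s _ _ k) => //; [exact: psiB|exact: gX]].
have m0 k : meas t (fun s => h k s 0) by apply: (hm k (fun=> 0)); exact: measurable_cst.
have i0 k : intble t (fun s => h k s 0) := intble_bounded (m0 k) (h0B k).
have hlip k s r r' : 0 <= s <= t -> `|h k s r - h k s r'| <= K * `|r - r'|.
  move=> _; rewrite /h opprB addrA subrK.
  rewrite (le_trans (lagrangian_lip hC2 hK _ _ _ _))//.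
  by rewrite opprD addrACA subrr add0r.
(* The Picard bound divided by [ep k]; it is independent of [k] because [h k s 0] is itself of order
   [ep k]. *)
pose BD := 2 * ((B * C1 + B * C2) * t) * expR (2 * K * t).
have /choice[D HD] : forall k, exists D : R -> R, [/\ D 0 = 0, primitive t D (fun s => h k s (D s)) &
    forall s, 0 <= s <= t -> `|D s| <= ep k * BD].
  move=> k; have [D [D0 Dp DB]] := picard_solution t0 K0 (hm k) (i0 k) (hlip k).
  exists D; split => // s st; rewrite (le_trans (DB s st))// /BD mulrA ler_wpM2r ?expR_ge0//.
  rewrite mulrCA ler_wpM2l// mulrA -(Rint_cst (ep k * (B * C1 + B * C2)) (ltW t0)).
  apply: (Rint_le (t := t)); [by rewrite lexx ltW|exact/intble_norm/i0|exact: intble_cst|exact: h0B].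
have Dt k : 0 <= D k t.
  have [D0 Dp DB] := HD k.
  have [_ [_ u00 _] _] := hmin; have [[[_ xi0 xit] _] _ _] := hmin.
  pose w s := u s + D k s.
  suff : u t <= w t by rewrite /w lerDl.
  have ek : velocity t (fun s => xi s + ep k *: (phi s *: evec i)) (fun s => g s + ep k *: (psi s *: evec i)).
    move=> j.
    have pj := xg j.
    rewrite (_ : (fun s => _) = (fun s => xi s 0 j + (ep k * (evec i : E) 0 j) * phi s)); last first.
      by apply/funext => s; rewrite !mxE mulrAC mulrA.
    rewrite [X in primitive _ _ X](_ : _ = (fun s => g s 0 j + (ep k * (evec i : E) 0 j) * psi s)); last first.
      by apply/funext => s; rewrite !mxE mulrAC mulrA.
    exact: primitiveD (primitiveZ _ pp).
  apply: (competitor_le t0 hL1 hmin ek).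
  - by rewrite phi0 scale0r scaler0 addr0.
  - by rewrite phit scale0r scaler0 addr0.
  - by rewrite /w D0 addr0.
  rewrite [X in primitive _ _ X](_ : _ = (fun s => L (xi s) (u s) (g s) + h k s (D k s))); last first.
    by apply/funext => s; rewrite /h addrCA subrr addr0.
  exact: primitiveD (action_primitive t0 hC2 hmin xg) Dp.
(* Only the value of [L_r] on the minimizer enters the integrating factor. The error of using it at
   the intermediate point is put into [q]; divided by [ep k] it still vanishes in the limit, since
   [D / ep] is bounded. *)
pose q k s := h k s (D k s) - Lr s * D k s.
have LrK s : 0 <= s <= t -> `|Lr s| <= K by move=> _; exact: hK.
have iq k : intble t (q k).
  have [D0 Dp DB] := HD k; rewrite /q; apply: intbleD; first exact: Dp.1.
  by apply: intbleN; apply: (intble_Ml Lr_meas LrK); exact: primitive_intble Dp.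
have intq k : 0 <= Rintegral mu `[0, t] (fun s => expR (- lam s) * q k s).
  have [D0 Dp DB] := HD k.
  have Dp' : primitive t (D k) (fun s => Lr s * D k s + q k s).
    rewrite (_ : (fun s => _ + _) = (fun s => h k s (D k s)))//.
    by apply/funext => s; rewrite /q addrC subrK.
  have [<- _] := integrating_factor t0 Lr_meas LrK (iq k) Dp' D0 lam_primitive.
  by rewrite mulr_ge0 ?expR_ge0.
(* [z] is the intermediate point of the mean value theorem for the step [ep k] in the direction
   given by [phi], [D / ep] and [psi]; it tends to the base point and stays in a fixed bounded
   set. *)
have key k s : 0 <= s <= t -> exists z : E * R^o * E,
    [/\ `|z - (xi s, u s, g s)| <= ep k * (B + BD),
      [/\ `|z.1.1| <= X + B, `|z.1.2| <= X + BD & `|z.2| <= X + B],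
      `|(ep k)^-1 * D k s| <= BD &
    (ep k)^-1 * q k s = phi s * Dx L z.1.1 z.1.2 z.2 0 i + psi s * Dv L z.1.1 z.1.2 z.2 0 i +
      (Dr L z.1.1 z.1.2 z.2 - Lr s) * ((ep k)^-1 * D k s)].
  move=> st; have [D0 Dp DB] := HD k.
  have [c cE] := variation_mvt hC2 (xi s) (u s) (g s) i (phi s) ((ep k)^-1 * D k s) (psi s) (ep k).
  rewrite /= mulVKf ?gt_eqF// => E1.
  exists (xi s + c *: (phi s *: evec i), u s + c * ((ep k)^-1 * D k s), g s + c *: (psi s *: evec i)) => /=.
  have BD0 : 0 <= BD.
    by rewrite !mulr_ge0 ?expR_ge0 ?addr_ge0 ?mulr_ge0 ?(ltW t0) ?(ltW C10) ?(ltW C20).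
  rewrite (gtr0_norm (ep0 k)) in cE.
  have small (p : R) (y : E) : `|p| <= B -> `|y + c *: (p *: evec i) - y| <= ep k * (B + BD).
    move=> pB; rewrite addrAC subrr add0r scalerA (le_trans (norm_evec_le _ _))// normrM.
    by rewrite ler_pM// (le_trans pB)// lerDl.
  have DBk : `|(ep k)^-1 * D k s| <= BD.
    by rewrite normrM gtr0_norm ?invr_gt0// ler_pdivrMl//; exact: DB.
  split.
  - apply: phase_norm_le => /=; [exact/small/phiB| |exact/small/psiB].
    by rewrite addrAC subrr add0r normrM ler_pM// (le_trans DBk)// lerDr.
  - split.
    + by apply: (curveB s _ _ k) => //; [rewrite (gtr0_norm (ep0 k))|exact: phiB|exact: xiX].
    + rewrite (le_trans (ler_normD _ _))// lerD//; first exact: uX.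
      by rewrite normrM -[leRHS]mul1r ler_pM// (le_trans cE).
    + by apply: (curveB s _ _ k) => //; [rewrite (gtr0_norm (ep0 k))|exact: psiB|exact: gX].
  - exact: DBk.
  - rewrite /q /h E1 mulrBr mulKf ?gt_eqF//.
    by rewrite mulrBl [(ep k)^-1 * (Lr s * _)]mulrCA addrA; congr (_ - _); rewrite addrAC.
have BD0 : 0 <= BD.
  by rewrite !mulr_ge0 ?expR_ge0 ?addr_ge0 ?mulr_ge0 ?(ltW t0) ?(ltW C10) ?(ltW C20).
have [C3 C30 HC3] := phase_bounded (X + B + BD) (@Dx_continuous i).
have [C4 C40 HC4] := phase_bounded (X + B + BD) (@Dv_continuous i).
apply: (bounded_limit_ge0 (f_ := fun k s => expR (- lam s) * ((ep k)^-1 * q k s))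
  (C := expR (K * t) * (B * C3 + B * C4 + (K + K) * BD))).
- move=> k; apply: measurable_funM; first exact: expNlam_meas.
  by apply: measurable_funM; [exact: measurable_cst|exact: intble_meas (iq k)].
- move=> k s st; rewrite normrM; apply: ler_pM => //; first exact: expNlam_bound.
  have [z [_ [z1 z2 z3] dB ->]] := key k s st.
  have z1' : `|z.1.1| <= X + B + BD by rewrite (le_trans z1)// lerDl.
  have z2' : `|z.1.2| <= X + B + BD by rewrite (le_trans z2)// lerD2r lerDl.
  have z3' : `|z.2| <= X + B + BD by rewrite (le_trans z3)// lerDl.
  rewrite (le_trans (ler_normD _ _))//; apply: lerD; last first.
    rewrite normrM; apply: ler_pM => //; rewrite (le_trans (ler_normB _ _))//.
    by rewrite lerD// ?LrK// hK.
  rewrite (le_trans (ler_normD _ _))// !normrM; apply: lerD; apply: ler_pM => //.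
  + exact: phiB.
  + exact: HC3.
  + exact: psiB.
  + exact: HC4.
- move=> s st.
  have /choice[z Hz] : forall k, exists z : E * R^o * E,
    [/\ `|z - (xi s, u s, g s)| <= ep k * (B + BD), `|(ep k)^-1 * D k s| <= BD &
    (ep k)^-1 * q k s = phi s * Dx L z.1.1 z.1.2 z.2 0 i + psi s * Dv L z.1.1 z.1.2 z.2 0 i +
      (Dr L z.1.1 z.1.2 z.2 - Lr s) * ((ep k)^-1 * D k s)].
    by move=> k; have [z [z1 _ z2 z3]] := key k s st; exists z.
  have zd k : `|z k - (xi s, u s, g s)| <= k.+1%:R^-1 * (B + BD) by have [] := Hz k.
  have c1 := seq_cvg_comp (@Dx_continuous i) zd.
  have c2 := seq_cvg_comp (@Dv_continuous i) zd.
  have c3 := seq_cvg_comp Dr_continuous zd.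
  apply: cvgM; first exact: cvg_cst.
  rewrite (_ : (fun k => (ep k)^-1 * q k s) = (fun k => phi s * Dx L (z k).1.1 (z k).1.2 (z k).2 0 i +
      psi s * Dv L (z k).1.1 (z k).1.2 (z k).2 0 i +
      (Dr L (z k).1.1 (z k).1.2 (z k).2 - Lr s) * ((ep k)^-1 * D k s))); last first.
    by apply/funext => k; have [_ _ ->] := Hz k.
  have -> : phi s * Lx i s + psi s * Lv i s = phi s * Lx i s + psi s * Lv i s + 0 by rewrite addr0.
  apply: cvgD.
    by apply: cvgD; apply: cvgM; [exact: cvg_cst|exact: c1|exact: cvg_cst|exact: c2].
  apply: (cvg0_bounded (M := BD)) => [|k]; last by have [] := Hz k.
  rewrite -[X in _ --> X](subrr (Lr s)); apply: cvgB; [exact: c3|exact: cvg_cst].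
- move=> k.
  have -> : (fun s => expR (- lam s) * ((ep k)^-1 * q k s)) =
      (fun s => (ep k)^-1 * (expR (- lam s) * q k s)) by apply/funext => s; rewrite mulrCA.
  rewrite RintegralZl//; first by rewrite mulr_ge0// invr_ge0 ltW.
  by apply: (intble_Ml expNlam_meas expNlam_bound).
Qed.

Lemma Lx_bounded i : exists2 C : R, 0 < C & forall s, 0 <= s <= t -> `|Lx i s| <= C.
Proof.
have [C C0 HC] := phase_bounded X (@Dx_continuous i); exists C => // s st.
by apply: HC; [exact: xiX|exact: uX|exact: gX].
Qed.

Lemma Lv_bounded i : exists2 C : R, 0 < C & forall s, 0 <= s <= t -> `|Lv i s| <= C.
Proof.
have [C C0 HC] := phase_bounded X (@Dv_continuous i); exists C => // s st.
by apply: HC; [exact: xiX|exact: uX|exact: gX].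
Qed.

(** The opposite variation [- phi] gives the reverse inequality. *)
Lemma first_variation_eq0 i (phi psi : R -> R) (B : R) : primitive t phi psi ->
  phi 0 = 0 -> phi t = 0 -> (forall s, 0 <= s <= t -> `|phi s| <= B) ->
  (forall s, 0 <= s <= t -> `|psi s| <= B) ->
  intble t (fun s => expR (- lam s) * (phi s * Lx i s + psi s * Lv i s)) ->
  Rintegral mu `[0, t] (fun s => expR (- lam s) * (phi s * Lx i s + psi s * Lv i s)) = 0.
Proof.
move=> pp phi0 phit phiB psiB ii; apply/eqP; rewrite eq_le (first_variation_ge0 i pp phi0 phit phiB psiB) andbT.
rewrite -oppr_ge0 -mulN1r -RintegralZl//.
have -> : (fun s => -1 * (expR (- lam s) * (phi s * Lx i s + psi s * Lv i s))) =
    (fun s => expR (- lam s) * ((-1 * phi s) * Lx i s + (-1 * psi s) * Lv i s)).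
  by apply/funext => s; ring.
apply: (first_variation_ge0 i (B := B)).
- exact: primitiveZ.
- by rewrite phi0 mulr0.
- by rewrite phit mulr0.
- by move=> s st; rewrite mulN1r normrN; exact: phiB.
- by move=> s st; rewrite mulN1r normrN; exact: psiB.
Qed.

(** Integration by parts replaces [phi] by [psi] in the [Lx] term, through the primitive [Q] of
    [expR (- lam) * Lx]. What remains, [expR (- lam) * Lv - Q], is orthogonal to every bounded [psi]
    of mean zero, hence almost everywhere a constant [c], and [P = expR lam * (Q + c)]. *)
Lemma euler_lagrange_coord i : exists P : R -> R,
  primitive t P (fun s => Lx i s + Lr s * P s) /\
  {ae mu, forall s, 0 <= s <= t -> Lv i s = P s}.
Proof.
have [Cx Cx0 HCx] := Lx_bounded i; have [Cv Cv0 HCv] := Lv_bounded i.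
have tt : 0 <= t <= t by rewrite lexx ltW.
pose A s := expR (- lam s) * Lx i s; pose Bv s := expR (- lam s) * Lv i s.
have mA : meas t A by apply: measurable_funM; [exact: expNlam_meas|exact: Lx_meas].
have mB : meas t Bv by apply: measurable_funM; [exact: expNlam_meas|exact: Lv_meas].
have bA s : 0 <= s <= t -> `|A s| <= expR (K * t) * Cx.
  by move=> st; rewrite normrM ler_pM// ?HCx// expNlam_bound.
have bB s : 0 <= s <= t -> `|Bv s| <= expR (K * t) * Cv.
  by move=> st; rewrite normrM ler_pM// ?HCv// expNlam_bound.
have iA := intble_bounded mA bA; have iB := intble_bounded mB bB.
pose Q s := 0 + Rintegral mu `[0, s] A.
have Qp : primitive t Q A by exact: integral_primitive.
have iQ := primitive_intble Qp; have mQ := intble_meas iQ.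
have [CQ CQ0 HQ] := abs_cont_bounded (primitive_abs_cont Qp).
have Q0 : Q 0 = 0 by rewrite /Q set_itv1 Rintegral_set1 addr0.
pose b s := Bv s + - Q s.
have mb : meas t b by apply: intble_meas; apply: intbleD => //; exact: intbleN.
have bb s : 0 <= s <= t -> `|b s| <= expR (K * t) * Cv + CQ.
  by move=> st; rewrite (le_trans (ler_normD _ _))// normrN lerD// ?bB// HQ.
have [|c Hc] := orthogonal_to_mean_zero t0 mb bb.
  move=> psi N mpsi psiN psi0.
  have N0 : 0 <= N := le_trans (normr_ge0 _) (psiN t tt).
  have ipsi := intble_bounded mpsi psiN.
  pose phi s := 0 + Rintegral mu `[0, s] psi.
  have pp : primitive t phi psi by exact: integral_primitive.
  have phi0 : phi 0 = 0 by rewrite /phi set_itv1 Rintegral_set1 addr0.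
  have phit : phi t = 0 by rewrite /phi psi0 addr0.
  have mphi := intble_meas (primitive_intble pp).
  have [Cp Cp0 HCp] := abs_cont_bounded (primitive_abs_cont pp).
  have iN : intble t (fun s => expR (- lam s) * (phi s * Lx i s + psi s * Lv i s)).
    have -> : (fun s => expR (- lam s) * (phi s * Lx i s + psi s * Lv i s)) =
        (fun s => phi s * A s + psi s * Bv s) by apply/funext => s; rewrite /A /Bv; ring.
    by apply: intbleD; [exact: (intble_Ml mphi HCp)|exact: (intble_Ml mpsi psiN)].
  have iM : intble t (fun s => A s * phi s + Q s * psi s).
    by apply: intbleD; [exact: (intble_Ml mA bA (primitive_intble pp))|exact: (intble_Ml mQ HQ)].
  have E1 : Rintegral mu `[0, t] (fun s => A s * phi s + Q s * psi s) = 0.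
    have [_ /(_ t tt)] := primitiveM t0 Qp pp iM.
    by rewrite phit phi0 !mulr0 add0r => <-.
  have phiB s : 0 <= s <= t -> `|phi s| <= Cp + N by move=> st; rewrite (le_trans (HCp s st))// lerDl.
  have psiB s : 0 <= s <= t -> `|psi s| <= Cp + N.
    by move=> st; rewrite (le_trans (psiN s st))// lerDr ltW.
  have E2 := first_variation_eq0 pp phi0 phit phiB psiB iN.
  have -> : (fun s => psi s * b s) = (fun s => expR (- lam s) * (phi s * Lx i s + psi s * Lv i s) +
      -1 * (A s * phi s + Q s * psi s)) by apply/funext => s; rewrite /b /A /Bv; ring.
  by rewrite RintegralD ?RintegralZl ?E1 ?E2 ?mulr0 ?addr0//; exact: intbleZ.
pose ex s := expR (lam s).
have exp_ : primitive t ex (fun s => Lr s * ex s) := primitive_exp t0 lam_primitive.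
have Qcp : primitive t (fun s => Q s + c) A.
  have cp : primitive t (fun=> c) (fun=> 0).
    split; first exact: intble_cst.
    by move=> y /andP[y0 _]; rewrite Rint_cst// mul0r addr0.
  have := primitiveD Qp cp; congr (primitive _ _ _).
  by apply/funext => s; rewrite addr0.
have exA s : ex s * A s = Lx i s.
  by rewrite /ex /A mulrA -expRD subrr expR0 mul1r.
exists (fun s => ex s * (Q s + c)); split.
  have [Ce Ce0 HCe] := abs_cont_bounded (primitive_abs_cont exp_).
  have iex := primitive_intble exp_; have mex := intble_meas iex.
  have E : (fun s => Lx i s + Lr s * (ex s * (Q s + c))) =
      (fun s => Lr s * ex s * (Q s + c) + ex s * A s).
    by apply/funext => s; rewrite exA addrC mulrA.
  rewrite E; apply: primitiveM => //; apply: intbleD.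
    have [CQc _ HQc] := abs_cont_bounded (primitive_abs_cont Qcp).
    have iQc := primitive_intble Qcp.
    under [X in EFin \o X]eq_fun do rewrite mulrC.
    exact: (intble_Ml (intble_meas iQc) HQc exp_.1).
  exact: (intble_Ml mex HCe).
apply: aeS Hc => s H st; rewrite -(H st) /b addrC subrK /Bv /ex mulrA -expRD subrr expR0 mul1r//.
Qed.

Lemma euler_lagrange : exists P : R -> E,
  (forall i, primitive t (fun s => P s 0 i) (fun s => Lx i s + Lr s * P s 0 i)) /\
  {ae mu, forall s, 0 <= s <= t -> Dv L (xi s) (u s) (g s) = P s}.
Proof.
have /choice[P HP] := euler_lagrange_coord.
exists (fun s => \row_i P i s); split=> [i|].
  rewrite (_ : (fun s => (\row_i P i s) 0 i) = P i); last by apply/funext => s; rewrite mxE.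
  rewrite [X in primitive _ _ X](_ : _ = (fun s => Lx i s + Lr s * P i s)); last first.
    by apply/funext => s; rewrite mxE.
  by have [] := HP i.
have : {ae mu, forall s, forall i, 0 <= s <= t -> Lv i s = P i s}.
  by apply: ae_forall_ord => i; have [] := HP i.
apply: aeS => s h st; apply/rowP => i; rewrite [RHS]mxE; exact: h.
Qed.

End FirstVariation.

(** * Inversion of L_v *)

Section Legendre.
Context {R : realType} {n : nat}.
Notation E := 'rV[R]_n.
Notation V := (E * R^o * E)%type.

Lemma derive_lin_phase (F : V -> R^o) (z d : V) : Ck 1 F ->
  'D_d F z = \sum_b phase_coord d b * 'D_(phase_basis b) F z.
Proof.
exact: (@derive_lin R V _ (@phase_basis R n) (@phase_coord R n) (@phase_coordE R n) F z d).
Qed.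

Lemma derive_phase_basis (F : V -> R^o) z (d : V) : Ck 1 F ->
  'D_d F z = \sum_i d.1.1 0 i * 'D_((evec i, 0, 0) : V) F z + d.1.2 * 'D_((0, 1, 0) : V) F z +
    \sum_i d.2 0 i * 'D_((0, 0, evec i) : V) F z.
Proof.
move=> F1; rewrite derive_lin_phase//.
by rewrite [LHS]big_sumType [X in X + _ = _]big_sumType/= big_unit_sum.
Qed.

Lemma cont_of_dist (W W' : normedModType R) (G : W -> W') w :
  (forall e : R, 0 < e -> exists2 r : R, 0 < r & forall y, `|y - w| < r -> `|G y - G w| <= e) ->
  {for w, continuous G}.
Proof.
move=> H; apply/cvgrPdist_le => e /H[r r0 Hr]; apply/nbhs_ballP; exists r => // y.
by rewrite -ball_normE/= => yw; rewrite distrC; apply: Hr; rewrite distrC.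
Qed.

Lemma sum_continuous (T : topologicalType) (m : nat) (f : 'I_m -> T -> R^o) :
  (forall i, continuous (f i)) -> continuous ((fun z => \sum_i f i z) : T -> R^o).
Proof.
elim: m f => [|m IH] f fc z.
  rewrite (_ : (fun z => _) = fun=> 0); first exact: cvg_cst.
  by apply/funext => y; rewrite big_ord0.
rewrite (_ : (fun z => _) = (fun z => f ord0 z + \sum_(i < m) f (lift ord0 i) z)).
  by apply: cvgD; [exact: fc|apply: (IH (fun i => f (lift ord0 i))) => i; exact: fc].
by apply/funext => y; rewrite big_ord_recl.
Qed.

Lemma derive_vertical (F : V -> R^o) z (d : E) : Ck 1 F ->
  'D_((0, 0, d) : V) F z = \sum_i d 0 i * 'D_((0, 0, evec i) : V) F z.
Proof.
move=> F1; have H := derive_phase_basis z ((0, 0, d) : V) F1.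
have S0 : \sum_i (0 : E) 0 i * 'D_((evec i, 0, 0) : V) F z = 0.
  by apply: big1 => i _; rewrite mxE mul0r.
transitivity (\sum_i (0 : E) 0 i * 'D_((evec i, 0, 0) : V) F z + 0 * 'D_((0, 1, 0) : V) F z +
    \sum_i d 0 i * 'D_((0, 0, evec i) : V) F z); first exact: H.
by rewrite S0 add0r [0 * _]mul0r add0r.
Qed.

Lemma norm_le_enorm (v : E) : `|v| <= enorm v.
Proof. by apply: rV_norm_le; [exact: enorm_ge0|move=> i; exact: coord_le_enorm]. Qed.

Lemma le_sum4 (a b c d : R) : 0 <= a -> 0 <= b -> 0 <= c -> 0 <= d ->
  [/\ a <= a + b + c + d, b <= a + b + c + d, c <= a + b + c + d & d <= a + b + c + d].
Proof. by move=> *; split; lra. Qed.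

Lemma far_arith (S B C e l d q : R) : S + B + C < e -> (q + 1) * e - B <= l -> d <= q * e -> 1 < S ->
  C < l - d.
Proof. by move=> *; nra. Qed.

Variable L : E -> R -> E -> R.
Hypothesis hC2 : C2_lagrangian L.
Hypothesis hL1 : cond_L1 L.

Let F i : V -> R^o := 'D_((0, 0, evec i) : V) (phaseL L).

(* [d *m hess z] is the derivative of [L_v] in the direction [d] of the
   velocity. *)
Definition hess (z : V) : 'M[R]_n := \matrix_(j, i) 'D_((0, 0, evec j) : V) (F i) z.

Lemma FC1 i : Ck 1 (F i).
Proof. exact: phaseL_dC1. Qed.

Lemma F_derivable i z d : derivable (F i) z d.
Proof. by have [_ /(_ d)[]] := FC1 i. Qed.

Lemma F_dcont i d : continuous ('D_d (F i)).
Proof. by have [_ /(_ d)[_ []]] := FC1 i. Qed.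

Lemma hessE (d : E) z i : (d *m hess z) 0 i = 'D_((0, 0, d) : V) (F i) z.
Proof.
rewrite mxE derive_vertical; last exact: FC1.
by apply: eq_bigr => j _; rewrite mxE.
Qed.

Lemma derive_phaseL_vertical (d : E) : 'D_((0, 0, d) : V) (phaseL L) = \sum_(i < n) (d 0 i \*: F i).
Proof.
apply/funext => z; rewrite derive_vertical; last exact: CkS (phaseL_C2 hC2).
by rewrite fct_sumE; apply: eq_bigr.
Qed.

Lemma hess_form (d : E) z :
  'D_((0, 0, d) : V) ('D_((0, 0, d) : V) (phaseL L)) z = dotv d (d *m hess z).
Proof.
transitivity ('D_((0, 0, d) : V) (\sum_(i < n) (d 0 i \*: F i)) z).
  by rewrite -derive_phaseL_vertical.
rewrite derive_sum => [|i].
  by apply: eq_bigr => i _; rewrite hessE deriveZ//; exact: F_derivable.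
by apply: derivableZ; exact: F_derivable.
Qed.

Lemma hess_gt0 (d : E) z : d != 0 -> 0 < dotv d (d *m hess z).
Proof.
case: z => [[x r] v] d0; have [_ _ /(_ v d d0)] := hL1 x r.
have <- := hess_form d (x, r, v).
have -> : 'D_d (L x r : E -> R^o) = (fun v => 'D_((0, 0, d) : V) (phaseL L) (x, r, v)).
  by apply/funext => w; rewrite derive_phase_v.
have <- := derive_phase_v (fun x r v => 'D_((0, 0, d) : V) (phaseL L) (x, r, v)) x r v d.
rewrite (_ : phaseL (fun x r v => 'D_((0, 0, d) : V) (phaseL L) (x, r, v)) =
  'D_((0, 0, d) : V) (phaseL L))//.
Qed.

Lemma hess_continuous i j : continuous ((fun z => hess z j i) : V -> R^o).
Proof.
rewrite (_ : (fun z => _) = 'D_((0, 0, evec j) : V) (F i)); first exact: F_dcont.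
by apply/funext => z; rewrite mxE.
Qed.

(** The constant is the minimum of the positive definite form over the compact product of a bounded
    set of parameters and the unit sphere; homogeneity of degree 2 in [d] does the rest. *)
Lemma hess_coercive (X : R) : exists2 m : R, 0 < m & forall x r v (d : E),
  `|x| <= X -> `|r| <= X -> `|v| <= X -> m * `|d| ^+ 2 <= dotv d (d *m hess (x, r, v)).
Proof.
pose A := [set v : E | forall i, `[- X, X]%classic (v 0 i)].
pose S := [set d : E | `|d| = 1].
have inA (v : E) : `|v| <= X -> A v.
  by move=> vX i; rewrite /= in_itv/= -ler_norml (le_trans (le_rV_norm v i)).
have cS : compact S.
  apply: bounded_closed_compact.
    by exists 1; split => // y y1 d; rewrite /S /= => ->; exact: ltW.
  rewrite (_ : S = (fun d : E => `|d|) @^-1` [set 1])//.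
  by apply: closed_comp => [d _|]; [exact: norm_continuous|rewrite -set_itv1; exact: interval_closed].
have cA : compact (A `*` (`[- X, X]%classic : set R^o) `*` A `*` S).
  apply: compact_setX => //; apply: compact_setX; last exact: rV_closed_ball_compact.
  by apply: compact_setX; [exact: rV_closed_ball_compact|exact: segment_compact].
pose f (zd : V * E) : R := dotv zd.2 (zd.2 *m hess zd.1).
have fc : continuous f.
  have dc i : continuous ((fun zd : V * E => zd.2 0 i) : V * E -> R^o).
    move=> zd; apply: (@continuous_comp _ _ _ snd (fun v : E => v 0 i : R^o)); first exact: cvg_snd.
    exact: coord_continuous.
  have hc i j : continuous ((fun zd : V * E => hess zd.1 j i) : V * E -> R^o).
    move=> zd; apply: (@continuous_comp _ _ _ fst (fun z : V => hess z j i : R^o)); first exact: cvg_fst.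
    exact: (@hess_continuous i j).
  have mc i : continuous ((fun zd : V * E => (zd.2 *m hess zd.1) 0 i) : V * E -> R^o).
    rewrite (_ : (fun zd => _) = (fun zd : V * E => \sum_j zd.2 0 j * hess zd.1 j i)).
      apply: (sum_continuous (f := fun j (zd : V * E) => zd.2 0 j * hess zd.1 j i)) => j zd.
      by apply: cvgM; [exact: dc|exact: hc].
    by apply/funext => zd; rewrite mxE.
  apply: (sum_continuous (f := fun i (zd : V * E) => zd.2 0 i * (zd.2 *m hess zd.1) 0 i)) => i zd.
  by apply: cvgM; [exact: dc|exact: mc].
(* The product can be empty, for [n = 0] or [X < 0]; then no nonzero [d] meets the hypotheses. *)
have [E0|/set0P A0] := eqVneq (A `*` (`[- X, X]%classic : set R^o) `*` A `*` S) set0.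
  exists 1 => // x r v d xX rX vX; have [->|d0] := eqVneq d 0.
    by rewrite normr0 expr0n mulr0 mul0mx /dotv big1// => i _; rewrite mxE mul0r.
  have nd : `|d| != 0 by rewrite normr_eq0.
  have : (A `*` (`[- X, X]%classic : set R^o) `*` A `*` S) ((x, r, v), `|d|^-1 *: d).
    split => /=; last by rewrite /S /= normrZ normfV normr_id mulVf.
    split => /=; last exact: inA.
    by split => /=; [exact: inA|rewrite in_itv/= -ler_norml].
  by rewrite E0.
have [[[[x1 r1] v1] d1]] := compact_EVT_min A0 cA (continuous_subspaceT fc).
rewrite inE => -[_ d11] Hmin; rewrite /S/= in d11.
exists (f ((x1, r1, v1), d1)).
  apply: hess_gt0; apply/eqP => /= d10; move: d11; rewrite d10 normr0 => /eqP.
  by rewrite eq_sym oner_eq0.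
move=> x r v d xX rX vX; have [->|d0] := eqVneq d 0.
  by rewrite normr0 expr0n mulr0 mul0mx /dotv big1// => i _; rewrite mxE mul0r.
have nd : `|d| != 0 by rewrite normr_eq0.
have : ((x, r, v), `|d|^-1 *: d) \in (A `*` (`[- X, X]%classic : set R^o) `*` A `*` S).
  rewrite inE; split => /=; last by rewrite /S /= normrZ normfV normr_id mulVf.
  split => /=; last exact: inA.
  by split => /=; [exact: inA|rewrite in_itv/= -ler_norml].
move=> /Hmin; rewrite {2}/f /= => h.
have -> : dotv d (d *m hess (x, r, v)) =
    dotv (`|d|^-1 *: d) ((`|d|^-1 *: d) *m hess (x, r, v)) * `|d| ^+ 2.
  by rewrite -scalemxAl dotvZr [in RHS]dotvC dotvZr [in RHS]dotvC; field.
by rewrite ler_wpM2r ?sqr_ge0.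
Qed.

(** The factor [n] compares the dot product with sup norms; the extra 1 keeps the constant positive
    when [n = 0]. *)
Lemma coercive_bound (d p : E) (m : R) : 0 < m -> m * `|d| ^+ 2 <= dotv d p ->
  `|d| <= (n%:R + 1) / m * `|p|.
Proof.
move=> m0 H; rewrite mulrAC ler_pdivlMr//; have [->|d0] := eqVneq d 0.
  by rewrite normr0 mul0r mulr_ge0// addr_ge0.
have nd : 0 < `|d| by rewrite normr_gt0.
rewrite -(ler_pM2l nd); apply: (@le_trans _ _ (dotv d p)).
  by rewrite (_ : _ * _ = m * `|d| ^+ 2)//; ring.
rewrite (le_trans (ler_norm _))// (le_trans (dotv_norm_le d p))// mulrCA.
by rewrite ler_wpM2l// ler_wpM2r// lerDl.
Qed.

Lemma hess_inj_bound (X : R) : exists2 C : R, 0 < C & forall x r v (d : E),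
  `|x| <= X -> `|r| <= X -> `|v| <= X -> `|d| <= C * `|d *m hess (x, r, v)|.
Proof.
have [m m0 Hm] := hess_coercive X; exists ((n%:R + 1) / m) => [|x r v d xX rX vX].
  by rewrite divr_gt0// ltr_wpDl.
by apply: coercive_bound => //; exact: Hm.
Qed.

(** Paired with [v - w], the increment of [L_v] becomes that of a scalar function along a line, so
    one intermediate Hessian suffices in place of one per coordinate. *)
Lemma Dv_increment x r v w : exists2 c : R, `|c| <= 1 &
  dotv (v - w) (Dv L x r v - Dv L x r w) =
  dotv (v - w) ((v - w) *m hess (x, r, w + c *: (v - w))).
Proof.
set d := v - w; have [_ /(_ (0, 0, d))[G1 _]] := phaseL_dC1 hC2 (0, 0, d).
have [c c1] := mvt_line (x, r, w) 1 G1; rewrite mul1r hess_form.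
rewrite !phase_line_v scale1r => H; exists c; first by move: c1; rewrite normr1.
rewrite -[RHS]H.
rewrite {1}/d [w + _]addrC subrK !derive_phaseL//= dotvDr.
rewrite (_ : dotv d (- _) = - dotv d (Dv L x r w)); last first.
  by rewrite -scaleN1r dotvZr mulN1r.
by rewrite !dotv0 !mulr0 !addr0 !add0r ![dotv _ d]dotvC.
Qed.

(** Coercivity of the Hessian bounds the increment of [L_v] from below; this yields both injectivity
    and the Lipschitz bound on the inverse. *)
Lemma Dv_strong_mono (X : R) : exists2 C : R, 0 < C & forall x r v w,
  `|x| <= X -> `|r| <= X -> `|v| <= X -> `|w| <= X -> `|v - w| <= C * `|Dv L x r v - Dv L x r w|.
Proof.
(* The parameter [c] of [mvt_line] may be negative, so the intermediate point is only known to have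
   norm at most [3 * X]. *)
have [m m0 Hm] := hess_coercive (3 * X); exists ((n%:R + 1) / m) => [|x r v w xX rX vX wX].
  by rewrite divr_gt0// ltr_wpDl.
have X0 : 0 <= X := le_trans (normr_ge0 _) xX.
have XX : X <= 3 * X by rewrite ler_peMl// ler1n.
apply: coercive_bound => //; have [c c1 ->] := Dv_increment x r v w.
apply: Hm; [exact: le_trans XX|exact: le_trans XX|].
rewrite (le_trans (ler_normD _ _))// normrZ.
have h1 : `|v - w| <= X + X by rewrite (le_trans (ler_normB _ _))// lerD.
have -> : 3 * X = X + (X + X) by ring.
apply: lerD => //; apply: le_trans h1.
by rewrite ler_piMl.
Qed.

Lemma Dv_inj x r v w : Dv L x r v = Dv L x r w -> v = w.
Proof.
move=> E0; pose X := `|x| + `|r| + `|v| + `|w|.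
have [C C0 H] := Dv_strong_mono X.
apply/eqP; rewrite -subr_eq0 -normr_le0.
have := H x r v w; rewrite E0 subrr normr0 mulr0; apply.
all: have [? ? ? ?] := le_sum4 (normr_ge0 x) (normr_ge0 r) (normr_ge0 v) (normr_ge0 w).
all: by [].
Qed.

Lemma phase_comp_le (z : V) (X : R) : `|z| <= X -> [/\ `|z.1.1| <= X, `|z.1.2| <= X & `|z.2| <= X].
Proof. by rewrite !prod_normE/= !ge_max => /andP[/andP[]]. Qed.

Lemma C1_lipschitz_bounded (G : V -> R^o) (X : R) : Ck 1 G -> exists2 C : R, 0 < C &
  forall z z', `|z| <= X -> `|z'| <= X -> `|G z' - G z| <= C * `|z' - z|.
Proof.
move=> G1; have [_ GD] := G1.
have /choice[C HC] : forall b : 'I_n + unit + 'I_n, exists C : R, 0 < C /\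
    forall x r w, `|x| <= 3 * X -> `|r| <= 3 * X -> `|w| <= 3 * X -> `|'D_(phase_basis b) G (x, r, w)| <= C.
  move=> b; have [_ [Gb _]] := GD (phase_basis b).
  by have [C C0 H] := phase_bounded (3 * X) Gb; exists C.
have S0 : 0 <= \sum_b C b by apply: sumr_ge0 => b _; have [/ltW] := HC b.
exists (\sum_b C b + 1) => [|z z' zX zX']; first by rewrite ltr_wpDl.
have [Gd _] := GD (z' - z).
have [c c1] := mvt_line z 1 Gd; rewrite scale1r mul1r [z + _]addrC subrK => ->.
rewrite derive_lin_phase// (le_trans (ler_norm_sum _ _ _))//.
rewrite mulrDl mul1r (@le_trans _ _ ((\sum_b C b) * `|z' - z|)) ?lerDl//.
rewrite mulr_suml; apply: ler_sum => b _; rewrite normrM mulrC.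
rewrite normr1 in c1.
have zz : `|z + c *: (z' - z)| <= 3 * X.
  rewrite (le_trans (ler_normD _ _))// normrZ.
  have h1 : `|z' - z| <= X + X by rewrite (le_trans (ler_normB _ _))// lerD.
  have -> : 3 * X = X + (X + X) by ring.
  apply: lerD => //; apply: le_trans h1.
  by rewrite ler_piMl.
apply: ler_pM => //; last exact: phase_coord_le.
have [_ H] := HC b; have [h1 h2 h3] := phase_comp_le zz.
by move: (H _ _ _ h1 h2 h3); case: (z + c *: (z' - z)) => [[? ?] ?].
Qed.

Hypothesis hL2 : cond_L2' L.
Variable K : R.
Hypothesis hK : forall x r v, `|Dr L x r v| <= K.

Lemma is_derive_affine (c q a : R) : is_derive a (1 : R) (fun y : R => c + y * q) q.
Proof.
have h1 : is_derive a (1 : R) (q \*: (id : R -> R^o)) (q *: 1) by exact: is_deriveZ.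
have h2 := is_deriveD (is_derive_cst (c : R^o) a (1 : R)) h1.
have E1 : cst (c : R^o) + q \*: (id : R -> R^o) = (fun y : R => c + y * q).
  by apply/funext => y; rewrite /= mulrC.
by rewrite E1 in h2; apply: is_derive_eq h2 _; rewrite add0r /GRing.scale/= mulr1.
Qed.

Lemma critical_of_min x r p v :
  (forall w, L x r v - dotv p v <= L x r w - dotv p w) -> Dv L x r v = p.
Proof.
move=> H; apply/rowP => i.
have [_ /(_ (0, 0, evec i))[G1 _]] := CkS (phaseL_C2 hC2).
pose G (a : R) : R := phaseL L ((x, r, v) + a *: ((0, 0, evec i) : V)) - (dotv p v + a * p 0 i).
have GD (a : R) : is_derive a (1 : R) G
    ('D_((0, 0, evec i) : V) (phaseL L) ((x, r, v) + a *: ((0, 0, evec i) : V)) - p 0 i).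
  apply: is_deriveB; first exact: derivable_line.
  exact: is_derive_affine.
have : is_derive (0 : R) (1 : R) G 0.
  apply: (@derive1_at_min _ G (-1) 1); rewrite ?in_itv/= ?ltrN10 ?ltr01//.
  move=> a _; rewrite /G !phase_line_v scale0r mul0r !addr0 /phaseL/=.
  by have := H (v + a *: evec i); rewrite dotvDr dotv_evec.
move=> /(@derive_val _ _ _ _ _ _ _); have := @derive_val _ _ _ _ _ _ _ (GD 0) => -> /eqP.
by rewrite subr_eq0 phase_line_v scale0r addr0 -DvE => /eqP.
Qed.

(** Since [dotv p w] is at most [n * Y] times the length of [w], growth of slope [n * Y + 1] makes
    [L x r w - dotv p w] exceed [C], a bound for its value at 0, as soon as [w] is longer than [Z].
    A minimum over the compact cube of radius [Z], which contains the Euclidean ball, is therefore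
    global, and critical. *)
Lemma legendre_exists (Y : R) : exists2 Z : R, 0 < Z & forall x r p, `|r| <= Y -> `|p| <= Y ->
  exists v, [/\ `|v| <= Z, Dv L x r v = p &
    forall w, L x r v - dotv p v <= L x r w - dotv p w].
Proof.
have [B B0 H] := lagrangian_superlinear hC2 hL2 hK Y.
have [S S1 HS] := H (n%:R * Y + 1).
have [C C0 HC] := lagrangian_upper hC2 hL2 hK 0 Y.
pose Z := S + B + C.
have S0 : 0 < S by rewrite (lt_trans _ S1).
have Z0 : 0 < Z by rewrite /Z -addrA ltr_wpDr// addr_ge0// ltW.
exists Z => // x r p rY pY.
pose f w : R := L x r w - dotv p w.
have f0 : f 0 <= C.
  rewrite /f dotv0 subr0.
  by apply: HC => //; rewrite -[0](scale0r (0 : E)) enormZ normr0 mul0r.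
have far w : Z < enorm w -> C < f w.
  move=> wZ; have wS : S <= enorm w by rewrite (le_trans _ (ltW wZ))// /Z -addrA lerDl addr_ge0// ltW.
  have h1 := HS x r w rY wS.
  have h2 : dotv p w <= n%:R * Y * enorm w.
    rewrite (le_trans (ler_norm _))// (le_trans (dotv_norm_le _ _))// -mulrA ler_wpM2l//.
    by rewrite ler_pM// norm_le_enorm.
  rewrite /f; move: wZ h1 h2 S1; rewrite /Z.
  exact: far_arith.
pose A := [set w : E | forall i, `[- Z, Z]%classic (w 0 i)].
have A0 : A !=set0 by exists 0 => i; rewrite /= in_itv/= mxE lerNl oppr0 ltW.
have fc : continuous (f : E -> R^o).
  have Lc : continuous (L x r : E -> R^o).
    move=> w; apply: cont_of_dist => e e0.
    have Pc : continuous (phaseL L) := Ck0 (phaseL_C2 hC2).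
    have [r0 r00 Hr] := cont_dist (Pc (x, r, w)) e0.
    exists r0 => // y yw; apply: (Hr (x, r, y)); apply: le_lt_trans yw.
    by apply: phase_norm_le; rewrite /= ?subrr ?normr0.
  have dc : continuous ((fun w => dotv p w) : E -> R^o).
    move=> w; apply: cont_of_dist => e e0.
    have c0 : 0 < n%:R * `|p| + 1 by rewrite ltr_wpDl// mulr_ge0.
    exists (e / (n%:R * `|p| + 1)) => [|y]; first by rewrite divr_gt0.
    rewrite ltr_pdivlMr// => yw.
    have -> : dotv p y - dotv p w = dotv p (y - w).
      by rewrite dotvDr -[- w]scaleN1r dotvZr mulN1r.
    rewrite (le_trans (dotv_norm_le _ _))// (le_trans _ (ltW yw))// mulrA [leRHS]mulrC.
    by rewrite ler_wpM2r// lerDl.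
  by move=> w; exact: (cvgB (Lc w) (dc w)).
have [v] := compact_EVT_min A0 (@rV_closed_ball_compact R n Z) (continuous_subspaceT fc).
rewrite inE => vA Hv.
have vZ : `|v| <= Z.
  by apply: rV_norm_le; [exact: ltW|move=> i; have := vA i; rewrite /= in_itv/= -ler_norml].
have fv0 : f v <= f 0.
  by apply: Hv; rewrite inE => i; rewrite /= in_itv/= mxE lerNl oppr0 ltW.
have vmin w : f v <= f w.
  have [wZ|wZ] := leP (enorm w) Z.
    apply: Hv; rewrite inE => i; rewrite /= in_itv/= -ler_norml.
    by rewrite (le_trans (coord_le_enorm w i)).
  by rewrite (le_trans fv0)// (le_trans f0)// ltW// far.
by exists v; split => //; exact: critical_of_min.
Qed.

(** The inverse of [L_v] in the velocity, which turns out to be [H_p]. Under the hypotheses of this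
    section the default 0 is harmless, by [vel_spec]. *)
Definition vel x r p : E := xget 0 [set v | Dv L x r v = p].

Lemma vel_spec x r p : Dv L x r (vel x r p) = p.
Proof.
have [Z _ H] := legendre_exists (Num.max `|r| `|p|).
have [||v [_ vp _]] := H x r p; [by rewrite le_max lexx|by rewrite le_max lexx orbT|].
by apply: (@xgetPex _ 0 [set v | Dv L x r v = p]); exists v.
Qed.

Lemma vel_unique x r p v : Dv L x r v = p -> vel x r p = v.
Proof. by move=> vp; apply: (@Dv_inj x r); rewrite vel_spec. Qed.

Lemma vel_min x r p w : L x r (vel x r p) - dotv p (vel x r p) <= L x r w - dotv p w.
Proof.
have [Z _ H] := legendre_exists (Num.max `|r| `|p|).
have [||v [_ vp vm]] := H x r p; [by rewrite le_max lexx|by rewrite le_max lexx orbT|].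
by rewrite (vel_unique vp).
Qed.

Lemma vel_bounded (Y : R) : exists2 Z : R, 0 < Z & forall x r p, `|r| <= Y -> `|p| <= Y ->
  `|vel x r p| <= Z.
Proof.
have [Z Z0 H] := legendre_exists Y; exists Z => // x r p rY pY.
by have [v [vZ vp _]] := H x r p rY pY; rewrite (vel_unique vp).
Qed.

(** Stands in for the implicit function theorem. At the parameters [(x', r')], [L_v] takes the value
    [p'] at [v'], and at [v] a value that differs from [p] by the Lipschitz variation of [L_v] in
    the parameters; strong monotonicity converts the difference into a bound on [v' - v]. *)
Lemma vel_lipschitz (Y : R) : exists2 C : R, 0 < C & forall x r p x' r' p',
  `|x| <= Y -> `|r| <= Y -> `|p| <= Y -> `|x'| <= Y -> `|r'| <= Y -> `|p'| <= Y ->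
  `|vel x' r' p' - vel x r p| <= C * (`|p' - p| + `|x' - x| + `|r' - r|).
Proof.
have [Z Z0 HZ] := vel_bounded Y; pose X := Num.max Y Z.
have YX : Y <= X by rewrite le_max lexx.
have ZX : Z <= X by rewrite le_max lexx orbT.
have [C C0 HC] := Dv_strong_mono X.
have /choice[M HM] : forall i, exists M : R, 0 < M /\
    forall z z', `|z| <= X -> `|z'| <= X -> `|F i z' - F i z| <= M * `|z' - z|.
  by move=> i; have [M M0 H] := C1_lipschitz_bounded X (FC1 i); exists M.
have S0 : 0 <= \sum_i M i by apply: sumr_ge0 => i _; have [/ltW] := HM i.
exists (C * (1 + \sum_i M i)); first by rewrite mulr_gt0// ltr_wpDr.
move=> x r p x' r' p' xY rY pY xY' rY' pY'.
set v := vel x r p; set v' := vel x' r' p'.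
have vX : `|v| <= X := le_trans (HZ x r p rY pY) ZX.
have vX' : `|v'| <= X := le_trans (HZ x' r' p' rY' pY') ZX.
rewrite (le_trans (HC x' r' v' v _ _ _ _)) ?(le_trans xY')// ?(le_trans rY')//.
rewrite -mulrA ler_wpM2l ?(ltW C0)// vel_spec.
have -> : p' - Dv L x' r' v = (p' - p) + (Dv L x r v - Dv L x' r' v).
  by rewrite vel_spec addrA subrK.
have d0 : 0 <= `|x' - x| + `|r' - r| by rewrite addr_ge0.
have D1 : `|Dv L x r v - Dv L x' r' v| <= (\sum_i M i) * (`|x' - x| + `|r' - r|).
  apply: rV_norm_le => [|i]; first by rewrite mulr_ge0.
  rewrite mxE [X in _ + X]mxE !DvE; have [M0 H] := HM i.
  have zX' : `|((x', r', v) : V)| <= X by apply: phase_norm_le => //=; exact: le_trans YX.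
  have zX : `|((x, r, v) : V)| <= X by apply: phase_norm_le => //=; exact: le_trans YX.
  have h := H _ _ zX' zX.
  rewrite (le_trans h)//; apply: ler_pM => //; first exact: ltW.
    by rewrite (bigD1 i)//= lerDl sumr_ge0// => j _; have [/ltW] := HM j.
  apply: phase_norm_le => /=; rewrite ?subrr ?normr0//.
    by rewrite distrC lerDl.
  by rewrite distrC lerDr.
rewrite (le_trans (ler_normD _ _))// mulrDl mul1r -!addrA; apply: lerD => //.
rewrite addrA (le_trans D1)//.
apply: (@le_trans _ _ ((\sum_i M i) * (`|p' - p| + (`|x' - x| + `|r' - r|)))).
  by rewrite ler_wpM2l// lerDr.
by rewrite lerDr.
Qed.

End Legendre.

(** * Regularity of the minimizer *)

Section RegularityOnInterval.
Context {R : realType}.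
Notation mu := (@lebesgue_measure R).
Implicit Types (t : R) (W : normedModType R).

Lemma within_cont_eq W t (f g : R -> W) : (forall s, 0 <= s <= t -> f s = g s) ->
  {within `[0, t], continuous f} -> {within `[0, t], continuous g}.
Proof.
move=> fg /within_cont_dist H; apply/within_cont_dist => s st e e0.
have [d d0 Hd] := H s st e e0; exists d => // y yt ys.
by rewrite -!fg//; exact: Hd.
Qed.

Lemma der_eq W t (f g : R -> W) s : 0 <= s <= t -> (forall s, 0 <= s <= t -> f s = g s) ->
  der t f s = der t g s.
Proof.
move=> st fg; rewrite /der /lim; congr get; apply/funext => d; apply/propext.
split; last by apply: has_der_eq => // y yt; rewrite fg.
exact: has_der_eq.
Qed.

Lemma Ck_on_eq W t k (f g : R -> W) : (forall s, 0 <= s <= t -> f s = g s) ->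
  Ck_on t k f -> Ck_on t k g.
Proof.
elim: k f g => [|k IH] f g fg [fc fd]; split => //; try exact: within_cont_eq fc.
have [fd1 fd2] := fd; split.
  move=> s; rewrite in_itv/= => st; rewrite -(der_eq st fg).
  by apply: (has_der_eq st fg); apply: fd1; rewrite in_itv.
by apply: IH fd2 => s st; exact: der_eq.
Qed.

(** Lets regularity be proved by exhibiting a derivative, without reference to the limit in
    [der]. *)
Lemma Ck_onS W t k (f g : R -> W) : 0 < t -> (forall s, 0 <= s <= t -> has_der t f s (g s)) ->
  Ck_on t k g -> Ck_on t k.+1 f.
Proof.
move=> t0 fg gk; split.
  by apply/within_cont_dist => s st e e0; exact: (has_der_cont (fg s st)).
have E s : 0 <= s <= t -> der t f s = g s by move=> st; apply: has_der_der => //; exact: fg.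
split; last by apply: Ck_on_eq gk => s st; rewrite E.
by move=> s; rewrite in_itv/= => st; rewrite E//; exact: fg.
Qed.

Lemma within_contD W t (f g : R -> W) : {within `[0, t], continuous f} ->
  {within `[0, t], continuous g} -> {within `[0, t], continuous (fun s => f s + g s)}.
Proof. by move=> cf cg s; apply: cvgD; [exact: cf|exact: cg]. Qed.

Lemma within_contN W t (f : R -> W) : {within `[0, t], continuous f} ->
  {within `[0, t], continuous (fun s => - f s)}.
Proof. by move=> cf s; apply: cvgN; exact: cf. Qed.

Lemma within_contM t (f g : R -> R^o) : {within `[0, t], continuous f} ->
  {within `[0, t], continuous g} -> {within `[0, t], continuous ((fun s => f s * g s) : R -> R^o)}.
Proof. by move=> cf cg s; apply: cvgM; [exact: cf|exact: cg]. Qed.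

Lemma within_cont_cst W t (c : W) : {within `[0, t], continuous (fun=> c : W)}.
Proof. by move=> s; exact: cvg_cst. Qed.

Lemma within_cont_sum t m (f : 'I_m -> R -> R^o) : (forall i, {within `[0, t], continuous (f i)}) ->
  {within `[0, t], continuous ((fun s => \sum_i f i s) : R -> R^o)}.
Proof. by move=> H; apply: sum_continuous. Qed.

Lemma within_cont_coord n t (f : R -> 'rV[R]_n) :
  (forall i, {within `[0, t], continuous ((fun s => f s 0 i) : R -> R^o)}) ->
  {within `[0, t], continuous f}.
Proof.
move=> H; apply/within_cont_dist => s st e e0.
have e20 : 0 < e / 2 by rewrite divr_gt0.
have /choice[d Hd] : forall i, exists d : R, 0 < d /\
    forall y, 0 <= y <= t -> `|y - s| < d -> `|f y 0 i - f s 0 i| < e / 2.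
  by move=> i; have [d d0 Hd] := (within_cont_dist _ _).2 (H i) s st _ e20; exists d.
pose d0 := \big[Num.min/1]_i d i.
exists d0 => [|y yt ys].
  by rewrite /d0; elim/big_ind: _ => // [a b a0 b0|i _]; [rewrite lt_min a0|have [] := Hd i].
apply: (@le_lt_trans _ _ (e / 2)); last by rewrite ltr_pdivrMr// ltr_pMr// ltr1n.
apply: rV_norm_le => [|i]; first exact: ltW.
rewrite mxE [X in _ + X]mxE; have [_ h] := Hd i; apply/ltW/h => //.
by rewrite (lt_le_trans ys)//; exact: bigmin_le_cond.
Qed.

Lemma coord_within_cont n t (f : R -> 'rV[R]_n) i : {within `[0, t], continuous f} ->
  {within `[0, t], continuous ((fun s => f s 0 i) : R -> R^o)}.
Proof.
move=> /within_cont_dist H; apply/within_cont_dist => s st e e0.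
have [d d0 Hd] := H s st e e0; exists d => // y yt ys.
apply: le_lt_trans (Hd y yt ys); have := le_rV_norm (f y - f s) i.
by rewrite mxE [X in _ + X]mxE.
Qed.

Lemma within_cont_phase n t (F : 'rV[R]_n * R^o * 'rV[R]_n -> R^o) (x : R -> 'rV[R]_n) (u : R -> R)
    (w : R -> 'rV[R]_n) : continuous F -> {within `[0, t], continuous x} ->
  {within `[0, t], continuous (u : R -> R^o)} -> {within `[0, t], continuous w} ->
  {within `[0, t], continuous ((fun s => F (x s, u s, w s)) : R -> R^o)}.
Proof.
move=> Fc /within_cont_dist xc /within_cont_dist uc /within_cont_dist wc.
apply/within_cont_dist => s st e e0.
have e20 : 0 < e / 2 by rewrite divr_gt0.
have [r r0 Hr] := cont_dist (Fc (x s, u s, w s)) e20.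
have r20 : 0 < r / 2 by rewrite divr_gt0.
have [d1 d10 H1] := xc s st _ r20; have [d2 d20 H2] := uc s st _ r20.
have [d3 d30 H3] := wc s st _ r20.
exists (Num.min d1 (Num.min d2 d3)) => [|y yt]; first by rewrite !lt_min d10 d20.
rewrite !lt_min => /and3P[y1 y2 y3].
apply: (@le_lt_trans _ _ (e / 2)); last by rewrite ltr_pdivrMr// ltr_pMr// ltr1n.
apply: Hr; apply: (@le_lt_trans _ _ (r / 2)); last by rewrite ltr_pdivrMr// ltr_pMr// ltr1n.
by apply: phase_norm_le; apply/ltW; [exact: H1|exact: H2|exact: H3].
Qed.

Lemma has_der_mulmx n t (f : R -> 'rV[R]_n) s d (M : 'M[R]_n) : has_der t f s d ->
  has_der t (fun y => f y *m M) s (d *m M).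
Proof.
move=> /has_derP H; apply/has_derP => e e0.
pose C := \sum_i \sum_j `|M i j| + 1.
have S0 : 0 <= \sum_i \sum_j `|M i j| by apply: sumr_ge0 => i _; exact: sumr_ge0.
have C0 : 0 < C by rewrite ltr_wpDl.
have bnd (v : 'rV[R]_n) : `|v *m M| <= `|v| * C.
  apply: rV_norm_le => [|j]; first by rewrite mulr_ge0// ltW.
  rewrite mxE (le_trans (ler_norm_sum _ _ _))// /C mulrDr mulr1.
  apply: (@le_trans _ _ (`|v| * \sum_i \sum_j `|M i j|)); last by rewrite lerDl.
  rewrite mulr_sumr; apply: ler_sum => i _; rewrite normrM ler_pM ?le_rV_norm//.
  by rewrite (bigD1 j)//= lerDl sumr_ge0.
have [r r0 Hr] := H (e / C) (divr_gt0 e0 C0); exists r => // y yt ys.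
rewrite scalemxAl -!mulmxBl (le_trans (bnd _))// -ler_pdivlMr// mulrAC.
exact: Hr.
Qed.

Lemma tangent_arith (F D H e : R) : (H - e) * D <= F <= (H + e) * D ->
  - (e * D) <= F - D * H <= e * D.
Proof. by move=> /andP[h1 h2]; apply/andP; split; lra. Qed.

(** Near [s] the density stays within [e] of [h s], hence so do the slopes of [f]. This upgrades
    derivatives from almost everywhere to everywhere, endpoints included. *)
Lemma primitive_cont_has_der t (f h : R -> R) : primitive t f h ->
  {within `[0, t], continuous (h : R -> R^o)} ->
  forall s, 0 <= s <= t -> has_der t (f : R -> R^o) s (h s).
Proof.
move=> fh /within_cont_dist hc s st; apply/has_derP => e e0.
have [d d0 Hd] := hc s st e e0; exists d => // y yt ys.
have H a b : 0 <= a -> a <= b -> b <= t -> (forall z, a <= z <= b -> `|z - s| <= `|y - s|) ->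
    `|f b - f a - (b - a) * h s| <= e * (b - a).
  move=> a0 ab bt zs; rewrite ler_norml; apply: tangent_arith.
  apply: (primitive_incr fh) => // z /andP[az zb]; rewrite -ler_distl ltW// Hd//.
    by rewrite (le_trans a0 az) (le_trans zb).
  by apply: (le_lt_trans _ ys); apply: zs; rewrite az.
have /andP[s0 s1] := st; have /andP[y0 y1] := yt.
have [sy|/ltW sy] := leP s y.
  rewrite [X in _ <= _ * X]ger0_norm ?subr_ge0//; apply: H => // z /andP[sz zy].
  by rewrite !ger0_norm ?subr_ge0 ?lerB// (le_trans sz).
rewrite [`|y - s|]distrC [X in _ <= _ * X]ger0_norm ?subr_ge0//.
rewrite -[leLHS]normrN [X in `|X| <= _](_ : _ = f s - f y - (s - y) * h s); last first.
  by rewrite /GRing.scale/=; ring.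
apply: H => // z /andP[yz zs].
by rewrite distrC [`|y - s|]distrC !ger0_norm ?subr_ge0 ?lerB// (le_trans yz).
Qed.

End RegularityOnInterval.

(** * A Lipschitz representative of the velocity *)

Section OptimalFlow.
Context {R : realType} {n : nat}.
Notation mu := (@lebesgue_measure R).
Notation E := 'rV[R]_n.
Notation V := (E * R^o * E)%type.
Notation intble t g := (mu.-integrable `[0, t] (EFin \o (g : R -> R))).
Notation meas t g := (measurable_fun (`[0, t]%classic : set (measurableTypeR R)) (g : R -> R)).

Lemma primitive_lip t (f f' : R -> R) (C : R) : primitive t f f' ->
  (forall s, 0 <= s <= t -> `|f' s| <= C) ->
  forall a b, 0 <= a <= t -> 0 <= b <= t -> `|f b - f a| <= C * `|b - a|.
Proof.
move=> fp fC; have H a b : 0 <= a -> a <= b -> b <= t -> `|f b - f a| <= C * `|b - a|.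
  move=> a0 ab bt; rewrite [X in _ <= _ * X]ger0_norm ?subr_ge0// ler_norml -mulNr.
  apply: (primitive_incr fp) => // s /andP[sa sb]; rewrite -ler_norml fC//.
  by rewrite (le_trans a0 sa) (le_trans sb).
move=> a b /andP[a0 at'] /andP[b0 bt]; have [ab|/ltW ba] := leP a b; first exact: H.
by rewrite distrC [`|b - a|]distrC; exact: H.
Qed.

Lemma primitive_lip_rV t (f f' : R -> E) (C : R) : 0 <= C ->
  (forall i, primitive t (fun s => f s 0 i) (fun s => f' s 0 i)) ->
  (forall s, 0 <= s <= t -> `|f' s| <= C) ->
  forall a b, 0 <= a <= t -> 0 <= b <= t -> `|f b - f a| <= C * `|b - a|.
Proof.
move=> C0 fp fC a b at' bt; apply: rV_norm_le => [|i]; first by rewrite mulr_ge0.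
rewrite mxE [X in _ + X]mxE; apply: (primitive_lip (fp i)) => // s st.
by rewrite (le_trans (le_rV_norm _ _))// fC.
Qed.

Lemma lip_within_cont (W : normedModType R) t (f : R -> W) (C : R) : 0 < C ->
  (forall a b, 0 <= a <= t -> 0 <= b <= t -> `|f b - f a| <= C * `|b - a|) ->
  {within `[0, t], continuous f}.
Proof.
move=> C0 H; apply/within_cont_dist => s st e e0; exists (e / C); first by rewrite divr_gt0.
move=> y yt ys; rewrite (le_lt_trans (H _ _ st yt))//.
by rewrite mulrC -ltr_pdivlMr.
Qed.

Variables (L : E -> R -> E -> R) (t u0 : R) (x0 x : E) (xi : R -> E) (u : R -> R).
Hypothesis t0 : 0 < t.
Hypothesis hC2 : C2_lagrangian L.
Hypothesis hL1 : cond_L1 L.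
Hypothesis hL2 : cond_L2' L.
Variable K : R.
Hypothesis K0 : 0 < K.
Hypothesis hK : forall x r v, `|Dr L x r v| <= K.
Hypothesis hmin : minimizer L t u0 x0 x xi u.

(** A density matters only up to a null set, so it may be set to 0 where it exceeds the essential
    bound. *)
Lemma bounded_velocity : exists g, velocity t xi g /\
  exists2 N : R, 0 < N & forall s, 0 <= s <= t -> `|g s| <= N.
Proof.
have [[[xac _ _] _] _ _] := hmin.
have [g xg] := velocity_exists t0 xac.
have [N N0 HN] := speed_bounded t0 hC2 hL1 hL2 K0 hK hmin xg.
pose g' s := if enorm (g s) <= N then g s else 0.
exists g'; split; last first.
  exists N => // s _; rewrite /g'; case: ifP => [gN|_]; last by rewrite normr0 ltW.
  by rewrite (le_trans (norm_le_enorm _)).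
move=> i; apply: (primitive_eq t0 (xg i)).
  apply: (@intble_bounded _ _ _ N) => [|s _].
    rewrite (_ : (fun s => _) = (fun s => if enorm (g s) <= N then g s 0 i else 0)); last first.
      by apply/funext => s; rewrite /g'; case: ifP => // _; rewrite mxE.
    apply: measurable_fun_if => //.
    - by apply: measurable_fun_ler => //; exact: speed_meas xg.
    - by apply: measurable_funS (velocity_meas xg i) => //; exact: subIsetl.
  rewrite /g'; case: ifP => [gN|_]; last by rewrite mxE normr0 ltW.
  by rewrite (le_trans (coord_le_enorm _ _)).
by apply: aeS HN => s H st; rewrite /g' H.
Qed.

(** The representative of the velocity is [vel L (xi s) (u s) (P s)], Lipschitz because [xi], [u]
    and [P] are primitives of bounded functions. It equals [g] almost everywhere, so the three a.e.
    equations acquire continuous densities and hold at every point. *)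
Lemma minimizer_flow : exists v P : R -> E,
  [/\ forall s, 0 <= s <= t -> Dv L (xi s) (u s) (v s) = P s,
      exists2 C : R, 0 < C & forall a b, 0 <= a <= t -> 0 <= b <= t -> `|v b - v a| <= C * `|b - a|,
      forall s, 0 <= s <= t -> has_der t xi s (v s),
      forall s, 0 <= s <= t -> has_der t (u : R -> R^o) s (L (xi s) (u s) (v s)) &
      forall s, 0 <= s <= t ->
        has_der t P s (Dx L (xi s) (u s) (v s) + Dr L (xi s) (u s) (v s) *: P s)].
Proof.
have [g [xg [N N0 gN]]] := bounded_velocity.
have xac := minimizer_ac xg; have uac := action_ac hmin.
have [X1 X10 HX1] := abs_cont_bounded xac; have [X2 X20 HX2] := abs_cont_bounded uac.
pose X := X1 + X2 + N.
have X1X : X1 <= X by rewrite /X -addrA lerDl addr_ge0// ltW.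
have X2X : X2 <= X by rewrite /X addrAC lerDr addr_ge0// ltW.
have NX : N <= X by rewrite /X lerDr addr_ge0// ltW.
have xiX s : 0 <= s <= t -> `|xi s| <= X by move=> st; rewrite (le_trans (HX1 s st)).
have uX s : 0 <= s <= t -> `|u s| <= X by move=> st; rewrite (le_trans (HX2 s st)).
have gX s : 0 <= s <= t -> `|g s| <= X by move=> st; rewrite (le_trans (gN s st)).
have [P [Pp PE]] := euler_lagrange t0 hC2 hL1 K0 hK hmin xg xiX uX gX.
have PV : velocity t P (fun s => Dx L (xi s) (u s) (g s) + Dr L (xi s) (u s) (g s) *: P s).
  move=> i; rewrite [X in primitive _ _ X](_ : _ = (fun s => Dx L (xi s) (u s) (g s) 0 i +
    Dr L (xi s) (u s) (g s) * P s 0 i)); first exact: Pp.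
  by apply/funext => s; rewrite mxE [X in _ + X]mxE.
have [X3 X30 HX3] := abs_cont_bounded (velocity_abs_cont PV).
pose v s := vel L (xi s) (u s) (P s).
have up := action_primitive t0 hC2 hmin xg.
have [CL CL0 HCL] := phase_bounded X (Ck0 (phaseL_C2 hC2)).
have /choice[Cx HCx] : forall i, exists C : R, 0 < C /\ forall x r w, `|x| <= X -> `|r| <= X -> `|w| <= X ->
    `|Dx L x r w 0 i| <= C.
  by move=> i; have [C C0 H] := phase_bounded X (Dx_continuous hC2 (i := i)); exists C.
pose C3 := \sum_i Cx i + K * X3.
have S0 : 0 <= \sum_i Cx i by apply: sumr_ge0 => i _; have [/ltW] := HCx i.
have C30 : 0 <= C3 by rewrite addr_ge0// mulr_ge0// ltW.
have xlip := primitive_lip_rV (ltW N0) xg gN.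
have ulip : forall a b, 0 <= a <= t -> 0 <= b <= t -> `|u b - u a| <= CL * `|b - a|.
  apply: (primitive_lip up) => s st; apply: (HCL (xi s) (u s) (g s)); [exact: xiX|exact: uX|exact: gX].
have Plip : forall a b, 0 <= a <= t -> 0 <= b <= t -> `|P b - P a| <= C3 * `|b - a|.
  apply: (primitive_lip_rV C30 PV).
  move=> s st; apply: rV_norm_le => // i; rewrite mxE [X in _ + X]mxE (le_trans (ler_normD _ _))//.
  apply: lerD; last by rewrite normrM ler_pM// (le_trans (le_rV_norm _ _))// HX3.
  have [C0 H] := HCx i; rewrite (le_trans (H _ _ _ (xiX s st) (uX s st) (gX s st)))//.
  by rewrite (bigD1 i)//= lerDl sumr_ge0// => j _; have [/ltW] := HCx j.
pose Y := X + X3.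
have XY : X <= Y by rewrite /Y lerDl ltW.
have X3Y : X3 <= Y by rewrite /Y lerDr (le_trans _ X1X)// ltW.
have [Cv Cv0 HCv] := vel_lipschitz hC2 hL1 hL2 hK Y.
have vlip a b : 0 <= a <= t -> 0 <= b <= t -> `|v b - v a| <= (Cv * (C3 + N + CL)) * `|b - a|.
  move=> at' bt; rewrite (le_trans (HCv _ _ _ _ _ _ _ _ _ _ _ _))//.
  - by rewrite (le_trans (xiX a at')).
  - by rewrite (le_trans (uX a at')).
  - by rewrite (le_trans (HX3 a at')).
  - by rewrite (le_trans (xiX b bt)).
  - by rewrite (le_trans (uX b bt)).
  - by rewrite (le_trans (HX3 b bt)).
  rewrite -mulrA ler_wpM2l ?(ltW Cv0)// mulrDl [(C3 + N) * _]mulrDl.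
  by apply: lerD; [apply: lerD; [exact: Plip|exact: xlip]|exact: ulip].
have Clip0 : 0 < Cv * (C3 + N + CL) by rewrite mulr_gt0// addr_gt0// ltr_wpDl.
have vspec s : Dv L (xi s) (u s) (v s) = P s by exact: (vel_spec hC2 hL2 hK).
have gv : {ae mu, forall s, 0 <= s <= t -> g s = v s}.
  by apply: aeS PE => s H st; rewrite /v; apply/esym/(vel_unique hC2 hL1 hL2 hK)/H.
have xc : {within `[0, t], continuous xi} := abs_cont_within xac.
have uc : {within `[0, t], continuous (u : R -> R^o)} := abs_cont_within uac.
have vc : {within `[0, t], continuous v} := lip_within_cont Clip0 vlip.
have Pc : {within `[0, t], continuous P} := abs_cont_within (velocity_abs_cont PV).
have cont_intble (f : R -> R) : {within `[0, t], continuous (f : R -> R^o)} -> intble t f.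
  by move=> fc; apply: continuous_compact_integrable => //; exact: segment_compact.
exists v, P; split.
- by move=> s _.
- by exists (Cv * (C3 + N + CL)).
- move=> s st; apply/has_der_coord => i.
  have vic := coord_within_cont (i := i) vc.
  apply: (primitive_cont_has_der _ vic) => //; apply: (primitive_eq t0 (xg i) (cont_intble _ vic)).
  by apply: aeS gv => y H yt; rewrite H.
- have Lc := within_cont_phase (Ck0 (phaseL_C2 hC2)) xc uc vc.
  apply: (primitive_cont_has_der _ Lc); apply: (primitive_eq t0 up (cont_intble _ Lc)).
  by apply: aeS gv => y H yt; rewrite H.
- move=> s st; apply/has_der_coord => i.
  have Dc : {within `[0, t], continuous ((fun s => Dx L (xi s) (u s) (v s) 0 i +
      Dr L (xi s) (u s) (v s) * P s 0 i) : R -> R^o)}.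
    apply: within_contD; first exact: (within_cont_phase (Dx_continuous hC2 (i := i)) xc uc vc).
    apply: within_contM; first exact: (within_cont_phase (Dr_continuous hC2) xc uc vc).
    exact: coord_within_cont.
  rewrite mxE [X in _ + X]mxE.
  apply: (primitive_cont_has_der _ Dc) => //; apply: (primitive_eq t0 (Pp i) (cont_intble _ Dc)).
  by apply: aeS gv => y H yt; rewrite H.
Qed.

End OptimalFlow.

(** * From Lipschitz velocity to class C^2 *)

Section Bootstrap.
Context {R : realType} {n : nat}.
Notation E := 'rV[R]_n.
Notation V := (E * R^o * E)%type.

Lemma unitmx_of_inj (M : 'M[R]_n) : (forall d : E, d *m M = 0 -> d = 0) -> M \in unitmx.
Proof.
move=> H; rewrite -row_free_unit -kermx_eq0; apply/rowV0P => d /sub_kermxP.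
exact: H.
Qed.

Lemma mulmx_shuffle (a b : E) (M N : 'M[R]_n) (c : R) i :
  (a *m M) 0 i - (b *m M) 0 i - c = ((a - b) *m N) 0 i - c - ((a - b) *m (N - M)) 0 i.
Proof.
rewrite mulmxBr [X in _ = _ - X]mxE [X in _ = _ - (_ + X)]mxE [(a - b) *m M]mulmxBl.
by rewrite [X in _ = _ - (_ - X)]mxE [X in _ = _ - (_ - (_ + X))]mxE; ring.
Qed.

Lemma mulmx_diff (a b c d : E) (A B : 'M[R]_n) : a *m A = c -> b *m B = d ->
  (a - b) *m B = (c - d) + a *m (B - A).
Proof. by move=> <- <-; rewrite mulmxBl mulmxBr [RHS]addrC addrA subrK. Qed.

Lemma within_bounded (W : normedModType R) t (f : R -> W) : {within `[0, t], continuous f} ->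
  exists2 M : R, 0 < M & forall s, 0 <= s <= t -> `|f s| <= M.
Proof.
move=> fc; have /compact_bounded[M [_ HM]] := continuous_compact fc (@segment_compact R 0 t).
exists (`|M| + 1) => [|s st]; first by rewrite ltr_wpDl.
apply: (HM (`|M| + 1)); first by rewrite (le_lt_trans (ler_norm M))// ltrDl.
by exists s => //=; rewrite in_itv.
Qed.

Lemma has_der_within (W : normedModType R) t (f d : R -> W) :
  (forall s, 0 <= s <= t -> has_der t f s (d s)) -> {within `[0, t], continuous f}.
Proof. by move=> fd; apply/within_cont_dist => s st e e0; exact: (has_der_cont (fd s st)). Qed.

Lemma within_cont_derive t (F : V -> R^o) (x : R -> E) (u : R -> R) (w dx : R -> E) (du : R -> R)
    (dw : R -> E) : Ck 1 F ->
  {within `[0, t], continuous x} -> {within `[0, t], continuous (u : R -> R^o)} ->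
  {within `[0, t], continuous w} ->
  {within `[0, t], continuous dx} -> {within `[0, t], continuous (du : R -> R^o)} ->
  {within `[0, t], continuous dw} ->
  {within `[0, t], continuous ((fun s => 'D_((dx s, du s, dw s) : V) F (x s, u s, w s)) : R -> R^o)}.
Proof.
move=> F1 xc uc wc dxc duc dwc; have [_ FD] := F1.
have Fc d : continuous ('D_d F) by have [_ []] := FD d.
apply: (@within_cont_eq _ _ _ (fun s => \sum_i dx s 0 i * 'D_((evec i, 0, 0) : V) F (x s, u s, w s) +
    du s * 'D_((0, 1, 0) : V) F (x s, u s, w s) +
    \sum_i dw s 0 i * 'D_((0, 0, evec i) : V) F (x s, u s, w s))).
  by move=> s _; rewrite [RHS]derive_phase_basis.
apply: within_contD; [apply: within_contD|].
- apply: within_cont_sum => i; apply: within_contM; first exact: coord_within_cont.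
  exact: (within_cont_phase (Fc _) xc uc wc).
- by apply: within_contM => //; exact: (within_cont_phase (Fc _) xc uc wc).
- apply: within_cont_sum => i; apply: within_contM; first exact: coord_within_cont.
  exact: (within_cont_phase (Fc _) xc uc wc).
Qed.

Variables (L : E -> R -> E -> R) (t : R) (xi : R -> E) (u : R -> R) (v P : R -> E).
Hypothesis t0 : 0 < t.
Hypothesis hC2 : C2_lagrangian L.
Hypothesis hL1 : cond_L1 L.
Hypothesis vP : forall s, 0 <= s <= t -> Dv L (xi s) (u s) (v s) = P s.
Variable C : R.
Hypothesis C0 : 0 < C.
Hypothesis vlip : forall a b, 0 <= a <= t -> 0 <= b <= t -> `|v b - v a| <= C * `|b - a|.
Hypothesis hxi : forall s, 0 <= s <= t -> has_der t xi s (v s).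
Hypothesis hu : forall s, 0 <= s <= t -> has_der t (u : R -> R^o) s (L (xi s) (u s) (v s)).
Hypothesis hP : forall s, 0 <= s <= t ->
  has_der t P s (Dx L (xi s) (u s) (v s) + Dr L (xi s) (u s) (v s) *: P s).

Let F i : V -> R^o := 'D_((0, 0, evec i) : V) (phaseL L).
Let dP s := Dx L (xi s) (u s) (v s) + Dr L (xi s) (u s) (v s) *: P s.
Let Ls s := L (xi s) (u s) (v s).
Let Hs s := hess L (xi s, u s, v s).

(** The derivative at [y = s] of [P y - L_v(xi y, u y, v s)], where the velocity is frozen. *)
Let ell s : E := \row_i (dP s 0 i - 'D_((v s, Ls s, 0) : V) (F i) (xi s, u s, v s)).

Let F1 i : Ck 1 (F i). Proof. exact: phaseL_dC1. Qed.

Let FP i s : 0 <= s <= t -> F i (xi s, u s, v s) = P s 0 i.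
Proof. by move=> st; rewrite -vP// DvE. Qed.

Lemma vertical_increment i x r w w' : exists2 z : V,
  `|z - (x, r, w)| <= `|w' - w| & F i (x, r, w') - F i (x, r, w) = ((w' - w) *m hess L z) 0 i.
Proof.
set d := w' - w; have [_ /(_ (0, 0, d))[G1 _]] := F1 i.
have [c c1] := mvt_line (x, r, w) 1 G1; rewrite mul1r.
rewrite !phase_line_v scale1r => H; rewrite normr1 in c1.
exists (x, r, w + c *: d); last by rewrite hessE// -[RHS]H /d [w + _]addrC subrK.
apply: phase_norm_le; rewrite /= ?subrr ?normr0// addrAC subrr add0r normrZ.
by rewrite ler_piMl.
Qed.

(** In each coordinate, [P y - L_v(xi y, u y, v s)] equals that of [(v y - v s) *m hess L z] with
    [z] near the base point. The left side is differentiable at [s], and replacing [hess L z] by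
    [Hs s] costs a small multiple of [|v y - v s|], negligible against [y - s] since [v] is
    Lipschitz. *)
Lemma has_der_hess s : 0 <= s <= t -> has_der t (fun y => v y *m Hs s) s (ell s).
Proof.
move=> st; apply/has_der_coord => i; apply/has_derP => e e0.
pose phi y : R := P y 0 i - F i (xi y, u y, v s).
have hphi : has_der t (phi : R -> R^o) s (ell s 0 i).
  rewrite mxE; apply: has_derD; first by have /has_der_coord := hP st; exact.
  apply: has_derN; apply: (phase_has_der (F1 i)); [exact: hxi|exact: hu|exact: has_der_cst].
have e20 : 0 < e / 2 by rewrite divr_gt0.
have [r1 r10 H1] := (has_derP _ _ _ _).1 hphi _ e20.
pose G (z : V) : R := \sum_j `|hess L z j i - Hs s j i|.
have Gc : continuous (G : V -> R^o).
  apply: (sum_continuous (f := fun j (z : V) => `|hess L z j i - Hs s j i|)) => j z.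
  by apply: cvg_norm; apply: cvgB; [exact: hess_continuous|exact: cvg_cst].
have e3 : 0 < e / (2 * C) by rewrite divr_gt0// mulr_gt0.
have [r2 r20 H2] := cont_dist (Gc (xi s, u s, v s)) e3.
have r22 : 0 < r2 / 2 by rewrite divr_gt0.
have [r3 r30 H3] := has_der_cont (hxi st) r22.
have [r4 r40 H4] := has_der_cont (hu st) r22.
exists (Num.min (Num.min r1 (r2 / (2 * C))) (Num.min r3 r4)).
  by rewrite !lt_min r10 r30 r40 divr_gt0// mulr_gt0.
move=> y yt; rewrite !lt_min => /andP[/andP[y1 y2] /andP[y3 y4]].
have [z zd zE] := vertical_increment i (xi y) (u y) (v s) (v y).
have yphi : phi y = ((v y - v s) *m hess L z) 0 i by rewrite -zE FP.
have sphi : phi s = 0 by rewrite /phi FP// subrr.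
have zclose : `|z - (xi s, u s, v s)| < r2.
  have -> : z - (xi s, u s, v s) = (z - (xi y, u y, v s)) + ((xi y, u y, v s) - (xi s, u s, v s)).
    by rewrite addrA subrK.
  rewrite (le_lt_trans (ler_normD _ _))// [ltRHS]splitr ltr_leD//.
    rewrite (le_lt_trans zd)// (le_lt_trans (vlip st yt))//.
    by rewrite mulrC -ltr_pdivlMr// (lt_le_trans y2)// -mulrA -invfM.
  apply: phase_norm_le; rewrite /= ?subrr ?normr0 ?(ltW r22)//; apply: ltW; [exact: H3|exact: H4].
have -> : (v y *m Hs s) 0 i - (v s *m Hs s) 0 i - (y - s) *: ell s 0 i =
    (phi y - phi s - (y - s) *: ell s 0 i) - ((v y - v s) *m (hess L z - Hs s)) 0 i.
  by rewrite sphi subr0 yphi; exact: mulmx_shuffle.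
rewrite (le_trans (ler_normB _ _))// [X in _ <= X * _](splitr e) mulrDl.
apply: lerD; first exact: H1.
rewrite mxE (le_trans (ler_norm_sum _ _ _))//.
have Gz : G z <= e / (2 * C).
  have := H2 z zclose; rewrite {2}/G big1 ?subr0.
    by apply: le_trans; exact: ler_norm.
  by move=> j _; rewrite subrr normr0.
apply: (@le_trans _ _ (C * `|y - s| * G z)).
  rewrite /G mulr_sumr; apply: ler_sum => j _; rewrite normrM.
  rewrite [X in _ * `|X|]mxE [X in _ * `|_ + X|]mxE.
  by rewrite ler_wpM2r// (le_trans (le_rV_norm _ _))// vlip.
rewrite (_ : e / 2 * _ = C * `|y - s| * (e / (2 * C))); last by field; rewrite gt_eqF.
by rewrite ler_wpM2l// mulr_ge0// ltW.
Qed.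

Lemma Hs_unit s : Hs s \in unitmx.
Proof.
apply: unitmx_of_inj => d; have [C1 _ H] := hess_inj_bound hC2 hL1 (`|xi s| + `|u s| + `|v s|).
move=> E0; have := H (xi s) (u s) (v s) d; rewrite E0 normr0 mulr0.
move=> h; apply/eqP; rewrite -normr_le0; apply: h.
- by rewrite -addrA lerDl addr_ge0.
- by rewrite addrAC lerDr addr_ge0.
- by rewrite lerDr addr_ge0.
Qed.

Definition acceleration s : E := ell s *m invmx (Hs s).

Lemma has_der_velocity s : 0 <= s <= t -> has_der t v s (acceleration s).
Proof.
move=> st; have H := has_der_mulmx (M := invmx (Hs s)) (has_der_hess st).
rewrite /acceleration; apply: has_der_eq st _ H => y _.
by rewrite mulmxK// Hs_unit.
Qed.

Let xc : {within `[0, t], continuous xi} := has_der_within hxi.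
Let uc : {within `[0, t], continuous (u : R -> R^o)} := has_der_within hu.
Let vc : {within `[0, t], continuous v} := lip_within_cont C0 vlip.
Let Pc : {within `[0, t], continuous P} := has_der_within hP.

Lemma Ls_cont : {within `[0, t], continuous (Ls : R -> R^o)}.
Proof. exact: (within_cont_phase (Ck0 (phaseL_C2 hC2)) xc uc vc). Qed.

Lemma dP_cont : {within `[0, t], continuous dP}.
Proof.
apply: within_cont_coord => i.
rewrite (_ : (fun s => _) = (fun s => Dx L (xi s) (u s) (v s) 0 i + Dr L (xi s) (u s) (v s) * P s 0 i)).
  apply: within_contD; first exact: (within_cont_phase (Dx_continuous hC2 (i := i)) xc uc vc).
  apply: within_contM; first exact: (within_cont_phase (Dr_continuous hC2) xc uc vc).
  exact: coord_within_cont.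
by apply/funext => s; rewrite mxE [X in _ + X]mxE.
Qed.

Lemma ell_cont i : {within `[0, t], continuous ((fun s => ell s 0 i) : R -> R^o)}.
Proof.
rewrite (_ : (fun s => _) = (fun s => dP s 0 i + - 'D_((v s, Ls s, 0) : V) (F i) (xi s, u s, v s))).
  apply: within_contD; first exact: coord_within_cont dP_cont.
  apply: within_contN; apply: (within_cont_derive (F1 i) xc uc vc vc Ls_cont).
  exact: within_cont_cst.
by apply/funext => s; rewrite mxE.
Qed.

(** With [a] the acceleration, [(a y - a s) *m Hs s = (ell y - ell s) + a y *m (Hs s - Hs y)], and
    [hess_inj_bound] bounds a vector by its image under [Hs s]. Continuity of matrix inversion is
    thereby bypassed. *)
Lemma acceleration_cont : {within `[0, t], continuous acceleration}.
Proof.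
have [X1 X10 HX1] := within_bounded xc; have [X2 X20 HX2] := within_bounded uc.
have [X3 X30 HX3] := within_bounded vc.
pose X := X1 + X2 + X3.
have [C1 C10 HC1] := hess_inj_bound hC2 hL1 X.
have Hb s (d : E) : 0 <= s <= t -> `|d| <= C1 * `|d *m Hs s|.
  move=> st; apply: HC1; rewrite /X.
  - by rewrite (le_trans (HX1 s st))// -addrA lerDl addr_ge0// ltW.
  - by rewrite (le_trans (HX2 s st))// addrAC lerDr addr_ge0// ltW.
  - by rewrite (le_trans (HX3 s st))// lerDr addr_ge0// ltW.
have aE s : acceleration s *m Hs s = ell s by rewrite mulmxKV// Hs_unit.
have [M M0 HM] : exists2 M : R, 0 < M & forall s, 0 <= s <= t -> `|acceleration s| <= M.
  have ec : {within `[0, t], continuous ell} by apply: within_cont_coord => i; exact: ell_cont.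
  have [M M0 HM] := within_bounded ec; exists (C1 * M); first exact: mulr_gt0.
  by move=> s st; rewrite (le_trans (Hb s _ st))// aE ler_wpM2l ?(ltW C10)// HM.
apply/within_cont_dist => s st e e0.
pose G y : R := \sum_i (`|ell y 0 i - ell s 0 i| + \sum_j M * `|Hs s j i - Hs y j i|).
have Gc : {within `[0, t], continuous (G : R -> R^o)}.
  apply: within_cont_sum => i; apply: within_contD.
    move=> y; apply: cvg_norm.
    by apply: cvgB; [exact: ell_cont|exact: cvg_cst].
  apply: within_cont_sum => j; apply: within_contM; first exact: within_cont_cst.
  move=> y; apply: cvg_norm; apply: cvgB; first exact: cvg_cst.
  exact: (within_cont_phase (hess_continuous hC2 (i := i) (j := j)) xc uc vc).
have eC : 0 < e / C1 by rewrite divr_gt0.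
have [d d0 Hd] := (within_cont_dist _ _).2 Gc s st _ eC.
exists d => // y yt ys; rewrite (le_lt_trans (Hb s _ st))// mulrC -ltr_pdivlMr//.
have Gs : G s = 0.
  rewrite /G big1// => i _; rewrite subrr normr0 add0r big1// => j _.
  by rewrite subrr normr0 mulr0.
have Gy0 : 0 <= G y.
  by apply: sumr_ge0 => i _; rewrite addr_ge0// sumr_ge0// => j _; rewrite mulr_ge0// ltW.
apply: le_lt_trans (Hd y yt ys); rewrite Gs subr0 ger0_norm//.
apply: rV_norm_le => // i.
have -> : (acceleration y - acceleration s) *m Hs s =
    (ell y - ell s) + acceleration y *m (Hs s - Hs y).
  by apply: mulmx_diff; exact: aE.
rewrite /G (bigD1 i)//=.
apply: (@le_trans _ _ (`|ell y 0 i - ell s 0 i| + \sum_j M * `|Hs s j i - Hs y j i|)); last first.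
  rewrite lerDl sumr_ge0// => k _; rewrite addr_ge0// sumr_ge0// => j _.
  by rewrite mulr_ge0// ltW.
rewrite mxE (le_trans (ler_normD _ _))//; apply: lerD; first by rewrite mxE [X in _ + X]mxE.
rewrite mxE (le_trans (ler_norm_sum _ _ _))//; apply: ler_sum => j _; rewrite normrM.
rewrite [X in _ * `|X|]mxE [X in _ * `|_ + X|]mxE ler_wpM2r//.
by rewrite (le_trans (le_rV_norm _ _))// HM.
Qed.

Lemma curve_C2 : Ck_on t 2 xi.
Proof.
apply: (Ck_onS t0 hxi); apply: (Ck_onS t0 has_der_velocity).
by split => //; exact: acceleration_cont.
Qed.

Let dz s : V := (v s, Ls s, acceleration s).

Lemma along_has_der (G : V -> R^o) s : Ck 1 G -> 0 <= s <= t ->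
  has_der t ((fun s => G (xi s, u s, v s)) : R -> R^o) s ('D_(dz s) G (xi s, u s, v s)).
Proof.
by move=> G1 st; apply: (phase_has_der G1); [exact: hxi|exact: hu|exact: has_der_velocity].
Qed.

Lemma along_derive_cont (G : V -> R^o) : Ck 1 G ->
  {within `[0, t], continuous ((fun s => 'D_(dz s) G (xi s, u s, v s)) : R -> R^o)}.
Proof.
by move=> G1; apply: (within_cont_derive G1 xc uc vc vc Ls_cont); exact: acceleration_cont.
Qed.

Lemma action_C2 : Ck_on t 2 (u : R -> R^o).
Proof.
have L1 : Ck 1 (phaseL L) := CkS (phaseL_C2 hC2).
apply: (Ck_onS t0 hu); apply: (Ck_onS t0 (fun s st => along_has_der L1 st)).
by split => //; exact: along_derive_cont.
Qed.

(** As [L_v] is only known to be C^1, the second derivative is obtained from [P' = L_x + L_r P],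
    whose right side is C^1 along the flow. *)
Lemma momentum_C2 : Ck_on t 2 P.
Proof.
pose X i : V -> R^o := 'D_((evec i, 0, 0) : V) (phaseL L).
pose Y : V -> R^o := 'D_((0, 1, 0) : V) (phaseL L).
have X1 i : Ck 1 (X i) by exact: phaseL_dC1.
have Y1 : Ck 1 Y by exact: phaseL_dC1.
have dPE s i : dP s 0 i = X i (xi s, u s, v s) + Y (xi s, u s, v s) * P s 0 i.
  by rewrite mxE [X in _ + X]mxE DxE DrE.
pose ddP s : E := \row_i ('D_(dz s) (X i) (xi s, u s, v s) +
  ('D_(dz s) Y (xi s, u s, v s) * P s 0 i + Y (xi s, u s, v s) * dP s 0 i)).
apply: (Ck_onS t0 hP); apply: (Ck_onS t0 (g := ddP)).
  move=> s st; apply/has_der_coord => i; rewrite mxE.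
  apply: (@has_der_eq _ _ _ (fun s => X i (xi s, u s, v s) + Y (xi s, u s, v s) * P s 0 i : R^o) _ _ _ st).
    by move=> y _; rewrite -dPE.
  have h1 := along_has_der (X1 i) st; have h2 := along_has_der Y1 st.
  have h3 : has_der t ((fun y => P y 0 i) : R -> R^o) s (dP s 0 i).
    by have /has_der_coord := hP st; exact.
  exact: (has_derD h1 (has_derM st h2 h3)).
split => //; apply: within_cont_coord => i.
apply: (@within_cont_eq _ _ _ (fun s => 'D_(dz s) (X i) (xi s, u s, v s) +
  ('D_(dz s) Y (xi s, u s, v s) * P s 0 i + Y (xi s, u s, v s) * dP s 0 i) : R^o)).
  by move=> s _; rewrite [RHS]mxE.
have c1 := along_derive_cont (X1 i); have c2 := along_derive_cont Y1.
have c3 := coord_within_cont (i := i) Pc.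
have c4 := within_cont_phase (Ck0 Y1) xc uc vc.
have c5 := coord_within_cont (i := i) dP_cont.
exact: (within_contD c1 (within_contD (within_contM c2 c3) (within_contM c4 c5))).
Qed.

End Bootstrap.

(** * Derivatives of the Hamiltonian *)

Section Envelope.
Context {R : realType} {n : nat}.
Notation E := 'rV[R]_n.
Notation V := (E * R^o * E)%type.
Variable L : E -> R -> E -> R.
Hypothesis hC2 : C2_lagrangian L.
Hypothesis hL1 : cond_L1 L.
Hypothesis hL2 : cond_L2' L.
Variable K : R.
Hypothesis hK : forall x r v, `|Dr L x r v| <= K.

Let H := hamiltonian L.
Let vel := vel L.

Lemma vel_maximizes x r p w :
  dotv p w - L x r w <= dotv p (vel x r p) - L x r (vel x r p).
Proof. by have := vel_min hC2 hL1 hL2 hK x r p w; rewrite -lerN2 !opprB. Qed.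

Lemma hamiltonianE x r p : H x r p = dotv p (vel x r p) - L x r (vel x r p).
Proof.
have ub : ubound (range (fun v => dotv p v - L x r v)) (dotv p (vel x r p) - L x r (vel x r p)).
  by move=> _ [w _ <-]; exact: vel_maximizes.
apply/eqP; rewrite eq_le; apply/andP; split.
  by apply: ge_sup => //; exists (dotv p 0 - L x r 0), 0.
by apply: ub_le_sup; [eexists; exact: ub|exists (vel x r p)].
Qed.

Lemma sub4 (a b c d : R) : a - b - (c - d) = a - c - (b - d).
Proof. ring. Qed.

Lemma between_arith (h f l a b e : R) : h * a <= f -> f <= h * b ->
  `|a - l| <= e -> `|b - l| <= e -> `|f - h * l| <= e * `|h|.
Proof.
move=> h1 h2 h3 h4.
have ha : `|h * a - h * l| <= e * `|h| by rewrite -mulrBr normrM mulrC ler_wpM2r.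
have hb : `|h * b - h * l| <= e * `|h| by rewrite -mulrBr normrM mulrC ler_wpM2r.
move: ha hb; rewrite !ler_norml => /andP[ha _] /andP[_ hb]; apply/andP; split.
  by apply: le_trans ha _; rewrite lerB.
by apply: le_trans hb; rewrite lerB.
Qed.

(* Testing the maximizer at one parameter against the other parameter traps the
   difference quotient between two values of the partial derivative. *)
Lemma hamiltonian_envelope x r p (dx : E) (dr : R) (dp : E) :
  h^-1 *: ((H (h *: dx + x) (h * dr + r) (h *: dp + p) : R^o) - H x r p) @[h --> (0 : R)^'] -->
  (dotv dp (vel x r p) - 'D_((dx, dr, 0) : V) (phaseL L) (x, r, vel x r p) : R^o).
Proof.
set v0 := vel x r p; set l := dotv dp v0 - _.
have [_ /(_ (dx, dr, 0))[G1 [Gc _]]] := phaseL_C2 hC2.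
set G := 'D_((dx, dr, 0) : V) (phaseL L) in l Gc *.
apply/cvgrPdist_le => e e0.
have e20 : 0 < e / 2 by rewrite divr_gt0.
have [rho rho0 Hrho] := cont_dist (Gc (x, r, v0)) e20.
pose D := `|dx| + `|dr| + `|dp|.
have D0 : 0 <= D by rewrite !addr_ge0.
pose Y := `|x| + `|r| + `|p| + D.
have [C C0 HC] := vel_lipschitz hC2 hL1 hL2 hK Y.
pose B := D + C * D + 1.
have B0 : 0 < B by rewrite ltr_wpDl// addr_ge0// mulr_ge0// ltW.
pose B' := n%:R * (`|dp| * (C * D)) + 1.
have B'0 : 0 < B' by rewrite ltr_wpDl// !mulr_ge0// ltW.
pose de := Num.min 1 (Num.min (rho / B) (e / 2 / B')).
have de0 : 0 < de by rewrite !lt_min ltr01/= !divr_gt0.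
suff main h : `|h| < de -> `|H (h *: dx + x) (h * dr + r) (h *: dp + p) - H x r p - h * l| <= e * `|h|.
  suff : nbhs (0 : R) (fun h : R => h != 0 ->
      `|l - h^-1 *: ((H (h *: dx + x) (h * dr + r) (h *: dp + p) : R^o) - H x r p)| <= e) by [].
  apply/nbhs_ballP; exists de => // h; rewrite -ball_normE/= sub0r normrN => hd hn.
  have := main h hd; rewrite distrC /GRing.scale/=.
  have hh : 0 < `|h| by rewrite normr_gt0.
  rewrite -ler_pdivrMr// -normfV -normrM mulrBl mulrAC divff// mul1r.
  by rewrite [_ / h]mulrC distrC.
rewrite !lt_min => /and3P[h1 h2 h3].
rewrite ltr_pdivlMr// in h2; rewrite ltr_pdivlMr// in h3.
have inY (W : normedModType R) (y dy : W) (c : R) : `|c| <= `|h| -> `|dy| <= D ->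
    `|c *: dy + y| <= `|y| + D.
  move=> ch dyD; rewrite (le_trans (ler_normD _ _))// addrC lerD2l normrZ.
  by rewrite (le_trans _ dyD)// ler_piMl// (le_trans ch)// ltW.
have dxD : `|dx| <= D by rewrite /D -addrA lerDl addr_ge0.
have drD : `|dr| <= D by rewrite /D addrAC lerDr addr_ge0.
have dpD : `|dp| <= D by rewrite /D lerDr addr_ge0.
set v1 := vel (h *: dx + x) (h * dr + r) (h *: dp + p).
(* The maximizer moves by at most a multiple of [h]: [vel] is Lipschitz for parameters bounded by
   [Y], which allows for every perturbation with [|h| < 1]. *)
have v10 : `|v1 - v0| <= C * D * `|h|.
  have hx : `|x| + D <= Y by rewrite /Y lerD2r -addrA lerDl addr_ge0.
  have hr : `|r| + D <= Y by rewrite /Y lerD2r addrAC lerDr addr_ge0.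
  have hp : `|p| + D <= Y by rewrite /Y lerD2r lerDr addr_ge0.
  have y0 (a : R) : a + D <= Y -> a <= Y by apply: le_trans; rewrite lerDl.
  rewrite (le_trans (HC x r p _ _ _ _ _ _ _ _ _)) ?(y0 _ hx) ?(y0 _ hr) ?(y0 _ hp)//.
  - exact: le_trans (inY _ x dx h (lexx _) dxD) hx.
  - exact: le_trans (inY R^o r dr h (lexx _) drD) hr.
  - exact: le_trans (inY _ p dp h (lexx _) dpD) hp.
  rewrite -mulrA ler_wpM2l ?(ltW C0)// !addrK !normrZ ?normrM /D.
  by rewrite le_eqVlt; apply/orP; left; apply/eqP; ring.
(* Covers both sides of the trap, [w = v0] for the lower and [w = v1] for the upper bound; [B'] and
   [B] in [de] are the constants of its two terms. *)
have est w c : `|c| <= `|h| -> `|w - v0| <= C * D * `|h| ->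
    `|dotv dp w - G (x + c *: dx, r + c * dr, w) - l| <= e.
  move=> ch wv; have -> : dotv dp w - G (x + c *: dx, r + c * dr, w) - l =
      dotv dp (w - v0) - (G (x + c *: dx, r + c * dr, w) - G (x, r, v0)).
    rewrite dotvDr -[- v0]scaleN1r dotvZr mulN1r /l.
    exact: sub4.
  rewrite (le_trans (ler_normB _ _))// [leRHS]splitr; apply: lerD.
    rewrite (le_trans (dotv_norm_le _ _))//.
    apply: le_trans (ltW h3).
    apply: (@le_trans _ _ (n%:R * (`|dp| * (C * D * `|h|)))); first by rewrite !ler_wpM2l.
    have -> : n%:R * (`|dp| * (C * D * `|h|)) = `|h| * (n%:R * (`|dp| * (C * D))) by ring.
    by rewrite ler_wpM2l// lerDl.
  apply: Hrho; apply: le_lt_trans h2.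
  have hB (a : R) : a <= B -> a * `|h| <= `|h| * B by move=> aB; rewrite mulrC ler_wpM2l.
  have CD0 : 0 <= C * D by rewrite mulr_ge0// ltW.
  apply: phase_norm_le => /=.
  - rewrite addrAC subrr add0r normrZ mulrC; apply: le_trans (hB `|dx| _); first by rewrite ler_wpM2l.
    by rewrite (le_trans dxD)// /B -addrA lerDl addr_ge0.
  - rewrite addrAC subrr add0r normrM mulrC; apply: le_trans (hB `|dr| _); first by rewrite ler_wpM2l.
    by rewrite (le_trans drD)// /B -addrA lerDl addr_ge0.
  - by rewrite (le_trans wv)// hB// /B addrAC lerDr addr_ge0.
have mvt w : exists2 c : R, `|c| <= `|h| &
    L (h *: dx + x) (h * dr + r) w - L x r w = h * G (x + c *: dx, r + c * dr, w).
  have [c ch E0] := mvt_line (x, r, w) h G1; exists c => //.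
  by move: E0; rewrite !phase_line !scaler0 !addr0 [h *: dx + x]addrC [h * dr + r]addrC.
have [c0 c0h M0] := mvt v0; have [c1 c1h M1] := mvt v1.
have v00 : `|v0 - v0| <= C * D * `|h| by rewrite subrr normr0 !mulr_ge0// ltW.
apply: (between_arith _ _ (est v0 c0 c0h v00) (est v1 c1 c1h v10)).
  rewrite [H (_ + _) _ _]hamiltonianE [H x r p]hamiltonianE -/v0.
  rewrite lerBrDr; apply: le_trans (vel_maximizes _ _ _ v0).
  rewrite mulrBr -M0 [dotv (_ + p) v0]dotvC dotvDr dotvZr ![dotv v0 _]dotvC.
  by move: (dotv _ _) (dotv _ _) (L _ _ _) (L _ _ _) => *; lra.
rewrite [H (_ + _) _ _]hamiltonianE [H x r p]hamiltonianE -/v1.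
rewrite lerBlDr -lerBlDl; apply: le_trans (vel_maximizes _ _ _ v1).
rewrite mulrBr -M1 [dotv (_ + p) v1]dotvC dotvDr dotvZr ![dotv v1 _]dotvC.
by move: (dotv _ _) (dotv _ _) (L _ _ _) (L _ _ _) => *; lra.
Qed.

Lemma hamiltonian_quotient x r p dx dr dp :
  h^-1 *: ((H (h *: dx + x) (h * dr + r) (h *: dp + p) : R^o) - H x r p) @[h --> (0 : R)^'] -->
  (dotv dp (vel x r p) - (dotv (Dx L x r (vel x r p)) dx + Dr L x r (vel x r p) * dr) : R^o).
Proof.
have := @hamiltonian_envelope x r p dx dr dp.
by rewrite derive_phaseL//= dotv0 addr0.
Qed.

Lemma derivative_of_limit (W : normedModType R) (f : W -> R^o) y d l :
  h^-1 *: (f (h *: d + y) - f y) @[h --> (0 : R)^'] --> l ->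
  derivable f y d /\ 'D_d f y = l.
Proof. by move=> H0; split; [apply/cvg_ex; exists l|exact: cvg_lim H0]. Qed.

Lemma limit_congr (f g : R -> R^o) (l l' : R^o) : (forall h, f h = g h) -> l = l' ->
  f h @[h --> (0 : R)^'] --> l -> g h @[h --> (0 : R)^'] --> l'.
Proof. by move=> /funext -> ->. Qed.

Lemma hamiltonian_partials x r p (v := vel x r p) :
  [/\ has_partials H x r p, Dv H x r p = v, Dx H x r p = - Dx L x r v &
      Dr H x r p = - Dr L x r v].
Proof.
have ei (q : E) i : dotv q (evec i) = q 0 i by rewrite -[evec i]scale1r dotv_evec mul1r.
have hx i : derivable (fun y => H y r p : R^o) x (evec i) /\
    'D_(evec i) (fun y => H y r p : R^o) x = - Dx L x r v 0 i.
  apply: derivative_of_limit; apply: limit_congr (@hamiltonian_quotient x r p (evec i) 0 0) => [h|].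
    by rewrite mulr0 scaler0 !add0r.
  by rewrite dotvC dotv0 mulr0 addr0 sub0r ei.
have hp i : derivable (H x r : E -> R^o) p (evec i) /\
    'D_(evec i) (H x r : E -> R^o) p = v 0 i.
  apply: derivative_of_limit; apply: limit_congr (@hamiltonian_quotient x r p 0 0 (evec i)) => [h|].
    by rewrite mulr0 scaler0 !add0r.
  by rewrite dotv0 mulr0 addr0 subr0 dotvC ei.
have hr : derivable ((fun z : R => H x z p) : R^o -> R^o) r 1 /\
    'D_1 ((fun z : R => H x z p) : R^o -> R^o) r = - Dr L x r v.
  apply: derivative_of_limit; apply: limit_congr (@hamiltonian_quotient x r p 0 1 0) => [h|].
    by rewrite !scaler0 !add0r.
  by rewrite dotvC !dotv0 mulr1 !add0r.
split.
- by split => [i||i]; [have [] := hx i|have [] := hr|have [] := hp i].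
- by apply/rowP => i; rewrite mxE; have [_] := hp i.
- by apply/rowP => i; rewrite !mxE; have [_ ->] := hx i; rewrite mxE.
- by rewrite /Dr derive1E; have [_] := hr.
Qed.

End Envelope.

Theorem theorem1 (R : realType) (n : nat)
    (L : 'rV[R]_n -> R -> 'rV[R]_n -> R)
    (hC2 : C2_lagrangian L) (hL1 : cond_L1 L) (hL2 : cond_L2' L)
    (hL3 : cond_L3 L)
    (x0 x : 'rV[R]_n) (t u0 : R) (ht : 0 < t)
    (xi : R -> 'rV[R]_n) (u : R -> R)
    (hmin : minimizer L t u0 x0 x xi u) :
  let dxi := der t xi in
  let p := fun s => Dv L (xi s) (u s) (dxi s) in
  let H := hamiltonian L in
  [/\ Ck_on t 2 xi,
      Ck_on t 2 (u : R -> R^o) &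
      forall s, s \in `[0, t] ->
        has_der t p s
          (Dx L (xi s) (u s) (dxi s)
           + Dr L (xi s) (u s) (dxi s) *: Dv L (xi s) (u s) (dxi s))] /\
  (Ck_on t 2 p /\
   forall s, s \in `[0, t] ->
     [/\ has_partials H (xi s) (u s) (p s),
         has_der t xi s (Dv H (xi s) (u s) (p s)),
         has_der t p s
           (- Dx H (xi s) (u s) (p s) - Dr H (xi s) (u s) (p s) *: p s) &
         has_der t (u : R -> R^o) s
           (dotv (p s) (dxi s) - H (xi s) (u s) (p s))]).
Proof.
move=> dxi p H; have [K K0 hK] := hL3.
have [v [P [vP [C C0 vlip] hxi hu hP]]] := minimizer_flow ht hC2 hL1 hL2 K0 hK hmin.
have dxiE s : 0 <= s <= t -> dxi s = v s by move=> st; apply: has_der_der => //; exact: hxi.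
have pE s : 0 <= s <= t -> P s = p s by move=> st; rewrite /p dxiE// vP.
have hp s : 0 <= s <= t -> has_der t p s
    (Dx L (xi s) (u s) (v s) + Dr L (xi s) (u s) (v s) *: p s).
  by move=> st; rewrite -(pE s st); apply: has_der_eq st pE (hP s st).
split; first split.
- exact: (curve_C2 ht hC2 hL1 vP C0 vlip hxi hu hP).
- exact: (action_C2 ht hC2 hL1 vP C0 vlip hxi hu hP).
- move=> s; rewrite in_itv/= => st; have := hp s st.
  by rewrite /p dxiE.
split; first by apply: Ck_on_eq pE _; exact: (momentum_C2 ht hC2 hL1 vP C0 vlip hxi hu hP).
move=> s; rewrite in_itv/= => st.
(* Inverting [L_v(xi, u, v) = p] gives [v] back, so the derivatives of [H] in [p], [x] and [r] are
   [v], [- L_x] and [- L_r], and the Lie equation is the system of [minimizer_flow] rewritten. *)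
have velE : vel L (xi s) (u s) (p s) = v s.
  by apply: (vel_unique hC2 hL1 hL2 hK); rewrite vP// pE.
have [hpart hv hx hr] := hamiltonian_partials hC2 hL1 hL2 hK (xi s) (u s) (p s).
rewrite velE in hv hx hr; split => //.
- by rewrite hv; exact: hxi.
- by rewrite hx hr opprK scaleNr opprK; exact: hp.
- rewrite dxiE// /H (hamiltonianE hC2 hL1 hL2 hK) velE opprB addrC subrK; exact: hu.
Qed.
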